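(* Let assumptions A1, A2 and A3 (see context) be satisfied, and let $\mathcal D'$ be an arbitrary compact set contained in $\Omega_{c_1}$. Consider the closed-loop system formed by the extended system $\dot\chi=f_e(\chi)+g_e v$, $y=h_e(\chi)$, the projected observer with state $\hat x^P$ (see context), and the output feedback control law $v=\hat v=\phi(\hat x^P,z)$. Then there exists a scalar $\rho^*$, $0<\rho^*\le 1$, such that, for all $\rho\in(0,\rho^*]$, the set $\mathcal D'\times\Omega_{c_2}^x$ (initial conditions $(\chi(0),\hat x(0))$) is contained in the region of attraction of the origin $(x=0,z=0,\hat x=0)$.
   Context: Plant: $\dot x=f(x,u)$, $y=h(x,u)$, $x\in\mathbb{R}^n$, $u,y\in\mathbb{R}$, $f,h$ known smooth functions, $f(0,0)=0$. Observability mapping: let $\varphi_0=h$ and $\varphi_i=\frac{\partial\varphi_{i-1}}{\partial x}f(x,u)+\sum_{k\ge 0}\frac{\partial\varphi_{i-1}}{\partial u^{(k)}}u^{(k+1)}$, $i=1,\ldots,n-1$ ($u^{(0)}=u$). Let $n_u$, $0\le n_u\le n$, be such that $\varphi_0,\ldots,\varphi_{n-1}$ depend only on $x,u,\ldots,u^{(n_u-1)}$ ($n_u=0$: no dependence on $u$). Then $y_e:=[y,\dot y,\ldots,y^{(n-1)}]^\top=\mathcal H(x,u,\ldots,u^{(n_u-1)}):=[h,\varphi_1,\ldots,\varphi_{n-1}]^\top$. Extended system: $n_u$ integrators are added at the input, $u=z_1$, $\dot z_i=z_{i+1}$ ($i<n_u$), $\dot z_{n_u}=v$; $z=[z_1,\ldots,z_{n_u}]^\top$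 is known, $\mathcal H$ is written $\mathcal H(x,z)$, $\chi=[x^\top,z^\top]^\top\in\mathbb{R}^{n+n_u}$, and $\dot\chi=f_e(\chi)+g_ev$, $y=h_e(\chi)$ with $f_e(\chi)=[f^\top(x,z_1),z_2,\ldots,z_{n_u},0]^\top$, $g_e=[0,\ldots,0,1]^\top$, $h_e(\chi)=h(x,z_1)$. A1 (observability over $\mathcal X\times\mathcal U\subset\mathbb{R}^n\times\mathbb{R}^{n_u}$, a set containing the origin): $y_e=\mathcal H(x,z)$ is invertible with respect to $x$ with smooth inverse $x=\mathcal H^{-1}(y_e,z)$, for all $x\in\mathcal X$, $z\in\mathcal U$ (in particular $\partial\mathcal H/\partial x$ is invertible there). For a set $C$, $\mathcal H^{-1}(C,z)$ denotes $\{\mathcal H^{-1}(\xi,z):\xi\in C\}$. A2: the origin of the plant is locally (respectively globally) stabilizable by a static function of $x$, i.e. there is a smooth $\bar u(x)$ such that the origin is an asymptotically stable (respectively globally asymptotically stable) equilibrium of $\dot x=f(x,\bar u(x))$. Consequently there is a smooth control $v=\phi(x,z)=\phi(\chi)$, fixed from now on, making the origin of the extended system asymptotically stable with domain of attraction $\mathcal D$, and a continuously differentiable $V$ on $\mathcal D$ and class $\mathcal K$ functions $\alpha_1,\alpha_2,\alpha_3$ such that for all $\chi\in\mathcal D$: $\alpha_1(\|\chi\|)\le V(\chi)\le\alpha_2(\|\chi\|)$, $\lim_{\chi\to\partial\mathcal D}\alpha_1(\|\chi\|)=\infty$, and $\frac{\partial V}{\partial\chi}(f_e(\chi)+g_e\phi(\chi))\le-\alpha_3(\|\chi\|)$.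 For $c_2>c_1>0$ set $\Omega_{c_i}=\{\chi: V(\chi)\le c_i\}$ ($i=1,2$), $\Omega_{c_2}^x=\{x\in\mathbb{R}^n:\chi\in\Omega_{c_2}\}$, $\Omega_{c_2}^z=\{z\in\mathbb{R}^{n_u}:\chi\in\Omega_{c_2}\}$ (projections of $\Omega_{c_2}$ on the $x$ and $z$ components). A3: $c_2$ can be (and is) selected so that (1) $\mathcal H(\Omega_{c_2}^x,z)\subset C_\xi(z)\subset\mathcal H(\mathcal X,z)$ for all $z\in\Omega_{c_2}^z$, for some convex compact set $C_\xi(z)$; (2) $\Omega_{c_2}^z\subset\mathcal U$. Projected observer. $(A_c,B_c,C_c)$ is the canonical realization of dimension $n$: $A_c$ has ones on the first superdiagonal and zeros elsewhere, $B_c=[0,\ldots,0,1]^\top$, $C_c=[1,0,\ldots,0]$. $L\in\mathbb{R}^{n\times1}$ is such that $A_c-LC_c$ is Hurwitz; $P$ solves $P(A_c-LC_c)+(A_c-LC_c)^\top P=-I$; $S=S^\top$ is the matrix square root of $P$; $\rho\in(0,1]$ is a design constant; $\mathcal E=\mathrm{diag}[\rho,\rho^2,\ldots,\rho^n]$; $\mathcal E'=\mathrm{diag}[\rho^{-(n-1)},\rho^{-(n-2)},\ldots,1]$; $\Gamma=(S\mathcal E')^{-1}((S\mathcal E')^{-1})^\top$. The unprojected observer vector field is $$\dot{\hat x}=f(\hat x,z_1)+\left[\frac{\partial\mathcal H(\hat x,z)}{\partial\hat x}\right]^{-1}\mathcal E^{-1}L\,[y-h(\hat x,z_1)],$$ and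 with $\hat\xi=\mathcal H(\hat x,z)$ one sets $\dot{\hat\xi}=\frac{\partial\mathcal H}{\partial\hat x}\dot{\hat x}+\frac{\partial\mathcal H}{\partial z}\dot z$. Writing $C_\xi(z)=\{\xi:b(\xi,z)\le0\}$ with boundary $\partial C_\xi(z)=\{\xi:b(\xi,z)=0\}$, let $N(\hat\xi,z)=\nabla_\xi b(\hat\xi,z)$ and $N_z(\hat\xi,z)=\nabla_zb(\hat\xi,z)$ be the normal vectors to the boundary with respect to $\xi$ and $z$. The projected observer, with state $\hat x^P$ (the right-hand side being evaluated at $\hat x=\hat x^P$), is $$\dot{\hat x}^P=\left[\frac{\partial\mathcal H}{\partial\hat x}\right]^{-1}\left\{\mathcal P(\hat\xi,\dot{\hat\xi},z,\dot z)-\frac{\partial\mathcal H}{\partial z}\dot z\right\},$$ where $\mathcal P(\hat\xi,\dot{\hat\xi},z,\dot z)=\dot{\hat\xi}-\Gamma\frac{N\,(N^\top\dot{\hat\xi}+N_z^\top\dot z)}{N^\top\Gamma N}$ if $N^\top\dot{\hat\xi}+N_z^\top\dot z\ge0$ and $\hat\xi\in\partial C_\xi(z)$, and $\mathcal P=\dot{\hat\xi}$ otherwise. *)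

(* Defs.v *)
From HB Require Import structures.
From mathcomp Require Import all_boot all_order all_algebra.
From mathcomp Require Import all_classical all_reals all_analysis.
From mathcomp Require Import complex.

Set Implicit Arguments.
Unset Strict Implicit.
Unset Printing Implicit Defensive.
Import Order.TTheory GRing.Theory Num.Theory.
Import numFieldNormedType.Exports.
Local Open Scope classical_set_scope.
Local Open Scope ring_scope.

(* The library norm on matrices is the sup norm. *)
Definition enorm (R : realType) (m : nat) (x : 'cV[R]_m) : R :=
  Num.sqrt (\sum_i x i 0 ^+ 2).

(* On a finite-dimensional V and an open U this is C^oo: every iterated
   directional derivative is differentiable, hence continuous, on U. *)
Definition smooth_on (R : realType) (V W : normedModType R) (U : set V)
    (f : V -> W) : Prop :=
  forall (vs : seq V) (x : V), U x ->
    differentiable (foldr (fun v g => 'D_v g) f vs) x.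

Definition smooth (R : realType) (V W : normedModType R) (f : V -> W) : Prop :=
  smooth_on setT f.

Definition C1_on (R : realType) (V W : normedModType R) (U : set V)
    (f : V -> W) : Prop :=
  forall x, U x ->
    differentiable f x /\ forall v, {for x, continuous ('D_v f)}.

Definition jac (R : realType) (m p : nat) (F : 'cV[R]_p -> 'cV[R]_m)
    (x : 'cV[R]_p) : 'M[R]_(m, p) :=
  \matrix_(i, j) 'D_(delta_mx j 0) (fun x' => F x' i 0) x.

Definition grad (R : realType) (p : nat) (g : 'cV[R]_p -> R)
    (x : 'cV[R]_p) : 'cV[R]_p :=
  \col_j 'D_(delta_mx j 0) g x.

Definition boundary (T : topologicalType) (A : set T) : set T :=
  closure A `\` interior A.

(* Class K on [0, a), where a may be +oo. *)
Definition class_K (R : realType) (a : \bar R) (alpha : R -> R) : Prop :=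
  [/\ alpha 0 = 0,
      forall r s, 0 <= r -> r < s -> (s%:E < a)%E -> alpha r < alpha s
    & {within [set r | 0 <= r /\ (r%:E < a)%E], continuous alpha}].

(* Caratheodory solution on [0, T) of x' = F(x), in integral form (absolutely
   continuous, equation a.e.), for a field F whose state space is K. Fields
   considered here may be discontinuous. *)
Definition solution (R : realType) (m : nat) (K : set 'cV[R]_m)
    (F : 'cV[R]_m -> 'cV[R]_m) (T : \bar R) (x : R -> 'cV[R]_m) : Prop :=
  forall t : R, 0 <= t -> (t%:E < T)%E ->
    K (x t) /\
    forall i,
      lebesgue_measure.-integrable `[0, t] (EFin \o (fun s => F (x s) i 0)) /\
      x t i 0 = x 0 i 0
        + \int[lebesgue_measure]_(s in `[0, t]) F (x s) i 0.

(* Points from which a complete solution exists, every solution extends to a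
   complete one, and every complete solution tends to the origin. *)
Definition region_of_attraction (R : realType) (m : nat) (K : set 'cV[R]_m)
    (F : 'cV[R]_m -> 'cV[R]_m) : set 'cV[R]_m :=
  [set p |
    [/\ exists x, solution K F +oo%E x /\ x 0 = p,
        forall T x, (0 < T)%E -> solution K F T x -> x 0 = p ->
          exists y, solution K F +oo%E y /\
            forall t, 0 <= t -> (t%:E < T)%E -> y t = x t
      & forall x, solution K F +oo%E x -> x 0 = p ->
          x t @[t --> +oo%R] --> (0 : 'cV[R]_m)]].

Definition lyapunov_stable (R : realType) (m : nat) (K : set 'cV[R]_m)
    (F : 'cV[R]_m -> 'cV[R]_m) : Prop :=
  forall eps : R, 0 < eps -> exists2 delta : R, 0 < delta &
    forall T x, solution K F T x -> enorm (x 0) < delta ->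
      forall t, 0 <= t -> (t%:E < T)%E -> enorm (x t) < eps.

Definition asymptotically_stable (R : realType) (m : nat) (K : set 'cV[R]_m)
    (F : 'cV[R]_m -> 'cV[R]_m) : Prop :=
  [/\ K 0 /\ F 0 = 0,
      lyapunov_stable K F
    & exists2 r : R, 0 < r &
        forall p, K p -> enorm p < r -> region_of_attraction K F p].

Definition stabilizable (R : realType) (n : nat)
    (f : 'cV[R]_n -> R -> 'cV[R]_n) : Prop :=
  exists ubar : 'cV[R]_n -> R,
    smooth ubar /\ asymptotically_stable setT (fun x => f x (ubar x)).

(* obs_coord f h i x w is the i-th formal time derivative of h along the plant,
   w k standing for the k-th time derivative of u. It does not depend on
   w k for k > i, so the sum over all k >= 0 reduces to k <= i. *)
Fixpoint obs_coord (R : realType) (n : nat) (f : 'cV[R]_n -> R -> 'cV[R]_n)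
    (h : 'cV[R]_n -> R -> R) (i : nat) (x : 'cV[R]_n) (w : nat -> R) : R :=
  if i is j.+1 then
    'D_(f x (w 0%N)) (fun x' => obs_coord f h j x' w) x
    + \sum_(k < j.+1)
        derive1 (fun s : R =>
           obs_coord f h j x (fun l => if l == k then s else w l)) (w k)
        * w k.+1
  else h x (w 0%N).

Definition depends_on_first (R : realType) (n : nat)
    (f : 'cV[R]_n -> R -> 'cV[R]_n) (h : 'cV[R]_n -> R -> R) (nu : nat) : Prop :=
  forall (i : nat) (x : 'cV[R]_n) (w w' : nat -> R), (i < n)%N ->
    (forall k, (k < nu)%N -> w k = w' k) ->
    obs_coord f h i x w = obs_coord f h i x w'.

(* The integrator chain: entries z_1, ..., z_nu of z, then the new input v.
   Thus u is entry 0 and the derivative of z_(i+1) is entry i+1; when nu = 0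
   there is no integrator and u = v. *)
Definition chain (R : realType) (nu : nat) (z : 'cV[R]_nu) (v : R) (k : nat) : R :=
  oapp (fun i : 'I_nu => z i 0) v (insub k).

Definition zdot (R : realType) (nu : nat) (z : 'cV[R]_nu) (v : R) : 'cV[R]_nu :=
  \col_i chain z v i.+1.

Definition obs_map (R : realType) (n nu : nat) (f : 'cV[R]_n -> R -> 'cV[R]_n)
    (h : 'cV[R]_n -> R -> R) (x : 'cV[R]_n) (z : 'cV[R]_nu) : 'cV[R]_n :=
  \col_(i < n) obs_coord f h i x (chain z 0).

Definition ext_field (R : realType) (n nu : nat)
    (f : 'cV[R]_n -> R -> 'cV[R]_n) (chi : 'cV[R]_(n + nu)) (v : R) :
    'cV[R]_(n + nu) :=
  let x := usubmx chi in let z := dsubmx chi in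
  col_mx (f x (chain z v 0)) (zdot z v).

Definition ext_output (R : realType) (n nu : nat) (h : 'cV[R]_n -> R -> R)
    (chi : 'cV[R]_(n + nu)) (v : R) : R :=
  h (usubmx chi) (chain (dsubmx chi) v 0).

(* For nu >= 1 the extended system is f_e(chi) + g_e v. *)
Lemma ext_fieldE (R : realType) (n nu : nat)
    (f : 'cV[R]_n -> R -> 'cV[R]_n) (chi : 'cV[R]_(n + nu.+1)) (v : R) :
  ext_field f chi v =
    col_mx (f (usubmx chi) (dsubmx chi ord0 0))
           (\col_i if insub i.+1 is Some j then dsubmx chi j 0 else 0)
    + v *: col_mx 0 (delta_mx ord_max 0).
Proof.
rewrite /ext_field /chain insubT /= scale_col_mx scaler0 add_col_mx addr0.
congr col_mx; first by congr (f _ (_ _ _)); apply: val_inj.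
apply/matrixP => i j; rewrite !mxE ord1 eqxx andbT /chain.
case: insubP => [k ltk _|] /=.
  rewrite (_ : (i == ord_max) = false) ?mulr0 ?addr0 //.
  by apply/negbTE/eqP => ei; move: ltk; rewrite ei ltnn.
rewrite -leqNgt ltnS => lei.
rewrite (_ : (i == ord_max) = true) ?mulr1 ?add0r //.
by apply/eqP/val_inj/anti_leq; rewrite /= lei andbT -ltnS.
Qed.

Definition observable (R : realType) (n nu : nat)
    (H : 'cV[R]_n -> 'cV[R]_nu -> 'cV[R]_n)
    (X : set 'cV[R]_n) (U : set 'cV[R]_nu) : Prop :=
  [/\ X 0 /\ U 0,
      exists (Hinv : 'cV[R]_n -> 'cV[R]_nu -> 'cV[R]_n)
             (O : set ('cV[R]_n * 'cV[R]_nu)%type),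
        [/\ open O, smooth_on O (fun p => Hinv p.1 p.2)
          & forall x z, X x -> U z -> O (H x z, z) /\ Hinv (H x z) z = x]
    & forall x z, X x -> U z -> jac (H ^~ z) x \in unitmx].

(* V is a Lyapunov function for chi' = F(chi) on D. The limit as chi tends to
   the boundary of D includes chi going to infinity when D is unbounded. *)
Definition lyapunov_function (R : realType) (m : nat)
    (F : 'cV[R]_m -> 'cV[R]_m) (D : set 'cV[R]_m) (V : 'cV[R]_m -> R)
    (a : \bar R) (alpha1 alpha2 alpha3 : R -> R) : Prop :=
  [/\ open D /\ C1_on D V,
      [/\ class_K a alpha1, class_K a alpha2 & class_K a alpha3],
      (forall chi, D chi -> ((enorm chi)%:E < a)%E),
      (forall M : R, exists Q : set 'cV[R]_m, [/\ compact Q, Q `<=` D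
         & forall chi, D chi -> ~ Q chi -> M < alpha1 (enorm chi)])
    & forall chi, D chi ->
        [/\ alpha1 (enorm chi) <= V chi, V chi <= alpha2 (enorm chi)
          & 'D_(F chi) V chi <= - alpha3 (enorm chi)]].

Definition sublevel (R : realType) (m : nat) (D : set 'cV[R]_m)
    (V : 'cV[R]_m -> R) (c : R) : set 'cV[R]_m :=
  [set chi | D chi /\ V chi <= c].

(* The inclusion of Ox in X expresses that H is used on the domain X on which
   it is invertible. *)
Definition admissible_sets (R : realType) (n nu : nat)
    (H : 'cV[R]_n -> 'cV[R]_nu -> 'cV[R]_n)
    (X : set 'cV[R]_n) (U : set 'cV[R]_nu)
    (Ox : set 'cV[R]_n) (Oz : set 'cV[R]_nu)
    (C : 'cV[R]_nu -> set 'cV[R]_n) : Prop :=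
  [/\ forall z, Oz z ->
        [/\ [set H x z | x in Ox] `<=` C z, C z `<=` [set H x z | x in X],
            @convex_set R 'cV[R]_n (C z) & compact (C z)],
      Ox `<=` X & Oz `<=` U].

Definition boundary_function (R : realType) (n nu : nat)
    (Oz : set 'cV[R]_nu) (C : 'cV[R]_nu -> set 'cV[R]_n)
    (b : 'cV[R]_n -> 'cV[R]_nu -> R) : Prop :=
  C1_on setT (fun p : ('cV[R]_n * 'cV[R]_nu)%type => b p.1 p.2) /\
  forall z, Oz z ->
    [/\ C z = [set xi | b xi z <= 0],
        boundary (C z) = [set xi | b xi z = 0]
      & forall xi, b xi z = 0 -> grad (b ^~ z) xi != 0].

Definition Ac (R : realType) (n : nat) : 'M[R]_n :=
  \matrix_(i, j) (j == i.+1 :> nat)%:R.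

Definition Cc (R : realType) (n : nat) : 'rV[R]_n :=
  \row_j (j == 0 :> nat)%:R.

Definition hurwitz (R : realType) (n : nat) (A : 'M[R]_n) : Prop :=
  forall lambda : R[i],
    eigenvalue (map_mx (real_complex R) A) lambda -> complex.Re lambda < 0.

Definition Erho (R : realType) (n : nat) (rho : R) : 'M[R]_n :=
  diag_mx (\row_i rho ^+ i.+1).

Definition E'rho (R : realType) (n : nat) (rho : R) : 'M[R]_n :=
  diag_mx (\row_i rho ^- (n - i.+1)).

Definition Gam (R : realType) (n : nat) (S : 'M[R]_n) (rho : R) : 'M[R]_n :=
  let M := invmx (S *m E'rho n rho) in M *m M^T.

Definition observer_field (R : realType) (n nu : nat)
    (f : 'cV[R]_n -> R -> 'cV[R]_n) (h : 'cV[R]_n -> R -> R) (L : 'cV[R]_n)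
    (rho : R) (xh : 'cV[R]_n) (z : 'cV[R]_nu) (v y : R) : 'cV[R]_n :=
  let u := chain z v 0 in
  f xh u + (y - h xh u) *:
    (invmx (jac (obs_map f h ^~ z) xh) *m invmx (Erho n rho) *m L).

Definition projection (R : realType) (n nu : nat) (G : 'M[R]_n)
    (b : 'cV[R]_n -> 'cV[R]_nu -> R)
    (xi dxi : 'cV[R]_n) (z dz : 'cV[R]_nu) : 'cV[R]_n :=
  let N := grad (b ^~ z) xi in
  let Nz := grad (b xi) z in
  let rate := (N^T *m dxi + Nz^T *m dz) 0 0 in
  if (0 <= rate) && (b xi z == 0)
  then dxi - (rate / (N^T *m G *m N) 0 0) *: (G *m N)
  else dxi.

Definition projected_observer_field (R : realType) (n nu : nat)
    (f : 'cV[R]_n -> R -> 'cV[R]_n) (h : 'cV[R]_n -> R -> R) (L : 'cV[R]_n)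
    (S : 'M[R]_n) (b : 'cV[R]_n -> 'cV[R]_nu -> R)
    (rho : R) (xh : 'cV[R]_n) (z : 'cV[R]_nu) (v y : R) : 'cV[R]_n :=
  let Hx := jac (obs_map f h ^~ z) xh in
  let Hz := jac (obs_map f h xh) z in
  let dz := zdot z v in
  let dxi := Hx *m observer_field f h L rho xh z v y + Hz *m dz in
  invmx Hx *m (projection (Gam S rho) b (obs_map f h xh z) dxi z dz - Hz *m dz).

(* State (chi, xhat) with chi = (x, z). *)
Definition closed_loop (R : realType) (n nu : nat)
    (f : 'cV[R]_n -> R -> 'cV[R]_n) (h : 'cV[R]_n -> R -> R)
    (phi : 'cV[R]_(n + nu) -> R) (L : 'cV[R]_n) (S : 'M[R]_n)
    (b : 'cV[R]_n -> 'cV[R]_nu -> R) (rho : R)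
    (s : 'cV[R]_(n + nu + n)) : 'cV[R]_(n + nu + n) :=
  let chi := usubmx s in
  let z := dsubmx chi in
  let xh := dsubmx s in
  let v := phi (col_mx xh z) in
  col_mx (ext_field f chi v)
    (projected_observer_field f h L S b rho xh z v (ext_output h chi v)).

(* The projection prescribes the motion of xihat = H(xhat, z) inside C(z) and on
   its boundary; this is the state space of the closed loop. It cannot be
   dropped: the formula also assigns a (non-projected) velocity outside C(z),
   and since the field is discontinuous across the boundary, Caratheodory
   solutions of the unconstrained equation may leave C(z). That solutions
   remaining in C(z) exist is part of region_of_attraction. *)
Definition closed_loop_states (R : realType) (n nu : nat)
    (f : 'cV[R]_n -> R -> 'cV[R]_n) (h : 'cV[R]_n -> R -> R)
    (C : 'cV[R]_nu -> set 'cV[R]_n) : set 'cV[R]_(n + nu + n) :=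
  [set s | let z := dsubmx (usubmx s) in C z (obs_map f h (dsubmx s) z)].

(* Main.v *)
Require Import Defs.
From HB Require Import structures.
From mathcomp Require Import all_boot all_order all_algebra.
From mathcomp Require Import all_classical all_reals all_analysis.
From mathcomp Require Import ring lra.
Set Implicit Arguments.
Unset Strict Implicit.
Unset Printing Implicit Defensive.
Import Order.TTheory GRing.Theory Num.Theory.
Import numFieldNormedType.Exports.
Local Open Scope classical_set_scope.
Local Open Scope ring_scope.

(* The proof follows trajectories of the closed loop with state s = (chi, xhat).

   - The set [branch] of states with chi in Omega c2, xhat in X and
     H(xhat, z) in C(z) is compact, because the convex sets C(z) are bounded
     uniformly in z, and it is open relative to the constraint, because
     H(., z) is locally injective.
   - On it the projected field is a field F0 reflected at the level set
     {b = 0}: the outward speed rate = D_F0 b is cancelled along the push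
     direction. Solutions exist as ultralimits, when k grows, of Peano
     solutions of the penalised fields F0 - rate^+ * ramp(k b) * push.
   - For the error e = H(xhat, z) - H(x, z), the projection does not increase
     W = |S E' e|^2, since C(z) is convex and subtracting Gam N is orthogonal
     projection for the inner product of S E'. With the high gain, W' <= - (c / rho) W, so that |e(t)| is at
     most q rho^-n |e(0)| exp(- c t / (2 rho)).
   - V' <= - alpha3 + k |e| with k independent of rho. On a short initial
     interval, V grows at a rate that does not depend on rho; afterwards the
     integral of |e| is small when rho is. Hence V stays below (c1 + c2) / 2,
     the state never leaves [branch], and both e and V tend to 0. *)

(** * Dini derivatives *)

(** [region_of_attraction] quantifies over every Caratheodory solution of a discontinuous field:
    solutions need not be unique and no flow is available. Existence is therefore kept apart from
    the estimates, which are proved for an arbitrary integral solution by means of upper right Dini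
    derivatives. The estimates hold only on [branch], and it is they that keep the solution there.
    An induction on real time breaks this circle. The factor rho^-n is the peaking of a high-gain
    observer. A bound on V that used the decay of e from time 0 on would contain its integral, of
    order rho^(1-n). Hence the initial window: there e is bounded only by the compactness of
    [branch], uniformly in rho, and this bound is what the projection buys. The length tau of the
    window is fixed before rho, after which exp(- c tau / (2 rho)) beats rho^-n. *)

Lemma real_induction (R : realType) (a b : R) (P : R -> Prop) : a <= b ->
  (forall t, a <= t -> t <= b -> (forall r, a <= r -> r < t -> P r) -> P t) ->
  (forall t, a <= t -> t < b -> (forall r, a <= r -> r <= t -> P r) ->
     exists2 d : R, 0 < d & forall r, t < r -> r < t + d -> r <= b -> P r) ->
  forall t, a <= t -> t <= b -> P t.
Proof.
move=> ab left_step right_step.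
(* The ends of the initial segments on which P holds: the left step puts [sup S] into S, the right
   step makes it equal to b. *)
pose S : set R := [set t | [/\ a <= t, t <= b & forall r, a <= r -> r <= t -> P r]].
have Sa : S a.
  split=> // r ar ra; have -> : r = a by apply: le_anti; rewrite ra ar.
  by apply: left_step => // r' ar' /(le_lt_trans ar'); rewrite ltxx.
have Sub : ubound S b by move=> t [].
have hS : has_sup S by split; [exists a | exists b].
have am : a <= sup S by apply: (ub_le_sup hS.2).
have mb : sup S <= b by apply: ge_sup => //; exists a.
have Pm r : a <= r -> r < sup S -> P r.
  move=> ar rm; have [t St rt] := sup_adherent (eps := sup S - r) ltac:(by rewrite subr_gt0) hS.
  by case: St => _ _; apply => //; apply: ltW; move: rt; rewrite opprB addrC subrK.
have Sm : S (sup S).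
  split=> // r ar; rewrite le_eqVlt => /orP[/eqP->|]; last exact: Pm.
  exact: left_step.
have [bm|mb'] := leP b (sup S).
  move=> t at_ tb; case: Sm => _ _; apply => //; exact: le_trans bm.
case: Sm => _ _ Pm'.
have [d d0 Pd] := right_step _ am mb' Pm'.
pose m' := Num.min (sup S + d / 2) b.
have mm' : sup S < m' by rewrite /m' lt_min mb' ltrDl divr_gt0.
have : S m'.
  split; [exact: le_trans (ltW mm')|by rewrite /m' ge_min lexx orbT|].
  move=> r ar rm'; have [|mr] := leP r (sup S); first exact: Pm'.
  apply: Pd => //; last by apply: le_trans rm' _; rewrite /m' ge_min lexx orbT.
  apply: le_lt_trans rm' _; rewrite /m' gt_min ltrD2l.
  by apply/orP; left; rewrite ltr_pdivrMr// mulr_natr mulr2n ltrDl.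
by move=> /(ub_le_sup hS.2); rewrite leNgt mm'.
Qed.

(** Left limits carry an estimate to the supremum in [real_induction]; right derivatives carry it
    beyond. *)
Definition lcont (R : realType) (W : normedModType R) (q : R -> W) (t : R) :=
  q r @[r --> t^'-] --> q t.

Lemma lcontP (R : realType) (W : normedModType R) (q : R -> W) (t : R) :
  lcont q t <-> forall e : R, 0 < e -> exists2 d : R, 0 < d &
    forall r : R, t - d < r -> r <= t -> `|q r - q t| < e.
Proof.
split=> [/cvgrPdist_lt H e e0|H].
  have /nbhs_ballP[d /= d0 Hd] := H e e0.
  exists d => // r tr; rewrite le_eqVlt => /orP[/eqP->|rt]; first by rewrite subrr normr0.
  rewrite distrC; apply: (Hd r _ rt) => /=.
  by rewrite /ball /= gtr0_norm ?subr_gt0//; lra.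
apply/cvgrPdist_lt => e e0; have [d d0 Hd] := H e e0.
apply/nbhs_ballP; exists d => //= r; rewrite /ball /= => br rt.
rewrite distrC; apply: Hd; last exact: ltW.
by move: br; rewrite gtr0_norm ?subr_gt0//; lra.
Qed.

Lemma lcont_comp (R : realType) (W W' : normedModType R) (q : R -> W) (g : W -> W') (t : R) :
  lcont q t -> {for q t, continuous g} -> lcont (g \o q) t.
Proof. by move=> lq cg; apply: cvg_comp lq cg. Qed.

Lemma continuous_lcont (R : realType) (W : normedModType R) (q : R -> W) (t : R) :
  {for t, continuous q} -> lcont q t.
Proof. by move=> cq; apply: cvg_at_left_filter. Qed.

(** Right derivatives are what reflected solutions have: along them the field is only right
    continuous. The nonstrict estimate avoids quotients and passes to limits of q. *)
Definition rder (R : realType) (W : normedModType R) (q : R -> W) (t : R) (v : W) :=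
  forall e : R, 0 < e -> exists2 d : R, 0 < d &
    forall h : R, 0 < h -> h < d -> `|q (t + h) - q t - h *: v| <= e * h.

(* The upper right Dini derivative of q at t is at most c. *)
Definition rdle (R : realType) (q : R -> R) (t c : R) :=
  forall e : R, 0 < e -> exists2 d : R, 0 < d &
    forall h : R, 0 < h -> h < d -> q (t + h) - q t <= (c + e) * h.

(** Real induction on [q t - q a <= (c + e) * (t - a)]: left continuity closes the estimate at t,
    the slack e absorbs the Dini bound to the right. It serves as the mean value inequality. *)
Lemma rdle_le (R : realType) (q : R -> R) (a b c : R) : a <= b ->
  (forall t, a < t -> t <= b -> lcont q t) ->
  (forall t, a <= t -> t < b -> rdle q t c) ->
  q b - q a <= c * (b - a).
Proof.
move=> ab lc rd; apply/ler_addgt0Pr => e0 e00.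
pose e := e0 / (b - a + 1).
have ba1 : 0 < b - a + 1 by rewrite ltr_wpDl ?subr_ge0.
have e_gt0 : 0 < e by rewrite divr_gt0.
have : q b - q a <= (c + e) * (b - a).
  apply: (@real_induction R a b (fun t => q t - q a <= (c + e) * (t - a))) => //.
    move=> t at_ tb IH; have [ta|at'] := leP t a.
      by have -> : t = a by [apply: le_anti; rewrite ta at_]; rewrite !subrr mulr0.
    apply/ler_addgt0Pr => eta eta0.
    have k0 : 0 < `|c + e| + 1 by rewrite ltr_wpDl.
    have eta20 : 0 < eta / 2 by rewrite divr_gt0.
    have [d d0 Hd] := (lcontP q t).1 (lc t at' tb) _ eta20.
    (* A point so close to the left of t that q and the linear bound each change by at most
       [eta / 2] between r and t. *)
    pose r := Num.max a (t - Num.min (d / 2) (eta / 2 / (`|c + e| + 1))).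
    have m0 : 0 < Num.min (d / 2) (eta / 2 / (`|c + e| + 1)).
      by rewrite lt_min !divr_gt0.
    have rt : r < t by rewrite /r gt_max at' /= ltrBlDr ltrDl.
    have ar : a <= r by rewrite /r le_max lexx.
    have rr : t - r <= Num.min (d / 2) (eta / 2 / (`|c + e| + 1)).
      by rewrite lerBlDr addrC -lerBlDr /r le_max lexx orbT.
    have := Hd r _ (ltW rt); have -> : t - d < r.
      have : t - r <= d / 2 by apply: le_trans rr _; rewrite ge_min lexx.
      by move=> ?; lra.
    move=> /(_ isT) /ltW; rewrite ler_norml => /andP[h1 h2].
    have IHr := IH r ar rt.
    have h3 : (c + e) * (r - t) <= eta / 2.
      have : t - r <= eta / 2 / (`|c + e| + 1) by apply: le_trans rr _; rewrite ge_min lexx orbT.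
      rewrite ler_pdivlMr // => h4; apply: le_trans h4.
      have : - (c + e) <= `|c + e| by rewrite -normrN ler_norm.
      have : 0 < t - r by rewrite subr_gt0.
      by move: (`|c + e|) => k; nra.
    nra.
  move=> t at_ tb IH; have [d d0 Hd] := rd t at_ tb _ e_gt0.
  exists d => // r tr rd' _; have := Hd (r - t); rewrite subr_gt0 ltrBlDr (addrC d).
  have -> : t + (r - t) = r by ring.
  move=> /(_ tr rd'); have := IH t at_ (lexx _); lra.
move=> /le_trans; apply; rewrite mulrDl lerD2l /e mulrAC ler_pdivrMr //.
by rewrite ler_pM2l // lerDl.
Qed.

(** Gronwall: [expR (c * (t - a)) * q t] has upper right Dini derivative at most 0. Nonnegativity of
    q allows [1 - c * h] to be bounded by [expR (- (c * h))] in front of [q t]. *)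
Lemma rdle_expR_le (R : realType) (q : R -> R) (a b c : R) : a <= b -> 0 <= c ->
  (forall t, a < t -> t <= b -> lcont q t) ->
  (forall t, a <= t -> t < b -> 0 <= q t) ->
  (forall t, a <= t -> t < b -> rdle q t (- c * q t)) ->
  q b <= expR (- (c * (b - a))) * q a.
Proof.
move=> ab c0 lc q0 rd.
pose g t := expR (c * (t - a)) * q t.
have : g b - g a <= 0 * (b - a).
  apply: rdle_le => // t at_ tb.
    apply: cvgM; last exact: lc.
    apply: (@continuous_lcont _ _ (fun s => expR (c * (s - a)))).
    apply: (@continuous_comp _ _ _ (fun s => c * (s - a)) expR); last exact: continuous_expR.
    apply: cvgM; first exact: cvg_cst.
    by apply: cvgB; [exact: cvg_id|exact: cvg_cst].
  move=> e e0; pose E := expR (c * (t - a)).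
  have E0 : 0 < E by exact: expR_gt0.
  have eE0 : 0 < e / (2 * E) by rewrite divr_gt0 // mulr_gt0.
  have [d d0 Hd] := rd t at_ tb _ eE0.
  have ln20 : 0 < ln 2 :> R by rewrite ln_gt0 // ltr1n.
  have c10 : 0 < c + 1 by rewrite ltr_wpDl.
  (* Up to this h one has [expR (c * h) <= 2], so the integrating factor at most doubles the error
     [e / (2 * E)]. *)
  exists (Num.min d (ln 2 / (c + 1))); first by rewrite lt_min d0 divr_gt0.
  move=> h h0; rewrite lt_min => /andP[hd h2].
  have := Hd h h0 hd; have := q0 t at_ tb.
  rewrite add0r /g -/E.
  have -> : c * (t + h - a) = c * (t - a) + c * h by ring.
  rewrite expRD -/E -mulrA -mulrBr => qt qh.
  have ch0 : 0 <= c * h by rewrite mulr_ge0 // ltW.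
  have e1 : expR (c * h) * (1 - c * h) <= 1.
    rewrite -[leRHS](expR0 R) -(subrr (c * h)) expRD ler_pM2l ?expR_gt0 //.
    by rewrite expR_ge1Dx.
  have e2 : expR (c * h) <= 2.
    rewrite -[leRHS]lnK ?posrE ?ltr0n // ler_expR.
    rewrite ltr_pdivlMr // in h2; apply: le_trans (ltW h2).
    by rewrite mulrC ler_wpM2l ?(ltW h0) // lerDl.
  have e3 : 1 <= expR (c * h) by rewrite -[leLHS](expR0 R) ler_expR.
  have qh' : q (t + h) <= q t * (1 - c * h) + e / (2 * E) * h by nra.
  have : expR (c * h) * q (t + h) <= q t + 2 * (e / (2 * E) * h).
    apply: (@le_trans _ _ (expR (c * h) * (q t * (1 - c * h) + e / (2 * E) * h))).
      by rewrite ler_pM2l // expR_gt0.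
    rewrite mulrDr; apply: lerD.
      by rewrite mulrCA -[leRHS]mulr1 ler_wpM2l.
    by rewrite ler_wpM2r // mulr_ge0 // ltW.
  have -> : 2 * (e / (2 * E) * h) = e * h / E by field; lra.
  rewrite -lerBlDl => H; have := ler_wpM2l (ltW E0) H.
  by rewrite (mulrC E (_ / _)) divfK ?gt_eqF.
rewrite mul0r /g subrr mulr0 expR0 mul1r subr_le0 => H.
have -> : q b = expR (- (c * (b - a))) * (expR (c * (b - a)) * q b).
  by rewrite mulrA -expRD addNr expR0 mul1r.
by rewrite ler_pM2l // expR_gt0.
Qed.

(** * Peano existence by ultralimits *)

Lemma cV_norm_le (R : realType) (m : nat) (v : 'cV[R]_m) (e : R) : 0 <= e ->
  (`|v| <= e) <-> (forall i, `|v i 0| <= e).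
Proof.
move=> e0; split=> [vle i|H].
  apply: le_trans vle; rewrite [leRHS]/Num.Def.normr /= mx_normrE.
  exact: (@le_bigmax _ _ _ 0 (fun k => `|v k.1 k.2|) (i, 0)).
rewrite [leLHS]/Num.Def.normr /= mx_normrE.
by apply: bigmax_le => // -[i j] _ /=; rewrite ord1.
Qed.

Lemma cV_norm_lt (R : realType) (m : nat) (v : 'cV[R]_m) (e : R) : 0 < e ->
  (`|v| < e) <-> (forall i, `|v i 0| < e).
Proof.
move=> e0; split=> [vle i|H].
  by apply: le_lt_trans vle; apply: (cV_norm_le v (normr_ge0 v)).1.
rewrite [ltLHS]/Num.Def.normr /= mx_normrE.
by apply: bigmax_lt => // -[i j] _ /=; rewrite ord1.
Qed.

Lemma cV_coord_le (R : realType) (m : nat) (v : 'cV[R]_m) i : `|v i 0| <= `|v|.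
Proof. exact: (cV_norm_le v (normr_ge0 v)).1. Qed.

(** The norm of a column is the sup norm, so it is enough to apply [rdle_le] to each coordinate and
    to its opposite, encoded by the sign s. *)
Lemma rder_incr (R : realType) (m : nat) (q : R -> 'cV[R]_m) (a b : R) (v : 'cV[R]_m) (c : R) :
  a <= b -> 0 <= c ->
  (forall t, a < t -> t <= b -> lcont q t) ->
  (forall t, a <= t -> t < b -> exists2 w, rder q t w & `|w - v| <= c) ->
  `|q b - q a - (b - a) *: v| <= c * (b - a).
Proof.
move=> ab c0 lc rd; apply/cV_norm_le; first by rewrite mulr_ge0 ?subr_ge0.
move=> i; rewrite !mxE ler_norml.
have lci (s : bool) t : a < t -> t <= b -> lcont (fun t => (-1) ^+ s * q t i 0) t.
  move=> at_ tb; apply: cvgM; first exact: cvg_cst.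
  apply: (@lcont_comp _ _ _ q (fun x : 'cV_m => x i 0)); first exact: lc.
  exact: coord_continuous.
have H (s : bool) : (-1) ^+ s * q b i 0 - (-1) ^+ s * q a i 0 <= ((-1) ^+ s * v i 0 + c) * (b - a).
  apply: (@rdle_le R (fun t => (-1) ^+ s * q t i 0)) => //; first exact: lci.
  move=> t at_ tb e e0; have [w rw wv] := rd t at_ tb; have [d d0 Hd] := rw e e0.
  exists d => // h h0 hd; have := Hd h h0 hd.
  move=> /(cV_norm_le _ (mulr_ge0 (ltW e0) (ltW h0))).1 /(_ i).
  have := (cV_norm_le _ c0).1 wv i.
  rewrite !mxE !ler_norml => /andP[h1 h2] /andP[h3 h4].
  by case: (s); rewrite ?expr0 ?expr1; nra.
have := H true; have := H false; rewrite expr0 expr1.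
by move=> h1 h2; apply/andP; split; lra.
Qed.

(** An ultrafilter decides, for each x, whether [u k i 0] is eventually above x; the limit of a
    coordinate is the supremum of the x for which it is. One ultrafilter fixed in advance gives
    limits at all times at once, without diagonal extraction. *)
Lemma ultra_bounded_cvg (R : realType) (U : set_system nat) (m : nat) (u : nat -> 'cV[R]_m) (M : R) :
  UltraFilter U -> (forall k, `|u k| <= M) ->
  exists l : 'cV[R]_m, forall e : R, 0 < e -> \forall k \near U, `|u k - l| < e.
Proof.
move=> UU uM.
have M0 : 0 <= M := le_trans (normr_ge0 (u 0%N)) (uM 0%N).
have H i : exists l : R, forall e : R, 0 < e -> \forall k \near U, `|u k i 0 - l| < e.
  have uMi k : `|u k i 0| <= M by apply: (cV_norm_le _ M0).1.
  pose S : set R := [set x | \forall k \near U, x <= u k i 0].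
  have hS : has_sup S.
    split; first by exists (- M); apply: nearW => k; have := uMi k; rewrite ler_norml => /andP[].
    exists M => x /filter_ex[k xk]; apply: le_trans xk _.
    by have := uMi k; rewrite ler_norml => /andP[].
  exists (sup S) => e e0.
  have [x Sx xe] := sup_adherent e0 hS.
  have : ~ S (sup S + e / 2).
    by move=> /(ub_le_sup hS.2); rewrite gerDl leNgt divr_gt0.
  have [//|nS _] := in_ultra_setVsetC [set k | sup S + e / 2 <= u k i 0] UU.
  apply: filterS2 Sx nS => k xk /negP; rewrite -ltNge => ku.
  by rewrite ltr_norml; apply/andP; split; lra.
have [l Hl] := choice H.
exists (\col_i l i) => e e0.
have Hf := @filter_forall _ _ (fun i k => `|u k i 0 - l i| < e) U _ (fun i => Hl i e e0).
near=> k; apply/cV_norm_lt => // i; rewrite !mxE; move: i; near: k; exact: Hf.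
Unshelve. all: by end_near. Qed.

Lemma natultra : exists U : set_system nat, UltraFilter U /\ \oo `<=` U.
Proof. exact: ultraFilterLemma. Qed.

Section euler.
Variables (R : realType) (m : nat) (G : 'cV[R]_m -> 'cV[R]_m) (x0 : 'cV[R]_m).

Definition euler (d : R) (j : nat) : 'cV[R]_m := iter j (fun x => x + d *: G x) x0.

Lemma euler_incr (d c : R) (v : 'cV[R]_m) (p q : nat) : 0 <= d -> (p <= q)%N ->
  (forall j, (p <= j < q)%N -> `|G (euler d j) - v| <= c) ->
  `|euler d q - euler d p - ((q - p)%:R * d) *: v| <= c * ((q - p)%:R * d).
Proof.
move=> d0; elim: q => [|q IH].
  by rewrite leqn0 => /eqP-> _; rewrite !subrr !mul0r scale0r subrr normr0 mulr0.
rewrite leq_eqVlt => /orP[/eqP-> _|]; first by rewrite subnn !subrr !mul0r scale0r subrr normr0 mulr0.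
rewrite ltnS => pq H.
have {}IH := IH pq (fun j Hj => H j ltac:(by case/andP: Hj => -> /ltnW)).
rewrite (subSn pq) -natr1 mulrDl mul1r scalerDl mulrDr.
have -> : euler d q.+1 - euler d p - (((q - p)%:R * d) *: v + d *: v) =
  (euler d q - euler d p - ((q - p)%:R * d) *: v) + d *: (G (euler d q) - v).
  by rewrite /= scalerBr opprD; rewrite -!addrA; congr (_ + _); rewrite addrCA; congr (_ + _);
     rewrite addrCA.
apply: le_trans (ler_normD _ _) _; apply: lerD => //.
by rewrite normrZ ger0_norm // mulrC ler_wpM2r // H // pq ltnSn.
Qed.

End euler.

(** The Euler iterates are read as step functions of time, without interpolation, so they are
    Lipschitz up to one step. Their pointwise limits along an ultrafilter exist by boundedness
    alone, and [euler_incr] on short windows, where G is close to [G (s t)], gives the right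
    derivative. *)
Lemma peano (R : realType) (m : nat) (G : 'cV[R]_m -> 'cV[R]_m) (M : R) (x0 : 'cV[R]_m) :
  continuous G -> (forall x, `|G x| <= M) ->
  exists s : R -> 'cV[R]_m, [/\ s 0 = x0,
    forall t h, 0 <= t -> 0 <= h -> `|s (t + h) - s t| <= M * h
    & forall t, 0 <= t -> rder s t (G (s t))].
Proof.
move=> cG bG; have M0 : 0 <= M := le_trans (normr_ge0 _) (bG x0).
have [U [UU ooU]] := natultra.
pose d (k : nat) : R := k.+1%:R^-1.
have d0 k : 0 < d k by rewrite invr_gt0 ltr0n.
pose J k (t : R) := Num.truncn (t * k.+1%:R).
pose sk k t := euler G x0 (d k) (J k t).
have Jle k (t h : R) : 0 <= t -> 0 <= h -> (J k t <= J k (t + h)%R)%N.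
  move=> t0 h0; rewrite /J.
  apply: le_truncn; by rewrite ler_wpM2r // lerDl.
have Jd k (t h : R) : 0 <= t -> 0 <= h -> `|(J k (t + h)%R - J k t)%:R * d k - h| <= d k.
  move=> t0 h0; rewrite natrB ?Jle //.
  have := truncn_itv (mulr_ge0 t0 (ler0n R k.+1)).
  have := truncn_itv (mulr_ge0 (addr_ge0 t0 h0) (ler0n R k.+1)).
  rewrite -/(J k t) -/(J k (t + h)) -[(J k t).+1%:R]natr1 -[(J k (t + h)).+1%:R]natr1.
  have K0 : 0 < k.+1%:R :> R by rewrite ltr0n.
  set K := k.+1%:R in K0 *; move=> /andP[h1 h2] /andP[h3 h4].
  have -> : ((J k (t + h))%:R - (J k t)%:R) * d k - h = ((J k (t + h))%:R - (J k t)%:R - h * K) * d k.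
    by rewrite /d -/K; field; rewrite gt_eqF.
  rewrite normrM (gtr0_norm (d0 k)) ler_piMl // ?(ltW (d0 k)) // ler_norml.
  by apply/andP; split; nra.
have dsmall (e : R) : 0 < e -> \forall k \near U, d k < e.
  by move=> e0; apply: ooU; near=> k; near: k; exact: near_infty_natSinv_lt (PosNum e0).
have Lip k (t h : R) : 0 <= t -> 0 <= h -> `|sk k (t + h) - sk k t| <= M * (h + d k).
  move=> t0 h0; have := @euler_incr _ _ G x0 (d k) M 0 _ _ (ltW (d0 k)) (Jle k t h t0 h0).
  rewrite scaler0 subr0 => H; apply: le_trans (H _) _; first by move=> j _; rewrite subr0.
  by rewrite ler_wpM2l //; have := Jd k t h t0 h0; rewrite ler_norml => /andP[]; lra.
have bd (t : R) : exists l : 'cV[R]_m, 0 <= t -> forall e : R, 0 < e -> \forall k \near U, `|sk k t - l| < e.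
  have [t0|] := boolP (0 <= t); last by exists 0.
  have [k|l Hl] := @ultra_bounded_cvg R U m (fun k => sk k t) (`|x0| + M * (t + 1)) UU; last by exists l.
  have := Lip k 0 t (lexx 0) t0; rewrite add0r {2}/sk /J mul0r truncn0 /= => h1.
  rewrite -[sk k t](subrK x0) addrC; apply: le_trans (ler_normD _ _) _; rewrite lerD2l.
  by apply: le_trans h1 _; rewrite ler_wpM2l // lerD2l invf_le1 ?ltr0n // ler1n.
have [s Hs] := choice bd.
have sLip (t h : R) : 0 <= t -> 0 <= h -> `|s (t + h) - s t| <= M * h.
  move=> t0 h0; apply/ler_addgt0Pr => e e0.
  pose e' := e / (M + 2).
  have e'0 : 0 < e' by rewrite divr_gt0 // ltr_wpDl.
  have /filter_ex[k [[k1 k2] k3]] : \forall k \near U, (`|sk k (t + h) - s (t + h)| < e' /\ `|sk k t - s t| < e') /\ d k < e'.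
    apply: filterI; last exact: dsmall.
    by apply: filterI; apply: Hs => //; exact: addr_ge0.
  have -> : s (t + h) - s t = (sk k (t + h) - sk k t) - (sk k (t + h) - s (t + h)) + (sk k t - s t).
    by apply/colP => i; rewrite !mxE; ring.
  apply: le_trans (ler_normD _ _) _; apply: le_trans (lerD (ler_normB _ _) (lexx _)) _.
  have := Lip k t h t0 h0.
  have -> : e = (M + 2) * e' by rewrite /e' mulrC divfK // gt_eqF // ltr_wpDl.
  nra.
exists s; split=> //.
  apply/eqP; rewrite -subr_eq0 -normr_le0; apply/ler_addgt0Pr => e e0; rewrite add0r.
  have /filter_ex[k] := Hs 0 (lexx 0) e e0.
  by rewrite /sk /J mul0r truncn0 /= distrC => /ltW.
move=> t t0 e e0.
have /cvgrPdist_le /(_ e e0) /nbhs_ballP[r /= r0 Hr] := cG (s t).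
have M1 : 0 < M + 1 by rewrite ltr_wpDl.
(* Until then the Euler points, which move by at most [M * (h + d k)], stay in the ball around [s t]
   where G varies by at most e. *)
exists (r / (3 * (M + 1))); first by rewrite divr_gt0 // mulr_gt0.
move=> h h0 hd; set v := G (s t); apply/ler_addgt0Pr => eta eta0.
(* The first bound makes the errors of replacing s by [sk k], and the time covered by the steps by
   h, at most eta in total; the second keeps the Euler points in the ball. *)
pose e' := Num.min (eta / (3 + `|v| + e)) (r / (3 * (M + 1))).
have D0 : 0 < 3 + `|v| + e by rewrite ltr_wpDl // addr_ge0.
have e'0 : 0 < e' by rewrite lt_min !divr_gt0 // mulr_gt0.
have /filter_ex[k [[k1 k2] k3]] : \forall k \near U, (`|sk k (t + h) - s (t + h)| < e' /\ `|sk k t - s t| < e') /\ d k < e'.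
  apply: filterI; last exact: dsmall.
  by apply: filterI; apply: Hs => //; exact: addr_ge0 (ltW _).
have e'r : (M + 1) * e' <= r / 3.
  rewrite -ler_pdivlMl //; apply: (@le_trans _ _ (r / (3 * (M + 1)))); first by rewrite ge_min lexx orbT.
  by rewrite invfM mulrA mulrC.
have hr : (M + 1) * h < r / 3.
  by rewrite mulrC -ltr_pdivlMr //; apply: lt_le_trans hd _; rewrite invfM mulrA.
have Hh := Jd k t h t0 (ltW h0).
have key : `|sk k (t + h) - sk k t - ((J k (t + h)%R - J k t)%:R * d k) *: v|
   <= e * ((J k (t + h)%R - J k t)%:R * d k).
  apply: euler_incr; [exact: ltW | by apply: Jle => //; exact: ltW|].
  move=> j /andP[pj jq]; rewrite distrC; apply: Hr; rewrite -ball_normE /=.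
  have := @euler_incr _ _ G x0 (d k) M 0 _ _ (ltW (d0 k)) pj.
  rewrite scaler0 subr0 => /(_ (fun j _ => ltac:(by rewrite subr0))) H1.
  have H2 : `|euler G x0 (d k) j - euler G x0 (d k) (J k t)| <= M * (h + d k).
    apply: le_trans H1 _; rewrite ler_wpM2l //.
    apply: (@le_trans _ _ ((J k (t + h)%R - J k t)%:R * d k)).
      by rewrite ler_pM2r // ler_nat leq_sub2r // ltnW.
    by move: Hh; rewrite ler_norml => /andP[]; lra.
  have -> : s t - euler G x0 (d k) j = - (sk k t - s t) - (euler G x0 (d k) j - euler G x0 (d k) (J k t)).
    by apply/colP => i; rewrite /sk !mxE; ring.
  apply: le_lt_trans (ler_normB _ _) _; rewrite normrN.
  have : 0 <= M * h by rewrite mulr_ge0 // ltW.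
  nra.
set D := (_ * d k) in key Hh.
have -> : s (t + h) - s t - h *: v = (sk k (t + h) - sk k t - D *: v) - (sk k (t + h) - s (t + h)) + (sk k t - s t) + (D - h) *: v.
  apply/colP => i; rewrite !mxE; ring.
apply: le_trans (ler_normD _ _) _; rewrite normrZ.
apply: le_trans (lerD (ler_normD _ _) (lexx _)) _.
apply: le_trans (lerD (lerD (ler_normB _ _) (lexx _)) (lexx _)) _.
have h1 : `|D - h| * `|v| <= e' * `|v| by rewrite ler_wpM2r //; lra.
have h2 : e * D <= e * h + e * e'.
  by rewrite -mulrDr ler_pM2l //; move: Hh; rewrite ler_norml => /andP[]; lra.
have h3 : (3 + `|v| + e) * e' <= eta.
  by rewrite mulrC -ler_pdivlMr // ge_min lexx.
lra.
Unshelve. all: by end_near. Qed.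

(** * Solutions reflected at a level set *)

Lemma cV_continuous (R : realType) (T : topologicalType) (m : nat) (g : T -> 'cV[R]_m) (p : T) :
  (forall i, {for p, continuous (fun x => g x i 0)}) -> {for p, continuous g}.
Proof.
move=> cg; apply/cvgrPdist_lt => e e0; near=> x.
apply/cV_norm_lt => // i; rewrite !mxE; move: i; near: x.
by apply: filter_forall => i; move/cvgrPdist_lt: (cg i); apply.
Unshelve. all: by end_near. Qed.

Lemma rder_rdle (R : realType) (q : R -> R) (t v c : R) : rder q t v -> v <= c -> rdle q t c.
Proof.
move=> rq vc e e0; have [d d0 Hd] := rq e e0; exists d => // h h0 hd.
have := Hd h h0 hd; rewrite ler_norml => /andP[_].
by have := ler_wpM2r (ltW h0) vc; rewrite /GRing.scale /=; lra.
Qed.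

Lemma rderD (R : realType) (W : normedModType R) (q1 q2 : R -> W) (t : R) (v1 v2 : W) :
  rder q1 t v1 -> rder q2 t v2 -> rder (fun r => q1 r + q2 r) t (v1 + v2).
Proof.
move=> r1 r2 e e0; have e20 : 0 < e / 2 by rewrite divr_gt0.
have [d1 d10 H1] := r1 _ e20; have [d2 d20 H2] := r2 _ e20.
exists (Num.min d1 d2); first by rewrite lt_min d10.
move=> h h0; rewrite lt_min => /andP[h1 h2].
rewrite scalerDr (opprD (q1 t)) (opprD (h *: v1)) (addrACA (q1 (t + h))) (addrACA (q1 (t + h) - q1 t)).
apply: le_trans (ler_normD _ _) _.
rewrite [e]splitr mulrDl; apply: lerD; [exact: H1|exact: H2].
Qed.

Lemma rderZl (R : realType) (W : normedModType R) (q : R -> R) (t v : R) (w : W) :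
  rder q t v -> rder (fun r => q r *: w) t (v *: w).
Proof.
move=> rq e e0; have w10 : 0 < `|w| + 1 by rewrite ltr_wpDl.
have [d d0 H] := rq (e / (`|w| + 1)) ltac:(by rewrite divr_gt0).
exists d => // h h0 hd; have {}H := H h h0 hd.
rewrite scalerA -!scalerBl normrZ; have -> : h * v = h *: v by [].
have := ler_wpM2r (normr_ge0 w) H; move=> /le_trans; apply.
have -> : e / (`|w| + 1) * h * `|w| = e * h * (`|w| / (`|w| + 1)) by ring.
by rewrite ler_piMr ?mulr_ge0 ?(ltW e0) ?(ltW h0) // ler_pdivrMr // mul1r lerDl.
Qed.

Lemma diff_eps (R : realType) (V W : normedModType R) (g : V -> W) (x : V) (e : R) :
  differentiable g x -> 0 < e -> exists2 d : R, 0 < d &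
    forall y, `|y - x| < d -> `|g y - g x - 'd g x (y - x)| <= e * `|y - x|.
Proof.
move=> /diff_locallyP[_ /eqaddoP H] e0.
have /nbhs_ballP[d /= d0 Hd] := H e e0.
exists d => // y yx; have := Hd (y - x); rewrite -ball_normE /= sub0r normrN => /(_ yx).
by rewrite !fctE /= subrK opprD addrA.
Qed.

Lemma rder_comp (R : realType) (V W : normedModType R) (q : R -> V) (t : R) (v : V) (g : V -> W) :
  rder q t v -> differentiable g (q t) -> rder (g \o q) t ('D_v g (q t)).
Proof.
move=> rq dg e e0; rewrite deriveE //.
have [k k0 Hk] := linear_lipschitz (diff_continuous dg).
pose e1 := Num.min 1 (e / (2 * k)).
have e10 : 0 < e1 by rewrite lt_min ltr01 divr_gt0 // mulr_gt0.
have v10 : 0 < `|v| + 1 by rewrite ltr_wpDl.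
pose e2 := e / (2 * (`|v| + 1)).
have e20 : 0 < e2 by rewrite divr_gt0 // mulr_gt0.
have [d d0 Hd] := rq e1 e10; have [r r0 Hr] := diff_eps dg e20.
exists (Num.min d (r / (`|v| + 1))); first by rewrite lt_min d0 divr_gt0.
move=> h h0; rewrite lt_min => /andP[hd hr].
have {Hd}Hd := Hd h h0 hd; set D := q (t + h) - q t in Hd.
have e11 : e1 <= 1 by rewrite ge_min lexx.
have e1k : e1 * k <= e / 2.
  rewrite -ler_pdivlMr // /e1 ge_min; apply/orP; right.
  by rewrite -mulrA invfM.
have DM : `|D| <= (`|v| + 1) * h.
  rewrite -[D](subrK (h *: v)); apply: le_trans (ler_normD _ _) _.
  rewrite normrZ gtr0_norm // mulrDl mul1r addrC mulrC lerD2l.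
  by apply: le_trans Hd _; rewrite ler_piMl // ltW.
have := Hr (q (t + h)); rewrite -/D => /(_ _).
rewrite ltr_pdivlMr // mulrC in hr; move=> /(_ (le_lt_trans DM hr)) H2.
have -> : (g \o q) (t + h) - (g \o q) t - h *: 'd g (q t) v =
   (g (q (t + h)) - g (q t) - 'd g (q t) D) + 'd g (q t) (D - h *: v).
  have L : 'd g (q t) (D - h *: v) = 'd g (q t) D - h *: 'd g (q t) v by rewrite linearB linearZ.
  by rewrite L addrA subrK.
apply: le_trans (ler_normD _ _) _.
rewrite (splitr e) mulrDl; apply: lerD.
  apply: le_trans H2 _; apply: le_trans (ler_wpM2l (ltW e20) DM) _.
  by rewrite mulrA /e2 invfM mulrA divfK ?gt_eqF.
apply: le_trans (Hk _) _; apply: le_trans (ler_wpM2l (ltW k0) Hd) _.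
by rewrite mulrA ler_wpM2r ?(ltW h0) // mulrC.
Qed.

(** [rdle_le] applied to the positive part of q: where q < 0 it stays 0 for a short time, and where
    q >= 0 its right growth rate is at most 0. *)
Lemma rdle_nonpos (R : realType) (q : R -> R) (a b : R) : a <= b -> q a <= 0 ->
  (forall t, a < t -> t <= b -> lcont q t) ->
  (forall t, a <= t -> t < b -> exists2 v, rder q t v & 0 <= q t -> v <= 0) ->
  q b <= 0.
Proof.
move=> ab qa lc rd; pose g t := Num.max (q t) 0.
have : g b - g a <= 0 * (b - a).
  apply: rdle_le => // t at_ tb.
    apply/lcontP => e e0; have [d d0 Hd] := (lcontP q t).1 (lc t at_ tb) e e0.
    exists d => // r tr rt; apply: le_lt_trans (Hd r tr rt).
    have h1 := ler_norm (q r - q t); have h2 := ler_norm (q t - q r); rewrite distrC in h2.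
    have h3 := normr_ge0 (q r - q t).
    by rewrite /g ler_norml; apply/andP; split; case: (leP (q r) 0); case: (leP (q t) 0); lra.
  have [v rv vle] := rd t at_ tb.
  have [q0|q0] := leP 0 (q t).
    move=> e e0; have [d d0 Hd] := rder_rdle rv (vle q0) e0.
    exists d => // h h0 hd; have := Hd h h0 hd; rewrite /g (max_idPl q0) add0r => H.
    have eh : 0 <= e * h by rewrite mulr_ge0 // ltW.
    by case: (leP (q (t + h)) 0); lra.
  move=> e e0; have [d d0 Hd] := rder_rdle rv (lexx v) (@ltr01 R).
  have v10 : 0 < `|v + 1| + 1 by rewrite ltr_wpDl.
  (* q grows at a rate of at most [v + 1], so it does not exceed 0 within this time. *)
  exists (Num.min d (- q t / (`|v + 1| + 1))); first by rewrite lt_min d0 divr_gt0 // oppr_gt0.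
  move=> h h0; rewrite lt_min => /andP[hd h2].
  rewrite ltr_pdivlMr // in h2; have := Hd h h0 hd; rewrite /g (max_idPr (ltW q0)) => H.
  have eh : 0 <= e * h by rewrite mulr_ge0 // ltW.
  have := ler_norm (v + 1); move: (`|v + 1|) h2 v10 => w *.
  by case: (leP (q (t + h)) 0); nra.
rewrite mul0r /g (max_idPr qa) subr0; apply: le_trans.
by rewrite le_max lexx.
Qed.

(** Abstract form of the projected field. It is applied with k the derivative of B along F0, and
    with nu scaled so that B has derivative 1 along it; subtracting [k s *: nu s] then freezes B. *)
Definition reflected (R : realType) (m : nat) (F0 nu : 'cV[R]_m -> 'cV[R]_m)
    (B k : 'cV[R]_m -> R) (s : 'cV[R]_m) : 'cV[R]_m :=
  if (0 <= k s) && (B s == 0) then F0 s - k s *: nu s else F0 s.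

(** Inside, the weight th is 0; at a boundary point with [k p <= 0] the factor [Num.max (k x) 0] is
    small, whatever the weight. At a boundary point with [k p > 0] neither argument works, and
    [reflected_exists] proceeds differently. *)
Lemma reflected_small (R : realType) (m : nat) (F0 nu : 'cV[R]_m -> 'cV[R]_m)
    (B k : 'cV[R]_m -> R) (p : 'cV[R]_m) (e : R) :
  {for p, continuous F0} -> {for p, continuous nu} -> {for p, continuous k} ->
  {for p, continuous B} -> 0 < e -> (B p < 0) \/ (B p = 0 /\ k p <= 0) ->
  exists2 d : R, 0 < d & forall x, `|x - p| < d ->
    (B p < 0 -> B x < B p / 2) /\
    forall th : R, 0 <= th -> th <= 1 -> (B p < 0 -> th = 0) ->
    `|F0 x - (Num.max (k x) 0 * th) *: nu x - reflected F0 nu B k p| <= e.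
Proof.
move=> /cvgrPdist_le cF /cvgrPdist_le cn /cvgrPdist_le ck /cvgrPdist_lt cB e0 Hp.
have v10 : 0 < `|nu p| + 1 by rewrite ltr_wpDl.
have e20 : 0 < e / 2 by rewrite divr_gt0.
pose e3 := e / (2 * (`|nu p| + 1)).
have e30 : 0 < e3 by rewrite divr_gt0 // mulr_gt0.
have refl_p : reflected F0 nu B k p = F0 p.
  rewrite /reflected; case: ifP => // /andP[k0 /eqP B0]; case: Hp => [|[_ k0']]; first by rewrite B0 ltxx.
  by rewrite (le_anti (introT andP (conj k0' k0))) scale0r subr0.
have eB0 : 0 < (if B p < 0 then - B p / 2 else 1) by case: ifP => // B0; rewrite divr_gt0 // oppr_gt0.
have /nbhs_ballP[d /= d0 Hd] : \forall x \near p, (`|F0 p - F0 x| <= e / 2 /\ `|nu p - nu x| <= 1)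
   /\ (`|k p - k x| <= e3 /\ `|B p - B x| < if B p < 0 then - B p / 2 else 1).
  by apply: filterI; apply: filterI; [exact: cF|exact: cn|exact: ck|exact: cB].
exists d => // x; rewrite distrC => px; have := Hd x; rewrite -ball_normE => /(_ px) [[h1 h2] [h3 h4]].
split=> [B0|th th0 th1 thB].
  by move: h4; rewrite B0 ltr_norml => /andP[]; lra.
rewrite refl_p.
have h5 : `|Num.max (k x) 0 * th| * `|nu x| <= e / 2.
  case: Hp => [/thB->|[_ k0]]; first by rewrite mulr0 normr0 mul0r ltW.
  have nux : `|nu x| <= `|nu p| + 1.
    by rewrite -[nu x](subrK (nu p)); apply: le_trans (ler_normD _ _) _; rewrite addrC lerD2l distrC.
  have kx : `|Num.max (k x) 0 * th| <= e3.
    rewrite ger0_norm ?mulr_ge0 ?le_max ?lexx ?orbT //.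
    apply: (@le_trans _ _ (Num.max (k x) 0)); first by rewrite ler_piMr // le_max lexx orbT.
    by rewrite ge_max (ltW e30) andbT; move: h3; rewrite ler_norml => /andP[]; lra.
  apply: le_trans (ler_pM (normr_ge0 _) (normr_ge0 _) kx nux) _.
  by rewrite /e3 invfM mulrA divfK ?gt_eqF.
rewrite addrAC; apply: le_trans (ler_normB _ _) _; rewrite normrZ (splitr e).
by apply: lerD => //; rewrite distrC.
Qed.

Lemma continuous_cst_at (T U : topologicalType) (c : U) (p : T) : {for p, continuous (fun _ : T => c)}.
Proof. exact: cst_continuous. Qed.

Lemma contD (R : realType) (T : topologicalType) (W : normedModType R) (f g : T -> W) (p : T) :
  {for p, continuous f} -> {for p, continuous g} -> {for p, continuous (fun x => f x + g x)}.
Proof. exact: cvgD. Qed.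

Lemma contB (R : realType) (T : topologicalType) (W : normedModType R) (f g : T -> W) (p : T) :
  {for p, continuous f} -> {for p, continuous g} -> {for p, continuous (fun x => f x - g x)}.
Proof. exact: cvgB. Qed.

Lemma contM (R : realType) (T : topologicalType) (f g : T -> R) (p : T) :
  {for p, continuous f} -> {for p, continuous g} -> {for p, continuous (fun x => f x * g x)}.
Proof. exact: cvgM. Qed.

Lemma contZ (R : realType) (T : topologicalType) (W : normedModType R) (f : T -> R) (g : T -> W) (p : T) :
  {for p, continuous f} -> {for p, continuous g} -> {for p, continuous (fun x => f x *: g x)}.
Proof. exact: cvgZ. Qed.

Lemma cont_sum (R : realType) (T : topologicalType) (I : Type) (r : seq I) (P : pred I)
    (f : I -> T -> R) (p : T) :
  (forall i, P i -> {for p, continuous (f i)}) ->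
  {for p, continuous (fun x => \sum_(i <- r | P i) f i x)}.
Proof.
move=> cf; elim: r => [|i r IH].
  rewrite (_ : (fun x => _) = fun=> 0); last by apply/funext => x; rewrite big_nil.
  exact: continuous_cst_at.
rewrite (_ : (fun x => _) = fun x => if P i then f i x + \sum_(j <- r | P j) f j x else \sum_(j <- r | P j) f j x).
  by case: (P i) (@cf i) => [ci|_] //; apply: contD => //; exact: ci.
by apply/funext => x; rewrite big_cons.
Qed.

Lemma cont_prod (R : realType) (T : topologicalType) (I : Type) (r : seq I) (P : pred I)
    (f : I -> T -> R) (p : T) :
  (forall i, P i -> {for p, continuous (f i)}) ->
  {for p, continuous (fun x => \prod_(i <- r | P i) f i x)}.
Proof.
move=> cf; elim: r => [|i r IH].
  rewrite (_ : (fun x => _) = fun=> 1); last by apply/funext => x; rewrite big_nil.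
  exact: continuous_cst_at.
rewrite (_ : (fun x => _) = fun x => if P i then f i x * \prod_(j <- r | P j) f j x else \prod_(j <- r | P j) f j x).
  by case: (P i) (@cf i) => [ci|_] //; apply: contM => //; exact: ci.
by apply/funext => x; rewrite big_cons.
Qed.

Lemma continuous_maxr (R : realType) (T : topologicalType) (f g : T -> R) (p : T) :
  {for p, continuous f} -> {for p, continuous g} ->
  {for p, continuous (fun x => Num.max (f x) (g x))}.
Proof.
move=> cf cg.
have -> : (fun x => Num.max (f x) (g x)) = (fun x => (f x + g x + `|f x - g x|) * 2^-1).
  by apply/funext => x; rewrite maxr_absE.
apply: cvgM; last exact: cvg_cst.
apply: cvgD; first exact: cvgD.
by apply: cvg_norm; exact: cvgB.
Qed.

Lemma continuous_minr (R : realType) (T : topologicalType) (f g : T -> R) (p : T) :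
  {for p, continuous f} -> {for p, continuous g} ->
  {for p, continuous (fun x => Num.min (f x) (g x))}.
Proof.
move=> cf cg.
have -> : (fun x => Num.min (f x) (g x)) = (fun x => - Num.max (- f x) (- g x)).
  by apply/funext => x; rewrite oppr_max !opprK.
by apply: cvgN; apply: (@continuous_maxr _ _ (fun x => - f x) (fun x => - g x)); exact: cvgN.
Qed.

(** Precomposition with this retraction onto a ball turns a field known near s0 into a global one,
    as [peano] requires, and changes nothing inside the ball. *)
Definition clamp (R : realType) (m : nat) (s0 : 'cV[R]_m) (r : R) (p : 'cV[R]_m) : 'cV[R]_m :=
  \col_i Num.max (s0 i 0 - r) (Num.min (s0 i 0 + r) (p i 0)).

Lemma clamp_continuous (R : realType) (m : nat) (s0 : 'cV[R]_m) (r : R) (p : 'cV[R]_m) :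
  {for p, continuous (clamp s0 r)}.
Proof.
apply: cV_continuous => i.
rewrite (_ : (fun x => _) = (fun x : 'cV[R]_m => Num.max (s0 i 0 - r) (Num.min (s0 i 0 + r) (x i 0)))).
  apply: (@continuous_maxr _ _ (fun=> s0 i 0 - r)). exact: continuous_cst_at.
  apply: (@continuous_minr _ _ (fun=> s0 i 0 + r) (fun x : 'cV[R]_m => x i 0)); first exact: continuous_cst_at.
  exact: coord_continuous.
by apply/funext => x; rewrite mxE.
Qed.

Lemma clamp_ball (R : realType) (m : nat) (s0 : 'cV[R]_m) (r : R) (p : 'cV[R]_m) : 0 <= r ->
  `|clamp s0 r p - s0| <= r.
Proof.
move=> r0; apply/cV_norm_le => // i; rewrite !mxE ler_distl.
rewrite le_max lexx /= ge_max ge_min lexx /= andbT; lra.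
Qed.

Lemma clamp_id (R : realType) (m : nat) (s0 : 'cV[R]_m) (r : R) (p : 'cV[R]_m) :
  `|p - s0| <= r -> clamp s0 r p = p.
Proof.
move=> pr; apply/colP => i; rewrite mxE.
have r0 := le_trans (normr_ge0 _) pr.
have := (cV_norm_le _ r0).1 pr i; rewrite !mxE ler_distl => /andP[h1 h2].
by rewrite (min_idPr h2) (max_idPr h1).
Qed.

Lemma rderN (R : realType) (W : normedModType R) (q : R -> W) (t : R) (v : W) :
  rder q t v -> rder (fun r => - q r) t (- v).
Proof.
move=> rq e e0; have [d d0 H] := rq e e0; exists d => // h h0 hd.
by rewrite scalerN -!opprD normrN; exact: H.
Qed.

Lemma derive_comb (R : realType) (V : normedModType R) (g : V -> R) (x u v : V) (c : R) :
  differentiable g x -> 'D_(u - c *: v) g x = 'D_u g x - c * 'D_v g x.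
Proof. by move=> dg; rewrite !deriveE // linearB linearZ. Qed.

(** At a point with B = 0 and k > 0 the penalty weights of the approximations need not converge, so
    their fields need not tend to the reflected one. There the proof follows a combination of the
    state and its level in which the weight cancels, and uses that the level tends to 0. *)
Lemma reflected_exists (R : realType) (m : nat) (F0 nu : 'cV[R]_m -> 'cV[R]_m)
    (B k : 'cV[R]_m -> R) (s0 : 'cV[R]_m) (r M : R) :
  0 < r -> 0 < M ->
  (forall p, `|p - s0| <= r ->
    [/\ {for p, continuous F0}, {for p, continuous nu}, {for p, continuous k}
       & differentiable B p] /\
    [/\ `|F0 p| + `|k p| * `|nu p| <= M, 'D_(F0 p) B p = k p & 'D_(nu p) B p = 1]) ->
  B s0 <= 0 ->
  exists s : R -> 'cV[R]_m, [/\ s 0 = s0,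
    forall t h, 0 <= t -> 0 <= h -> `|s (t + h) - s t| <= M * h,
    forall t, 0 <= t -> t <= r / M -> `|s t - s0| <= r /\ B (s t) <= 0
    & forall t, 0 <= t -> t < r / M ->
      rder s t (reflected F0 nu B k (s t)) /\
      forall e : R, 0 < e -> exists2 d : R, 0 < d & forall h, 0 < h -> h < d ->
       `|reflected F0 nu B k (s (t + h)) - reflected F0 nu B k (s t)| <= e].
Proof.
move=> r0 M0 Hp Bs0; set tau := r / M.
have cB p : `|p - s0| <= r -> {for p, continuous B}.
  by move=> /Hp[[_ _ _ dB] _]; exact: differentiable_continuous.
(* The weight is 1 for [B p >= 0], where the whole outward speed is cancelled, and 0 as soon as
   [j%:R * B p <= -1]. *)
pose th (j : nat) (p : 'cV[R]_m) : R := Num.max 0 (Num.min 1 (1 + j%:R * B p)).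
have th0 j p : 0 <= th j p by rewrite le_max lexx.
have th1 j p : th j p <= 1 by rewrite ge_max ler01 ge_min lexx.
pose lam j p : R := Num.max (k p) 0 * th j p.
have lam0 j p : 0 <= lam j p by rewrite mulr_ge0 // le_max lexx orbT.
pose g j p := F0 p - lam j p *: nu p.
have cg j p : `|p - s0| <= r -> {for p, continuous (g j)}.
  move=> pr; have [[c1 c2 c3 _] _] := Hp p pr.
  apply: contB; first exact: c1.
  apply: contZ; last exact: c2.
  apply: contM.
    by apply: (@continuous_maxr _ _ k (fun=> 0)); [exact: c3|exact: continuous_cst_at].
  apply: (@continuous_maxr _ _ (fun=> 0)); first exact: continuous_cst_at.
  apply: (@continuous_minr _ _ (fun=> 1) (fun x => 1 + j%:R * B x)); first exact: continuous_cst_at.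
  apply: contD; first exact: continuous_cst_at.
  by apply: contM; [exact: continuous_cst_at|exact: cB].
have bg j p : `|p - s0| <= r -> `|g j p| <= M.
  move=> pr; have [_ [h1 _ _]] := Hp p pr; apply: le_trans h1.
  apply: le_trans (ler_normB _ _) _; rewrite lerD2l normrZ ler_wpM2r // ger0_norm //.
  apply: (@le_trans _ _ (Num.max (k p) 0)); first by rewrite ler_piMr // le_max lexx orbT.
  by rewrite ge_max ler_norm normr_ge0.
have ex j : exists s : R -> 'cV[R]_m, [/\ s 0 = s0,
    forall t h, 0 <= t -> 0 <= h -> `|s (t + h) - s t| <= M * h
    & forall t, 0 <= t -> t <= tau -> rder s t (g j (s t))].
  (* A speed of at most M keeps the solution in the ball up to time [r / M], and there the clamped
     field is the given one. *)
  have [||s [s0E sL sD]] := @peano R m (g j \o clamp s0 r) M s0.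
  - move=> p; apply: continuous_comp; first exact: clamp_continuous.
    by apply: cg; exact: clamp_ball (ltW r0).
  - by move=> p; apply: bg; exact: clamp_ball (ltW r0).
  exists s; split=> // t t_ge0 tt; have := sD t t_ge0; rewrite /= clamp_id //.
  rewrite -s0E; have := sL 0 t (lexx 0) t_ge0; rewrite add0r => /le_trans; apply.
  by rewrite mulrC -ler_pdivlMr.
have {ex}[sk Hsk] := choice ex.
have skball j (t : R) : 0 <= t -> t <= tau -> `|sk j t - s0| <= r.
  move=> t0 tt; have [<- sL _] := Hsk j; have := sL 0 t (lexx 0) t0; rewrite add0r => /le_trans; apply.
  by rewrite mulrC -ler_pdivlMr.
have Lip_lcont (s : R -> 'cV[R]_m) t : (forall t h, 0 <= t -> 0 <= h -> `|s (t + h) - s t| <= M * h) ->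
   0 < t -> lcont s t.
  move=> sL t0; apply/lcontP => e e0; exists (Num.min t (e / M)); first by rewrite lt_min t0 divr_gt0.
  move=> q tq qt; have q0 : 0 < q.
    by apply: le_lt_trans tq; rewrite subr_ge0 ge_min lexx.
  have := sL q (t - q) (ltW q0); rewrite subr_ge0 [q + _](_ : _ = t); last by ring.
  move=> /(_ qt); rewrite distrC => /le_lt_trans; apply.
  rewrite mulrC -ltr_pdivlMr // ltrBlDr -ltrBlDl; apply: le_lt_trans tq.
  by rewrite lerD2l lerN2 ge_min lexx orbT.
have Bder j (t : R) : 0 <= t -> t <= tau ->
    rder (fun t => B (sk j t)) t (k (sk j t) - lam j (sk j t)).
  move=> t0 tt; have [_ _ sD] := Hsk j; have [[_ _ _ dB] [_ d1 d2]] := Hp _ (skball j t t0 tt).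
  have -> : k (sk j t) - lam j (sk j t) = 'D_(g j (sk j t)) B (sk j t).
    by rewrite /g derive_comb // d1 d2 mulr1.
  by apply: (@rder_comp _ _ _ (sk j) t _ B) => //; exact: sD.
have Blc j (t : R) : 0 < t -> t <= tau -> lcont (fun t => B (sk j t)) t.
  move=> t0 tt; apply: (@lcont_comp _ _ _ (sk j) B).
    by apply: Lip_lcont => //; have [] := Hsk j.
  by apply: cB; apply: skball => //; exact: ltW.
have Bneg j (t : R) : 0 <= t -> t <= tau -> B (sk j t) <= 0.
  move=> t0 tt; apply: (@rdle_nonpos R (fun t => B (sk j t)) 0 t) => //.
  - by have [-> _ _] := Hsk j.
  - by move=> q q0 qt; apply: Blc => //; exact: le_trans qt tt.
  move=> q q0 qt; have qtau : q <= tau := le_trans (ltW qt) tt.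
  exists (k (sk j q) - lam j (sk j q)); first exact: Bder.
  move=> B0; have thE : th j (sk j q) = 1.
    by rewrite /th (min_idPl _) ?lerDl ?mulr_ge0 // (max_idPr _).
  rewrite /lam thE mulr1.
  by rewrite subr_le0 le_max lexx.
have [U [UU ooU]] := natultra.
have FU : ProperFilter U := @ultra_proper _ _ UU.
have ex2 (E1 E2 : set nat) : U E1 -> U E2 -> exists j, E1 j /\ E2 j.
  by move=> h1 h2; near U => j; exists j; split; near: j.
have ex3 (E1 E2 E3 : set nat) : U E1 -> U E2 -> U E3 -> exists j, [/\ E1 j, E2 j & E3 j].
  by move=> h1 h2 h3; near U => j; exists j; split; near: j.
have bd (t : R) : exists l : 'cV[R]_m, 0 <= t -> forall e : R, 0 < e -> \forall j \near U, `|sk j t - l| < e.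
  have [t0|] := boolP (0 <= t); last by exists 0.
  have [j|l Hl] := @ultra_bounded_cvg R U m (fun j => sk j t) (`|s0| + M * t) UU; last by exists l.
  have [s0E sL _] := Hsk j; have := sL 0 t (lexx 0) t0; rewrite add0r s0E => h1.
  rewrite -[sk j t](subrK s0) addrC; apply: le_trans (ler_normD _ _) _; by rewrite lerD2l.
have [s Hs] := choice bd.
have lim_le (u : nat -> 'cV[R]_m) (l : 'cV[R]_m) c :
    (forall e : R, 0 < e -> \forall j \near U, `|u j - l| < e) ->
    (\forall j \near U, `|u j| <= c) -> `|l| <= c.
  move=> ul uc; apply/ler_addgt0Pr => e e0; have [j [h1 h2]] := ex2 _ _ (ul e e0) uc.
  rewrite -[l](subKr (u j)); apply: le_trans (ler_normB _ _) _; apply: lerD => //; exact: ltW.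
have lim_incr (t h : R) : 0 <= t -> 0 <= h -> forall v (e : R), 0 < e ->
    \forall j \near U, `|(sk j (t + h) - sk j t - h *: v) - (s (t + h) - s t - h *: v)| < e.
  move=> t0 h0 v e e0; have e20 : 0 < e / 2 by rewrite divr_gt0.
  have th_ : 0 <= t + h by rewrite addr_ge0.
  have h1 := Hs _ th_ _ e20; have h2 := Hs _ t0 _ e20.
  apply: filterS2 h1 h2 => j h1 h2; rewrite (splitr e).
  have -> : sk j (t + h) - sk j t - h *: v - (s (t + h) - s t - h *: v) =
    (sk j (t + h) - s (t + h)) - (sk j t - s t) by apply/colP => i; rewrite !mxE; ring.
  by apply: le_lt_trans (ler_normB _ _) _; exact: ltrD.
have sL (t h : R) : 0 <= t -> 0 <= h -> `|s (t + h) - s t| <= M * h.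
  move=> t0 h0; apply: (lim_le (fun j => sk j (t + h) - sk j t)).
    move=> e e0; have := lim_incr t h t0 h0 0 e e0.
    by apply: filterS => j; rewrite scaler0 !subr0.
  by apply: nearW => j; have [_ H _] := Hsk j; exact: H.
have s00 : s 0 = s0.
  apply/eqP; rewrite -subr_eq0 -normr_le0; apply/ler_addgt0Pr => e e0; rewrite add0r.
  by have /filter_ex[j] := Hs 0 (lexx 0) e e0; have [-> _ _] := Hsk j; rewrite distrC => /ltW.
have sball (t : R) : 0 <= t -> t <= tau -> `|s t - s0| <= r.
  move=> t0 tt; rewrite -s00; have := sL 0 t (lexx 0) t0; rewrite add0r => /le_trans; apply.
  by rewrite mulrC -ler_pdivlMr.
have Blim (t e : R) : 0 <= t -> t <= tau -> 0 < e -> \forall j \near U, `|B (sk j t) - B (s t)| < e.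
  move=> t0 tt e0; have /cvgrPdist_lt /(_ e e0) /nbhs_ballP[d /= d0 Hd] := cB _ (sball t t0 tt).
  have := Hs t t0 d d0; apply: filterS => j; rewrite distrC => h1; rewrite distrC; apply: Hd.
  by rewrite -ball_normE.
have sB (t : R) : 0 <= t -> t <= tau -> B (s t) <= 0.
  move=> t0 tt; apply/ler_addgt0Pr => e e0; rewrite add0r.
  have /filter_ex[j] := Blim t e t0 tt e0; rewrite distrC => h1; have h2 := Bneg j t t0 tt.
  by have h3 := ler_norm (B (s t) - B (sk j t)); lra.
(* On a short window, almost all approximations stay close to the limit point. *)
have window (t d : R) : 0 <= t -> 0 < d -> exists2 w : R, 0 < w & \forall j \near U,
    forall q, t <= q -> q <= t + w -> `|sk j q - s t| < d.
  move=> t0 d0; exists (d / (2 * M)); first by rewrite divr_gt0 // mulr_gt0.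
  have d20 : 0 < d / 2 by rewrite divr_gt0.
  have := Hs t t0 _ d20; apply: filterS => j h1 q tq qw.
  have [_ H _] := Hsk j; have := H t (q - t) t0; rewrite subr_ge0 [t + _](_ : _ = q); last by ring.
  move=> /(_ tq) h2.
  rewrite -[sk j q](subrK (sk j t)) -addrA; apply: le_lt_trans (ler_normD _ _) _.
  rewrite (splitr d); apply: ler_ltD => //; apply: le_trans h2 _.
  by rewrite mulrC -ler_pdivlMr // lerBlDl -mulrA -invfM.
(* Where k > 0 the level of an approximation has derivative [k * (1 - th j) >= 0], so in the limit B
   cannot decrease from 0, and [sB] prevents an increase: the solution slides along the level
   set. *)
have active (t : R) : 0 <= t -> t < tau -> B (s t) = 0 -> 0 < k (s t) ->
    exists2 w : R, 0 < w & forall h, 0 < h -> h < w -> B (s (t + h)) = 0.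
  move=> t0 tt B0 k0; have [[_ _ ck _] _] := Hp _ (sball t t0 (ltW tt)).
  move/cvgrPdist_lt: ck => /(_ _ k0) /nbhs_ballP[d /= d0 Hd].
  have [w w0 Hw] := window t d t0 d0.
  exists (Num.min w (tau - t)); first by rewrite lt_min w0 subr_gt0.
  move=> h h0; rewrite lt_min ltrBrDl => /andP[hw htau].
  have th_0 : 0 <= t + h by rewrite addr_ge0 // ltW.
  apply: le_anti; rewrite sB ?(ltW htau) //=; apply/ler_addgt0Pr => e e0.
  have e20 : 0 < e / 2 by rewrite divr_gt0.
  have [j [h1 h2 h3]] := ex3 _ _ _ (Blim _ _ t0 (ltW tt) e20) (Blim _ _ th_0 (ltW htau) e20) Hw.
  have : - B (sk j (t + h)) - - B (sk j t) <= 0 * (t + h - t).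
    apply: (@rdle_le R (fun t => - B (sk j t))); first by rewrite lerDl ltW.
      move=> q tq qth; apply: cvgN; apply: Blc; first exact: le_lt_trans tq.
      exact: le_trans qth (ltW htau).
    move=> q tq qth; have q0 := le_trans t0 tq.
    have qtau : q <= tau := ltW (lt_trans qth htau).
    have := rderN (Bder j q q0 qtau); move/rder_rdle; apply; rewrite opprB subr_le0.
    have kq : 0 < k (sk j q).
      have := Hd (sk j q); rewrite -ball_normE /= distrC h3 //; last by apply: ltW (lt_le_trans qth _); rewrite lerD2l ltW.
      by move=> /(_ isT); rewrite ltr_norml => /andP[]; lra.
    by rewrite /lam (max_idPl (ltW kq)) ler_piMr // ltW.
  move: h1 h2; rewrite B0 mul0r subr0 !ltr_norml => /andP[? ?] /andP[? ?]; lra.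
exists s; split=> //; first by move=> t t0 tt; split; [exact: sball|exact: sB].
move=> t t0 tt; have ttl := ltW tt.
have [[cF cn ck dB] [_ _ _]] := Hp _ (sball t t0 ttl).
have near_s (d : R) : 0 < d -> exists2 w : R, 0 < w & forall h, 0 < h -> h < w -> `|s (t + h) - s t| < d.
  move=> d0; exists (d / M); first by rewrite divr_gt0.
  move=> h h0 hw; apply: le_lt_trans (sL t h t0 (ltW h0)) _.
  by rewrite mulrC -ltr_pdivlMr.
have Bt := sB t t0 ttl.
have [Hcase|[B0 k0]] : (B (s t) < 0 \/ B (s t) = 0 /\ k (s t) <= 0) \/ (B (s t) = 0 /\ 0 < k (s t)).
- move: Bt; rewrite le_eqVlt => /orP[/eqP B0|]; last by left; left.
  by case: (leP (k (s t)) 0) => ?; [left; right | right].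
- split=> e e0; have [d d0 Hd] := reflected_small cF cn ck (cB _ (sball t t0 ttl)) e0 Hcase.
    have [w w0 Hw] := window t d t0 d0.
    exists (Num.min w (tau - t)); first by rewrite lt_min w0 subr_gt0.
    move=> h h0; rewrite lt_min ltrBrDl => /andP[hw htau].
    apply: (lim_le _ _ _ (lim_incr t h t0 (ltW h0) _)).
    (* On the window [B < B (s t) / 2], so these j make [1 + j%:R * B] negative and the weight
       zero. *)
    have big : \forall j \near U, B (s t) < 0 -> 2 / (- B (s t)) < j%:R.
      have [Bn|] := boolP (B (s t) < 0); last by move=> _; apply: nearW.
      by apply: ooU; have := nbhs_infty_gtr (2 / (- B (s t))); apply: filterS.
    apply: filterS2 Hw big => j Hw big.
    have -> : h = t + h - t by rewrite addrC addKr.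
    rewrite [t + (t + h - t)](_ : _ = t + h); last by ring.
    apply: rder_incr => //; [by rewrite lerDl ltW|exact: ltW| |].
      move=> q tq qth; apply: Lip_lcont; last exact: le_lt_trans tq.
      by have [] := Hsk j.
    move=> q tq qth; have [_ _ sD] := Hsk j.
    exists (g j (sk j q)); first by apply: sD; [exact: le_trans tq|exact: ltW (lt_trans qth htau)].
    have [h1 h2] := Hd _ (Hw q tq ltac:(by apply: ltW (lt_le_trans qth _); rewrite lerD2l ltW)).
    apply: h2 => // Bn; have := big Bn; have := h1 Bn; rewrite ltr_pdivrMr ?oppr_gt0 // => h3 h4.
    rewrite /th; apply/max_idPl; rewrite ge_min; apply/orP; right.
    have : (0:R) <= j%:R by []; nra.
  have [w w0 Hw] := near_s d d0; exists w => // h h0 hw.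
  have [h1 h2] := Hd _ (Hw h h0 hw); rewrite {1}/reflected; case: ifP => [/andP[k0 /eqP B0]|_].
    rewrite -[k (s (t + h))]mulr1 -{1}(max_idPl k0); apply: h2 => // Bn.
    by have := h1 Bn; rewrite B0; lra.
  by have := h2 0 (lexx 0) ler01 (fun _ => erefl); rewrite mulr0 scale0r subr0.
have [w1 w10 act] := active t t0 tt B0 k0.
have reflE x : 0 < k x -> B x = 0 -> reflected F0 nu B k x = F0 x - k x *: nu x.
  by move=> kx Bx; rewrite /reflected (ltW kx) Bx eqxx.
split=> e e0.
  rewrite reflE //.
  pose K := 1 + 2 * k (s t) + `|nu (s t)|.
  have K0 : 0 < K by rewrite /K ltr_wpDr // ltr_wpDr // mulr_ge0 // ltW.
  have eK0 : 0 < e / K by rewrite divr_gt0.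
  have /nbhs_ballP[d /= d0 Hd] : \forall x \near s t, (`|F0 (s t) - F0 x| <= e / K /\ `|nu (s t) - nu x| <= e / K)
    /\ (`|k (s t) - k x| <= e / K /\ `|k (s t) - k x| < k (s t)).
    by apply: filterI; apply: filterI; [move/cvgrPdist_le: cF|move/cvgrPdist_le: cn|move/cvgrPdist_le: ck|move/cvgrPdist_lt: ck]; apply.
  have [w w0 Hw] := window t d t0 d0.
  exists (Num.min w1 (Num.min w (tau - t))); first by rewrite !lt_min w10 w0 subr_gt0.
  move=> h h0; rewrite !lt_min ltrBrDl => /and3P[hw1 hw htau].
  set v := F0 (s t) - k (s t) *: nu (s t).
  have th_0 : 0 <= t + h by rewrite addr_ge0 // ltW.
  (* Its velocity [F0 - lam *: nu - (k - lam) *: nu (s t)] is close to [F0 - k *: nu] whatever the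
     weight. As B tends to 0 both at t and at [t + h], its increment has the same limit as that of
     [sk j]. *)
  pose q_ j (x : R) := sk j x + B (sk j x) *: (- nu (s t)).
  apply: (lim_le (fun j => q_ j (t + h) - q_ j t - h *: v)).
    move=> eta eta0; have eta20 : 0 < eta / 2 by rewrite divr_gt0.
    have N0 : 0 < 2 * (`|nu (s t)| + 1) by rewrite mulr_gt0 // ltr_wpDl.
    have eta40 : 0 < eta / 2 / (2 * (`|nu (s t)| + 1)) by rewrite divr_gt0.
    have F1 := lim_incr t h t0 (ltW h0) v _ eta20.
    have F2 := Blim _ _ t0 ttl eta40; have F3 := Blim _ _ th_0 (ltW htau) eta40.
    apply: filterS3 F1 F2 F3 => j h1; rewrite B0 (act h h0 hw1) !subr0 => h2 h3.
    have -> : q_ j (t + h) - q_ j t - h *: v - (s (t + h) - s t - h *: v) =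
      (sk j (t + h) - sk j t - h *: v - (s (t + h) - s t - h *: v)) -
      (B (sk j (t + h)) - B (sk j t)) *: nu (s t).
      by apply/colP => i; rewrite !mxE; ring.
    apply: le_lt_trans (ler_normB _ _) _; rewrite (splitr eta); apply: ltr_leD => //.
    rewrite normrZ.
    have h4 : `|B (sk j (t + h)) - B (sk j t)| <= eta / 2 / (`|nu (s t)| + 1).
      apply: le_trans (ler_normB _ _) _; apply: le_trans (ltW (ltrD h3 h2)) _.
      rewrite le_eqVlt; apply/orP; left; apply/eqP; field.
      by rewrite gt_eqF // ltr_wpDl.
    have := ler_wpM2r (normr_ge0 (nu (s t))) h4; move=> /le_trans; apply.
    rewrite [leLHS](_ : _ = eta / 2 * (`|nu (s t)| / (`|nu (s t)| + 1))); last by ring.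
    by rewrite ler_piMr ?(ltW eta20) // ler_pdivrMr ?ltr_wpDl // mul1r lerDl.
  apply: filterS Hw => j Hw.
  have -> : h = t + h - t by rewrite addrC addKr.
  rewrite [t + (t + h - t)](_ : _ = t + h); last by ring.
  apply: rder_incr => //; [by rewrite lerDl ltW|exact: ltW| |].
    move=> q tq qth; have q0 : 0 < q := le_lt_trans t0 tq.
    apply: cvgD; first by apply: Lip_lcont => //; have [] := Hsk j.
    apply: cvgZr_tmp; apply: Blc => //; exact: le_trans qth (ltW htau).
  move=> q tq qth; have [_ _ sD] := Hsk j; have q0 := le_trans t0 tq.
  have qtau : q <= tau := ltW (lt_trans qth htau).
  exists (g j (sk j q) + (k (sk j q) - lam j (sk j q)) *: (- nu (s t))).
    by apply: rderD; [exact: sD | apply: rderZl; exact: Bder].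
  have := Hd (sk j q); rewrite -ball_normE /= distrC Hw //; last first.
    by apply: ltW (lt_le_trans qth _); rewrite lerD2l ltW.
  move=> /(_ isT)[[f1 f2] [f3 f4]]; set x := sk j q in f1 f2 f3 f4 *.
  have -> : g j x + (k x - lam j x) *: (- nu (s t)) - v =
    - (F0 (s t) - F0 x) + lam j x *: (nu (s t) - nu x) + (k (s t) - k x) *: nu (s t).
    by apply/colP => i; rewrite /g /v !mxE; ring.
  have lamx : lam j x <= 2 * k (s t).
    have : lam j x <= Num.max (k x) 0 by rewrite ler_piMr // le_max lexx orbT.
    move=> /le_trans; apply; rewrite ge_max; move: f4; rewrite ltr_norml => /andP[? ?].
    by apply/andP; split; lra.
  apply: le_trans (ler_normD _ _) _.
  apply: le_trans (lerD (ler_normD _ _) (lexx _)) _; rewrite normrN (normrZ (lam j x)) (normrZ (k (s t) - k x)) (ger0_norm (lam0 _ _)).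
  have -> : e = e / K + 2 * k (s t) * (e / K) + `|nu (s t)| * (e / K).
    by rewrite -{1}[e](@divfK _ K) ?gt_eqF // /K; ring.
  apply: lerD; last by rewrite mulrC ler_wpM2l.
  by apply: lerD => //; apply: ler_pM.
have cr : {for s t, continuous (fun x => F0 x - k x *: nu x)}.
  by apply: contB; [exact: cF | exact: contZ].
have /nbhs_ballP[d /= d0 Hd] : \forall x \near s t,
   `|(F0 (s t) - k (s t) *: nu (s t)) - (F0 x - k x *: nu x)| <= e /\ `|k (s t) - k x| < k (s t).
  by apply: filterI; [move/cvgrPdist_le: cr|move/cvgrPdist_lt: ck]; apply.
have [w w0 Hw] := near_s d d0; exists (Num.min w w1); first by rewrite lt_min w0.
move=> h h0; rewrite lt_min => /andP[hw hw1].
have := Hd (s (t + h)); rewrite -ball_normE /= distrC Hw // => /(_ isT)[h1 h2].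
rewrite !reflE //; [by rewrite distrC| |exact: act].
by move: h2; rewrite ltr_norml => /andP[]; lra.
Unshelve. all: by end_near. Qed.

(** * Integral solutions *)

Lemma integrable_itvS (R : realType) (w : R -> R) (a t t' : R) : t <= t' ->
  lebesgue_measure.-integrable `[a, t'] (EFin \o w) ->
  lebesgue_measure.-integrable `[a, t] (EFin \o w).
Proof.
move=> tt'; apply: integrableS => //.
by apply: subset_itv; rewrite bnd_simp.
Qed.

Lemma Rintegral_itv_incr (R : realType) (w : R -> R) (a t t' : R) : a <= t -> t <= t' ->
  lebesgue_measure.-integrable `[a, t'] (EFin \o w) ->
  lebesgue_measure.-integrable `]t, t'] (EFin \o w) /\
  \int[lebesgue_measure]_(x in `[a, t']) w x - \int[lebesgue_measure]_(x in `[a, t]) w x =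
  \int[lebesgue_measure]_(x in `]t, t']) w x.
Proof.
move=> at_ tt' iw; split.
  apply: integrableS iw => //.
  by apply: subset_itv; rewrite bnd_simp.
by rewrite Rintegral_itvB // bnd_simp.
Qed.

Lemma Rintegral_itv_cst (R : realType) (t t' c : R) : t <= t' ->
  lebesgue_measure.-integrable `]t, t'] (EFin \o (fun=> c)) /\
  \int[lebesgue_measure]_(x in `]t, t']) c = c * (t' - t).
Proof.
move=> tt'.
have E : lebesgue_measure (`]t, t'] : set R) = (t' - t)%:E.
  rewrite lebesgue_measure_itv /= lte_fin; case: ltP => // t't.
  by have -> : t = t' by [apply: le_anti; rewrite tt']; rewrite subrr.
split; last by rewrite Rintegral_cst //; congr (_ * _); rewrite -[RHS]/(fine (t' - t)%:E) -E.
apply: measurable_bounded_integrable => //; first by rewrite -[X in (X < _)%E]/(lebesgue_measure (`]t, t'] : set R)) E ltry.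
exists `|c|; split; first exact: num_real.
by move=> x cx y _ /=; exact: ltW.
Qed.

Lemma Rintegral_itv_ub (R : realType) (w : R -> R) (a t t' c : R) : a <= t -> t <= t' ->
  lebesgue_measure.-integrable `[a, t'] (EFin \o w) ->
  (forall r, t < r -> r <= t' -> w r <= c) ->
  \int[lebesgue_measure]_(x in `[a, t']) w x - \int[lebesgue_measure]_(x in `[a, t]) w x
  <= c * (t' - t).
Proof.
move=> at_ tt' iw wc; have [iw' ->] := Rintegral_itv_incr at_ tt' iw.
have [ic <-] := Rintegral_itv_cst c tt'.
apply: le_Rintegral => // x; rewrite /= in_itv /= => /andP[]; exact: wc.
Qed.

Lemma Rintegral_itv_lb (R : realType) (w : R -> R) (a t t' c : R) : a <= t -> t <= t' ->
  lebesgue_measure.-integrable `[a, t'] (EFin \o w) ->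
  (forall r, t < r -> r <= t' -> c <= w r) ->
  c * (t' - t) <=
  \int[lebesgue_measure]_(x in `[a, t']) w x - \int[lebesgue_measure]_(x in `[a, t]) w x.
Proof.
move=> at_ tt' iw wc; have [iw' ->] := Rintegral_itv_incr at_ tt' iw.
have [ic <-] := Rintegral_itv_cst c tt'.
apply: le_Rintegral => // x; rewrite /= in_itv /= => /andP[]; exact: wc.
Qed.

Lemma Rintegral_itv_dist (R : realType) (w : R -> R) (a t t' c e : R) : a <= t -> t <= t' ->
  lebesgue_measure.-integrable `[a, t'] (EFin \o w) ->
  (forall r, t < r -> r <= t' -> `|w r - c| <= e) ->
  `|\int[lebesgue_measure]_(x in `[a, t']) w x - \int[lebesgue_measure]_(x in `[a, t]) w x
   - (t' - t) * c| <= e * (t' - t).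
Proof.
move=> at_ tt' iw wc; rewrite ler_distl.
have := @Rintegral_itv_ub R w a t t' (c + e) at_ tt' iw.
have := @Rintegral_itv_lb R w a t t' (c - e) at_ tt' iw.
move=> /(_ (fun r h1 h2 => ltac:(by have := wc r h1 h2; rewrite ler_distl => /andP[]))) h1.
move=> /(_ (fun r h1 h2 => ltac:(by have := wc r h1 h2; rewrite ler_distl => /andP[]))) h2.
by apply/andP; split; lra.
Qed.

Lemma Rintegral_comb (R : realType) (I : Type) (r : seq I) (w : I -> R -> R) (c : I -> R) (D : set R) :
  measurable D ->
  (forall i, lebesgue_measure.-integrable D (EFin \o w i)) ->
  lebesgue_measure.-integrable D (EFin \o (fun x => \sum_(i <- r) c i * w i x)) /\
  \int[lebesgue_measure]_(x in D) (\sum_(i <- r) c i * w i x) =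
  \sum_(i <- r) c i * \int[lebesgue_measure]_(x in D) w i x.
Proof.
move=> mD iw; elim: r => [|i r [IH1 IH2]].
  rewrite big_nil (_ : (fun x => _) = fun=> 0); last by apply/funext => x; rewrite big_nil.
  split; first exact: integrable0.
  by rewrite Rintegral_cst // mul0r.
rewrite big_cons (_ : (fun x => _) = fun x => c i * w i x + \sum_(j <- r) c j * w j x); last first.
  by apply/funext => x; rewrite big_cons.
have ici : lebesgue_measure.-integrable D (EFin \o (fun x => c i * w i x)).
  by have := @integrableZl _ _ _ lebesgue_measure D mD (c i) _ (iw i).
split; last by rewrite RintegralD // RintegralZl // IH2.
by have := @integrableD _ _ _ lebesgue_measure D mD _ _ ici IH1.
Qed.

(** q minus the integral of w is left continuous and, w being right continuous, has right derivative
    0; [rdle_le] for it and for its opposite makes its end values equal. This turns right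
    derivatives into the integral form required of solutions. *)
Lemma rder_Rintegral (R : realType) (q w : R -> R) (a b M : R) : a <= b ->
  (forall t, a < t -> t <= b -> lcont q t) ->
  (forall t, a <= t -> t < b -> rder q t (w t)) ->
  (forall t, a <= t -> t < b -> forall e : R, 0 < e -> exists2 d : R, 0 < d &
     forall h : R, 0 < h -> h < d -> `|w (t + h) - w t| <= e) ->
  measurable_fun (`[a, b] : set R) w -> (forall t, a <= t -> t <= b -> `|w t| <= M) ->
  lebesgue_measure.-integrable `[a, b] (EFin \o w) /\
  q b = q a + \int[lebesgue_measure]_(x in `[a, b]) w x.
Proof.
move=> ab lq dq cw mw bw.
have iw : lebesgue_measure.-integrable `[a, b] (EFin \o w).
  apply: measurable_bounded_integrable => //.
    by rewrite /= lebesgue_measure_itv /=; case: ifP => // _; rewrite ltry.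
  exists M; split; first exact: num_real.
  move=> x Mx y /=; rewrite in_itv /= => /andP[ay yb]; exact: le_trans (bw y ay yb) (ltW Mx).
split=> //.
pose J t := \int[lebesgue_measure]_(x in `[a, t]) w x.
pose D t := q t - J t.
have M0 : 0 <= M := le_trans (normr_ge0 _) (bw a (lexx a) ab).
have Jd t h : a <= t -> 0 <= h -> t + h <= b -> forall c e, (forall r, t < r -> r <= t + h -> `|w r - c| <= e) ->
   `|J (t + h) - J t - h * c| <= e * h.
  move=> at_ h0 thb c e H; have := @Rintegral_itv_dist R w a t (t + h) c e at_.
  rewrite lerDl [t + h - t]addrC addKr; apply => //.
  exact: integrable_itvS thb iw.
have lJ t : a < t -> t <= b -> lcont J t.
  move=> at_ tb; apply/lcontP => e e0.
  have M10 : 0 < M + 1 by rewrite ltr_wpDl.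
  exists (Num.min (t - a) (e / (M + 1))); first by rewrite lt_min subr_gt0 at_ divr_gt0.
  move=> r tr rt.
  have ar : a <= r.
    apply: ltW; apply: le_lt_trans tr; rewrite lerBrDr -lerBrDl ge_min lexx //.
  have tr' : t - r < e / (M + 1).
    by rewrite ltrBlDr -ltrBlDl; apply: le_lt_trans tr; rewrite lerD2l lerN2 ge_min lexx orbT.
  have := Jd r (t - r) ar; rewrite subr_ge0 [r + _](_ : _ = t); last by ring.
  move=> /(_ rt tb 0 M) H; have {}H : `|J t - J r - (t - r) * 0| <= M * (t - r).
    apply: H => x rx xt; rewrite subr0; apply: bw; first exact: le_trans ar (ltW rx).
    exact: le_trans xt tb.
  rewrite mulr0 subr0 distrC in H; apply: le_lt_trans H _.
  apply: (@le_lt_trans _ _ ((M + 1) * (t - r))); first by rewrite ler_wpM2r ?subr_ge0 // lerDl.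
  by rewrite mulrC -ltr_pdivlMr.
have dD t : a <= t -> t < b -> rder D t 0.
  move=> at_ tb e e0; have e20 : 0 < e / 2 by rewrite divr_gt0.
  have [d1 d10 H1] := dq t at_ tb _ e20; have [d2 d20 H2] := cw t at_ tb _ e20.
  exists (Num.min d1 (Num.min d2 (b - t))); first by rewrite !lt_min d10 d20 subr_gt0.
  move=> h h0; rewrite !lt_min ltrBrDl => /and3P[hd1 hd2 hb].
  have := H1 h h0 hd1; have := Jd t h at_ (ltW h0) (ltW hb) (w t) (e / 2).
  move=> /(_ _) H; have {}H := H (fun r h1 h2 => ltac:(
    have := H2 (r - t); rewrite subr_gt0 ltrBlDl [t + (r - t)](_ : _ = r); [|by ring];
    by apply; [|apply: le_lt_trans h2 _; rewrite ltrD2l])).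
  rewrite scaler0 subr0 /D; have -> : h *: w t = h * w t by [].
  move: H; rewrite !ler_norml => /andP[h1 h2] /andP[h3 h4]; apply/andP; split; lra.
have lD t : a < t -> t <= b -> lcont D t by move=> at_ tb; apply: cvgB; [exact: lq|exact: lJ].
have : D b - D a <= 0 * (b - a).
  by apply: rdle_le => // t at_ tb; apply: rder_rdle (dD t at_ tb) _.
have : (- D b) - (- D a) <= 0 * (b - a).
  apply: (@rdle_le R (fun t => - D t)) => // t at_ tb; first by apply: cvgN; exact: lD.
  by apply: rder_rdle (rderN (dD t at_ tb)) _; rewrite oppr0.
rewrite mul0r /D /J set_itv1 Rintegral_set1 => h1 h2; lra.
Qed.

(** * Integral solutions on intervals: gluing, closing, continuation *)

Lemma integrable_setU (R : realType) (A B : set R) (f : R -> R) :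
  measurable A -> measurable B -> [disjoint A & B] ->
  lebesgue_measure.-integrable A (EFin \o f) -> lebesgue_measure.-integrable B (EFin \o f) ->
  lebesgue_measure.-integrable (A `|` B) (EFin \o f).
Proof.
move=> mA mB dAB hA hB.
have /integrableP[mgA _] := integrable_abse hA; have /integrableP[mgB _] := integrable_abse hB.
move: hA hB => /integrableP[mfA iA] /integrableP[mfB iB].
apply/integrableP; split; first exact/measurable_funU.
rewrite integral_setU //; first exact: lte_add_pinfty.
exact/measurable_funU.
Qed.

(** Closed intervals with an arbitrary initial time, so that solutions can be glued. *)
Definition sol_on (R : realType) (m : nat) (K : set 'cV[R]_m) (F : 'cV[R]_m -> 'cV[R]_m)
    (a b : R) (y : R -> 'cV[R]_m) : Prop :=
  forall t : R, a <= t -> t <= b -> K (y t) /\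
    forall i, lebesgue_measure.-integrable `[a, t] (EFin \o (fun s => F (y s) i 0)) /\
      y t i 0 = y a i 0 + \int[lebesgue_measure]_(s in `[a, t]) F (y s) i 0.

Lemma solutionP (R : realType) (m : nat) (K : set 'cV[R]_m) (F : 'cV[R]_m -> 'cV[R]_m)
    (T : \bar R) (y : R -> 'cV[R]_m) :
  solution K F T y <-> forall b : R, (b%:E < T)%E -> sol_on K F 0 b y.
Proof.
split=> [sol b bT t t0 tb|sol t t0 tT]; last by apply: (sol t tT).
by apply: sol => //; apply: le_lt_trans bT; rewrite lee_fin.
Qed.

Lemma sol_on_eq (R : realType) (m : nat) (K : set 'cV[R]_m) (F : 'cV[R]_m -> 'cV[R]_m)
    (a b : R) (x y : R -> 'cV[R]_m) :
  (forall t, a <= t -> t <= b -> x t = y t) -> sol_on K F a b x -> sol_on K F a b y.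
Proof.
move=> xy sx t at_ tb; have [Kx ix] := sx t at_ tb; split; first by rewrite -xy.
have E i : {in `[a, t]%classic, (fun s => F (x s) i 0) =1 (fun s => F (y s) i 0)}.
  by move=> s; rewrite inE /= in_itv /= => /andP[h1 h2]; rewrite xy // (le_trans h2).
move=> i; have [i1 i2] := ix i; split.
  by apply: eq_integrable i1 => // s hs /=; rewrite E.
rewrite -xy // -xy ?(le_trans at_ tb) // i2; congr (_ + _).
by apply: eq_Rintegral => s hs; rewrite E.
Qed.

Lemma sol_on_concat (R : realType) (m : nat) (K : set 'cV[R]_m) (F : 'cV[R]_m -> 'cV[R]_m)
    (a b c : R) (x y : R -> 'cV[R]_m) : a <= b ->
  sol_on K F a b x -> sol_on K F b c y -> y b = x b ->
  sol_on K F a c (fun t => if t <= b then x t else y t).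
Proof.
move=> ab sx sy yx; set z := fun t => _.
have sz1 : sol_on K F a b z by apply: sol_on_eq sx => t at_ tb; rewrite /z tb.
have sz2 : sol_on K F b c z.
  apply: sol_on_eq sy => t bt tc; rewrite /z; case: leP => // tb.
  by have -> : t = b by [apply: le_anti; rewrite tb bt].
move=> t at_ tc; have [tb|bt] := leP t b; first exact: sz1.
have [Kz iz] := sz2 t (ltW bt) tc; split => // i.
have [i1 e1] := (sz1 b ab (lexx b)).2 i; have [i2 e2] := iz i.
have i2' : lebesgue_measure.-integrable `]b, t] (EFin \o (fun s => F (z s) i 0)).
  by apply: integrableS i2 => //; apply: subset_itv; rewrite bnd_simp.
have U : `[a, t]%classic = `[a, b]%classic `|` `]b, t]%classic :> set R.
  by rewrite -itv_bndbnd_setU // bnd_simp // ltW.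
have dj : [disjoint `[a, b]%classic & (`]b, t]%classic : set R)].
  apply/disj_set2P; rewrite -subset0 => s [] /=; rewrite !in_itv /= => /andP[_ h1] /andP[h2 _].
  by move: (le_lt_trans h1 h2); rewrite ltxx.
have iU : lebesgue_measure.-integrable `[a, t] (EFin \o (fun s => F (z s) i 0)).
  by rewrite U; apply: integrable_setU.
split=> //; rewrite U Rintegral_setU //; last by rewrite -U.
by rewrite e2 e1 -addrA; congr (_ + (_ + _)); rewrite Rintegral_itv_obnd_cbnd.
Qed.

Lemma sol_on_cont (R : realType) (m : nat) (K : set 'cV[R]_m) (F : 'cV[R]_m -> 'cV[R]_m)
    (a b : R) (y : R -> 'cV[R]_m) (t e : R) : a <= t -> t <= b -> sol_on K F a b y -> 0 < e ->
  exists2 d : R, 0 < d & forall r, a <= r -> r <= b -> `|r - t| < d -> `|y r - y t| < e.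
Proof.
move=> at_ tb sy e0; have ab := le_trans at_ tb.
have H i : exists2 d : R, 0 < d & forall r, a <= r -> r <= b -> `|r - t| < d -> `|y r i 0 - y t i 0| < e.
  have [ib _] := (sy b ab (lexx b)).2 i.
  have /subspace_continuousP/(_ t) := parameterized_integral_continuous ab ib.
  move=> /(_ ltac:(by rewrite /= in_itv /= at_)) /cvgrPdist_lt /(_ e e0).
  move=> /nbhs_ballP[d /= d0 Hd]; exists d => // r ar rb rt.
  have := Hd r; rewrite /ball /= distrC => /(_ rt); rewrite in_itv /= ar => /(_ rb).
  have [_ e1] := (sy r ar rb).2 i; have [_ e2] := (sy t at_ tb).2 i.
  rewrite distrC (_ : y r i 0 - y t i 0 = \int[lebesgue_measure]_(s in `[a, r]) F (y s) i 0 -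
    \int[lebesgue_measure]_(s in `[a, t]) F (y s) i 0) //.
  by rewrite e1 e2 opprD addrACA subrr add0r.
have [d Hd] := choice (fun i => let: ex_intro2 d h1 h2 := H i in ex_intro _ d (conj h1 h2)).
exists (\big[Num.min/1]_i d i); first by apply: lt_bigmin => // i _; case: (Hd i).
move=> r ar rb rt; apply/cV_norm_lt => // i; rewrite !mxE.
apply: (Hd i).2 => //; apply: lt_le_trans rt _.
exact: bigmin_le.
Qed.

Lemma sol_on_lcont (R : realType) (m : nat) (K : set 'cV[R]_m) (F : 'cV[R]_m -> 'cV[R]_m)
    (a b : R) (y : R -> 'cV[R]_m) (t : R) : a < t -> t <= b -> sol_on K F a b y -> lcont y t.
Proof.
move=> at_ tb sy; apply/lcontP => e e0; have [d d0 Hd] := sol_on_cont (ltW at_) tb sy e0.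
exists (Num.min d (t - a)); first by rewrite lt_min d0 subr_gt0.
move=> r tr rt; apply: Hd; last 1 first.
- rewrite distrC ger0_norm ?subr_ge0 // ltrBlDr -ltrBlDl; apply: le_lt_trans tr.
  by rewrite lerD2l lerN2 ge_min lexx.
- apply: ltW; apply: le_lt_trans tr; rewrite lerBrDr -lerBrDl ge_min lexx orbT //.
- exact: le_trans rt tb.
Qed.

Lemma sol_on_incr (R : realType) (m : nat) (K : set 'cV[R]_m) (F : 'cV[R]_m -> 'cV[R]_m)
    (a b : R) (y : R -> 'cV[R]_m) (t t' M : R) : a <= t -> t <= t' -> t' <= b -> sol_on K F a b y ->
  0 <= M -> (forall r, t < r -> r <= t' -> `|F (y r)| <= M) -> `|y t' - y t| <= M * (t' - t).
Proof.
move=> at_ tt' t'b sy M0 H.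
apply/cV_norm_le; first by rewrite mulr_ge0 // subr_ge0.
move=> i; rewrite !mxE.
have [i1 ->] := (sy t' (le_trans at_ tt') t'b).2 i.
have [_ ->] := (sy t at_ (le_trans tt' t'b)).2 i.
rewrite opprD addrACA subrr add0r.
have := @Rintegral_itv_dist R (fun s => F (y s) i 0) a t t' 0 M at_ tt' i1.
rewrite mulr0 subr0; apply => r tr rt'; rewrite subr0.
by apply: le_trans (H r tr rt'); exact: cV_coord_le.
Qed.

Lemma cV_sum_delta (R : realType) (m : nat) (v : 'cV[R]_m) : v = \sum_i v i 0 *: delta_mx i 0.
Proof.
rewrite [LHS]matrix_sum_delta; apply: eq_bigr => i _; rewrite big_ord1.
by congr (_ *: _).
Qed.

Lemma diff_cV (R : realType) (m : nat) (g : 'cV[R]_m -> R) (x v : 'cV[R]_m) :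
  'd g x v = \sum_i 'd g x (delta_mx i 0) * v i 0.
Proof.
rewrite [in LHS](cV_sum_delta v) linear_sum; apply: eq_bigr => i _.
by rewrite linearZ /= mulrC.
Qed.

(** The differential of g at [y t] is linear, so it passes through the integral that gives the
    increment of y. Bounding it on the velocities at later times bounds the Dini derivative; the
    velocity at the single time t carries no information about an integral solution. *)
Lemma sol_on_rdle (R : realType) (m : nat) (K : set 'cV[R]_m) (F : 'cV[R]_m -> 'cV[R]_m)
    (a b : R) (y : R -> 'cV[R]_m) (t M c : R) (g : 'cV[R]_m -> R) :
  a <= t -> t < b -> sol_on K F a b y -> differentiable g (y t) ->
  (forall r, t < r -> r <= b -> `|F (y r)| <= M) ->
  (forall e : R, 0 < e -> exists2 d : R, 0 < d & forall r, t < r -> r < t + d -> r <= b ->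
     'd g (y t) (F (y r)) <= c + e) ->
  rdle (g \o y) t c.
Proof.
move=> at_ tb sy dg bF H e e0.
have M0 : 0 <= M := le_trans (normr_ge0 _) (bF b tb (lexx b)).
have M10 : 0 < M + 1 by rewrite ltr_wpDl.
have e20 : 0 < e / 2 by rewrite divr_gt0.
have e30 : 0 < e / (2 * (M + 1)) by rewrite divr_gt0 // mulr_gt0.
have [d1 d10 H1] := diff_eps dg e30; have [d2 d20 H2] := H _ e20.
exists (Num.min (b - t) (Num.min (d1 / (M + 1)) d2)).
  by rewrite !lt_min subr_gt0 tb d20 divr_gt0.
move=> h h0; rewrite !lt_min ltrBrDl => /and3P[hb hd1 hd2].
have tth : t <= t + h by rewrite lerDl ltW.
have inc : `|y (t + h) - y t| <= M * h.
  have := @sol_on_incr R m K F a b y t (t + h) M at_ tth (ltW hb) sy M0.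
  rewrite [t + h - t](_ : _ = h); last by ring.
  by apply => r tr rth; apply: bF => //; apply: le_trans rth (ltW hb).
have inc' : `|y (t + h) - y t| < d1.
  apply: le_lt_trans inc _; apply: (@le_lt_trans _ _ ((M + 1) * h)); first by rewrite ler_wpM2r ?(ltW h0) // lerDl.
  by rewrite mulrC -ltr_pdivlMr.
have := H1 _ inc'; move=> /(le_trans (ler_norm _)).
have K1 : e / (2 * (M + 1)) * `|y (t + h) - y t| <= e / 2 * h.
  apply: le_trans (ler_wpM2l (ltW e30) inc) _.
  rewrite [leLHS](_ : _ = e / 2 * h * (M / (M + 1))); last by field; rewrite gt_eqF.
  rewrite -[leRHS]mulr1; apply: ler_wpM2l; first by rewrite mulr_ge0 // ltW.
  by rewrite ler_pdivrMr // mul1r lerDl.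
have K2 : 'd g (y t) (y (t + h) - y t) <= (c + e / 2) * h.
  rewrite diff_cV.
  have ii i := ((sy (t + h) (le_trans at_ tth) (ltW hb)).2 i).1.
  have [iw ew] := Rintegral_comb (index_enum 'I_m) (fun i => 'd g (y t) (delta_mx i 0))
    (measurable_itv `[a, t + h]) ii.
  have [_ ew'] := Rintegral_comb (index_enum 'I_m) (fun i => 'd g (y t) (delta_mx i 0))
    (measurable_itv `[a, t]) (fun i => integrable_itvS tth (ii i)).
  have -> : \sum_i 'd g (y t) (delta_mx i 0) * (y (t + h) - y t) i 0 =
     \int[lebesgue_measure]_(x in `[a, t + h]) (\sum_i 'd g (y t) (delta_mx i 0) * F (y x) i 0)
    - \int[lebesgue_measure]_(x in `[a, t]) (\sum_i 'd g (y t) (delta_mx i 0) * F (y x) i 0).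
    rewrite ew ew' -sumrB; apply: eq_bigr => i _; rewrite -mulrBr; congr (_ * _); rewrite !mxE.
    have [_ ->] := (sy (t + h) (le_trans at_ tth) (ltW hb)).2 i.
    have [_ ->] := (sy t at_ (ltW tb)).2 i.
    by rewrite opprD addrACA subrr add0r.
  have := @Rintegral_itv_ub R _ a t (t + h) (c + e / 2) at_ tth iw.
  rewrite [t + h - t](_ : _ = h); last by ring.
  apply => r tr rth; rewrite -diff_cV; apply: H2 => //.
    by apply: le_lt_trans rth _; rewrite ltrD2l.
  exact: le_trans rth (ltW hb).
rewrite /= => H3; lra.
Qed.

(** A bounded field makes y Lipschitz, so y has a limit at b, taken along an ultrafilter on the
    times [tn k]. With this limit as value at b, the integral equation extends to b by continuity of
    both sides. *)
Lemma sol_on_close (R : realType) (m : nat) (K : set 'cV[R]_m) (F : 'cV[R]_m -> 'cV[R]_m)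
    (a b M : R) (y : R -> 'cV[R]_m) : a < b ->
  (forall t, t < b -> sol_on K F a t y) ->
  (forall t, a <= t -> t < b -> `|F (y t)| <= M) ->
  exists p : 'cV[R]_m, (forall t, a <= t -> t < b -> `|y t - p| <= M * (b - t)) /\
    (K p -> sol_on K F a b (fun t => if t < b then y t else p)).
Proof.
move=> ab sy bF; have M0 : 0 <= M := le_trans (normr_ge0 _) (bF a (lexx a) ab).
have [U [UU ooU]] := natultra.
pose tn (k : nat) := b - (b - a) / k.+1%:R.
have ba0 : 0 < b - a by rewrite subr_gt0.
have tnb k : tn k < b by rewrite /tn gtrBl divr_gt0.
have atn k : a <= tn k.
  by rewrite /tn lerBrDl -lerBrDr ler_pdivrMr // ler_peMr ?ler1n // ltW.
have inc (t t' : R) : a <= t -> t <= t' -> t' < b -> `|y t' - y t| <= M * (t' - t).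
  move=> at_ tt' t'b; apply: (sol_on_incr at_ tt' (lexx t') (sy t' t'b) M0) => r tr rt'.
  by apply: bF; [exact: le_trans at_ (ltW tr)|exact: le_lt_trans rt' t'b].
have [k|p Hp] := @ultra_bounded_cvg R U m (fun k => y (tn k)) (`|y a| + M * (b - a)) UU.
  rewrite -[y (tn k)](subrK (y a)) addrC; apply: le_trans (ler_normD _ _) _; rewrite lerD2l.
  apply: le_trans (inc a (tn k) (lexx a) (atn k) (tnb k)) _.
  by rewrite ler_wpM2l // lerD2r ltW.
have lim (t : R) : a <= t -> t < b -> `|y t - p| <= M * (b - t).
  move=> at_ tb; apply/ler_addgt0Pr => e e0.
  have tk : \forall k \near U, t <= tn k.
    apply: ooU; have := nbhs_infty_gtr ((b - a) / (b - t)); apply: filterS => k hk.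
    rewrite /tn lerBrDl -lerBrDr ler_pdivrMr // mulrC -ler_pdivrMr ?subr_gt0 //.
    by apply: ltW; apply: lt_le_trans hk _; rewrite ler_nat.
  near U => k.
  have h1 : t <= tn k by near: k.
  have h2 : `|y (tn k) - p| < e by near: k; exact: Hp.
  have -> : y t - p = (y (tn k) - p) - (y (tn k) - y t) by apply/colP => i; rewrite !mxE; ring.
  apply: le_trans (ler_normB _ _) _; rewrite addrC; apply: lerD; last exact: ltW.
  by apply: le_trans (inc t (tn k) at_ h1 (tnb k)) _; rewrite ler_wpM2l // lerD2r ltW.
exists p; split=> // Kp; set z := fun t => _.
have zb : z b = p by rewrite /z ltxx.
have zE t : t < b -> z t = y t by rewrite /z => ->.
have sz t : t < b -> sol_on K F a t z.
  by move=> tb; apply: sol_on_eq (sy t tb) => s _ st; rewrite zE // (le_lt_trans st).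
move=> t at_; rewrite le_eqVlt => /orP[/eqP->|tb]; last by apply: (sz t tb).
split=> [|i]; first by rewrite zb.
set w := fun s => F (z s) i 0.
have mw : measurable_fun (`[a, b[ : set R) w.
  have -> : `[a, b[%classic = \bigcup_k `[a, tn k]%classic :> set R.
    apply/seteqP; split=> s /=; rewrite in_itv /=.
      move=> /andP[as_ sb].
      have /filter_ex[k hk] := nbhs_infty_gtr ((b - a) / (b - s)).
      exists k => //=; rewrite in_itv /= as_ /= /tn lerBrDl -lerBrDr ler_pdivrMr // mulrC.
      rewrite -ler_pdivrMr ?subr_gt0 //.
      by apply: ltW; apply: lt_le_trans hk _; rewrite ler_nat.
    by move=> [k _ /=]; rewrite in_itv /= => /andP[-> h]; exact: le_lt_trans h (tnb k).
  apply/measurable_fun_bigcup => // k.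
  have [/integrableP[h _] _] := (sz (tn k) (tnb k) (tn k) (atn k) (lexx _)).2 i.
  exact/measurable_realfun.measurable_EFinP.
have bw s : a <= s -> s <= b -> `|w s| <= Num.max M `|F p|.
  rewrite /w => as_; rewrite le_eqVlt => /orP[/eqP->|sb].
    by rewrite zb; apply: le_trans (cV_coord_le _ _) _; rewrite le_max lexx orbT.
  by rewrite zE //; apply: le_trans (cV_coord_le _ _) _; rewrite le_max bF.
set M' := Num.max M _ in bw.
have M'0 : 0 <= M' by rewrite le_max M0.
have iw : lebesgue_measure.-integrable `[a, b] (EFin \o w).
  apply: measurable_bounded_integrable => //.
  - by rewrite /= lebesgue_measure_itv /=; case: ifP => // _; rewrite ltry.
  - exact/measurable_realfun.measurable_fun_itv_bndo_bndcP.
  exists M'; split; first exact: num_real.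
  move=> x Mx s /=; rewrite in_itv /= => /andP[as_ sb]; exact: le_trans (bw s as_ sb) (ltW Mx).
split=> //; apply/eqP; rewrite -subr_eq0 -normr_le0; apply/ler_addgt0Pr => e e0; rewrite add0r.
(* Between [b - d] and b the solution moves by at most [M * d] and the integral by at most
   [M' * d]. *)
pose d := Num.min (b - a) (e / (M + M' + 1)).
have MM0 : 0 < M + M' + 1 by rewrite ltr_wpDl // addr_ge0.
have d0 : 0 < d by rewrite lt_min ba0 divr_gt0.
have sb : b - d < b by rewrite gtrBl.
have as_ : a <= b - d by rewrite lerBrDr -lerBrDl ge_min lexx.
have [_ e1] := (sz _ sb (b - d) as_ (lexx _)).2 i.
have := @Rintegral_itv_dist R w a (b - d) b 0 M' as_ (ltW sb) iw.
rewrite mulr0 subr0 => /(_ (fun r h1 h2 => ltac:(by rewrite subr0; apply: bw => //; exact: le_trans as_ (ltW h1)))).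
have := lim _ as_ sb; rewrite -zE // => /(le_trans (cV_coord_le _ i)); rewrite !mxE zb e1 -/w.
have -> : b - (b - d) = d by ring.
have : (M + M') * d <= e.
  apply: (@le_trans _ _ ((M + M' + 1) * d)); first by rewrite ler_wpM2r ?(ltW d0) // lerDl.
  by rewrite mulrC -ler_pdivlMr // ge_min lexx orbT.
rewrite !ler_norml => h1 /andP[h2 h3] /andP[h4 h5]; apply/andP; split; lra.
Unshelve. all: by end_near. Qed.

Lemma reflected_sol (R : realType) (m : nat) (F0 nu : 'cV[R]_m -> 'cV[R]_m)
    (B k : 'cV[R]_m -> R) (s0 : 'cV[R]_m) (r M : R) (K : set 'cV[R]_m)
    (F : 'cV[R]_m -> 'cV[R]_m) :
  0 < r -> 0 < M ->
  (forall p, `|p - s0| <= r ->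
    [/\ {for p, continuous F0}, {for p, continuous nu}, {for p, continuous k}
       & differentiable B p] /\
    [/\ `|F0 p| + `|k p| * `|nu p| <= M, 'D_(F0 p) B p = k p & 'D_(nu p) B p = 1]) ->
  B s0 <= 0 ->
  (forall p, `|p - s0| <= r -> B p <= 0 -> K p /\ F p = reflected F0 nu B k p) ->
  forall T : R, exists y, y T = s0 /\ sol_on K F T (T + r / M) y.
Proof.
move=> r0 M0 Hp Bs0 KF T.
have [s [s00 sL sB sD]] := reflected_exists r0 M0 Hp Bs0.
have tau0 : 0 < r / M by rewrite divr_gt0.
(* s is controlled at nonnegative times only; it is frozen before T so that q is continuous on the
   whole line. *)
pose q (t : R) := s (Num.max (t - T) 0).
have qL (t t' : R) : t <= t' -> `|q t' - q t| <= M * (t' - t).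
  move=> tt'; rewrite /q.
  have [h1|h1] := leP (t' - T) 0.
    have h2 : t - T <= 0 by apply: le_trans h1; rewrite lerD2r.
    by rewrite (max_idPr h2) subrr normr0 mulr_ge0 ?(ltW M0) // subr_ge0.
  have h0 : 0 <= Num.max (t - T) 0 by rewrite le_max lexx orbT.
  have h3 : Num.max (t - T) 0 <= t' - T by rewrite ge_max lerD2r tt' ltW.
  have := sL _ (t' - T - Num.max (t - T) 0) h0; rewrite subr_ge0 => /(_ h3).
  rewrite [_ + (_ - _)](_ : _ = t' - T); last by ring.
  move=> /le_trans; apply; rewrite ler_pM2l //.
  have h4 : t - T <= Num.max (t - T) 0 by rewrite le_max lexx.
  lra.
have qc (t : R) : {for t, continuous q}.
  apply/cvgrPdist_lt => e e0; apply/nbhs_ballP; exists (e / M); first exact: divr_gt0.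
  move=> u; rewrite /ball /= => tu.
  have [ut|/ltW ut] := leP u t.
    by apply: le_lt_trans (qL u t ut) _; rewrite mulrC -ltr_pdivlMr // -[t - u]ger0_norm // subr_ge0.
  rewrite distrC; apply: le_lt_trans (qL t u ut) _.
  by rewrite mulrC -ltr_pdivlMr // -[u - t]ger0_norm ?subr_ge0 // distrC.
have qs (t : R) : T <= t -> q t = s (t - T) by move=> Tt; rewrite /q (max_idPl _) // subr_ge0.
pose cl := clamp s0 r.
have clr p : `|cl p - s0| <= r by exact: clamp_ball (ltW r0).
have mcomp (u : 'cV[R]_m -> R) : (forall p, `|p - s0| <= r -> {for p, continuous u}) ->
    measurable_fun (setT : set R) (fun t => u (cl (q t))).
  move=> cu; apply: measurable_realfun.continuous_measurable_fun => t.
  apply: (@continuous_comp _ _ _ (cl \o q) u); last by apply: cu; exact: clr.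
  by apply: (@continuous_comp _ _ _ q cl); [exact: qc|exact: clamp_continuous].
have cB p : `|p - s0| <= r -> {for p, continuous B}.
  by move=> /Hp[[_ _ _ dB] _]; exact: differentiable_continuous.
(* The reflected field is discontinuous, but it chooses between two continuous expressions by a
   measurable test; [cl] makes these continuous in t on the whole line. *)
have mrefl i : measurable_fun (setT : set R) (fun t => reflected F0 nu B k (cl (q t)) i 0).
  rewrite (_ : (fun t => _) = (fun t => if (0 <= k (cl (q t))) && (B (cl (q t)) == 0) then
     F0 (cl (q t)) i 0 - k (cl (q t)) * nu (cl (q t)) i 0 else F0 (cl (q t)) i 0)); last first.
    by apply/funext => t; rewrite /reflected; case: ifP => _; rewrite ?mxE.
  have cE (g : 'cV[R]_m -> 'cV[R]_m) p : {for p, continuous g} -> {for p, continuous (fun p => g p i 0)}.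
    move=> cg; apply: (@continuous_comp _ _ _ g (fun x : 'cV[R]_m => x i 0)) => //.
    exact: coord_continuous.
  apply: measurable_fun_ifT.
  - apply: measurable_and.
      apply: measurable_realfun.measurable_fun_ler; first exact: measurable_cst.
      by apply: mcomp => p /Hp[[]].
    apply: measurable_realfun.measurable_fun_eqr; last exact: measurable_cst.
    exact: mcomp.
  - apply: (mcomp (fun p => F0 p i 0 - k p * nu p i 0)) => p /Hp[[c1 c2 c3 _] _].
    by apply: contB; [exact: cE|apply: contM => //; exact: cE].
  - by apply: (mcomp (fun p => F0 p i 0)) => p /Hp[[c1 _ _ _] _]; exact: cE.
have inb (t : R) : T <= t -> t <= T + r / M -> [/\ `|q t - s0| <= r, B (q t) <= 0 & cl (q t) = q t].
  move=> Tt tT; have [|h1 h2] := sB (t - T) _ ltac:(by rewrite lerBlDl); first by rewrite subr_ge0.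
  by rewrite qs //; split => //; exact: clamp_id.
exists q; split; first by rewrite qs // subrr.
move=> t Tt tT; have [h1 h2 h3] := inb t Tt tT; split; first by have [] := KF _ h1 h2.
move=> i.
have Fq (u : R) : T <= u -> u <= t -> F (q u) = reflected F0 nu B k (q u).
  by move=> Tu ut; have [g1 g2 _] := inb u Tu (le_trans ut tT); have [] := KF _ g1 g2.
apply: (@rder_Rintegral R (fun u => q u i 0) (fun u => F (q u) i 0) T t M) => //.
- move=> u Tu ut; apply: (@lcont_comp _ _ _ q (fun x : 'cV[R]_m => x i 0)); last exact: coord_continuous.
  by apply: continuous_lcont; exact: qc.
- move=> u Tu ut e e0; have [|D _] := sD (u - T) _ ltac:(by rewrite ltrBlDl; exact: lt_le_trans tT).
    by rewrite subr_ge0.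
  have [d d0 Hd] := D e e0; exists d => // h hh hd.
  have Tuh : T <= u + h by rewrite ler_wpDr // ltW.
  have := Hd h hh hd; rewrite [u - T + h]addrAC -(qs (u + h)) // -(qs u) // -Fq // ?(ltW ut) //.
  by move=> /(le_trans (cV_coord_le _ i)); rewrite !mxE.
- move=> u Tu ut e e0; have [|_ D] := sD (u - T) _ ltac:(by rewrite ltrBlDl; exact: lt_le_trans tT).
    by rewrite subr_ge0.
  have [d d0 Hd] := D e e0; exists (Num.min d (t - u)); first by rewrite lt_min d0 subr_gt0.
  move=> h hh; rewrite lt_min ltrBrDl => /andP[hd ht].
  have Tuh : T <= u + h by rewrite ler_wpDr // ltW.
  have := Hd h hh hd; rewrite [u - T + h]addrAC -!qs // -!Fq ?(ltW ut) ?(ltW ht) //.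
  by move=> /(le_trans (cV_coord_le _ i)); rewrite !mxE.
- apply: (@eq_measurable_fun _ _ _ _ _ (fun u => reflected F0 nu B k (cl (q u)) i 0)).
    move=> u; rewrite inE /= in_itv /= => /andP[Tu ut]; rewrite Fq //.
    by have [_ _ ->] := inb u Tu (le_trans ut tT).
  exact: measurable_funTS.
- move=> u Tu ut; rewrite Fq //; apply: le_trans (cV_coord_le _ _) _.
  have [g1 _ _] := inb u Tu (le_trans ut tT); have [_ [g2 _ _]] := Hp _ g1.
  rewrite /reflected; case: ifP => _; last by apply: le_trans g2; rewrite lerDl mulr_ge0.
  by apply: le_trans g2; apply: le_trans (ler_normB _ _) _; rewrite normrZ.
Qed.

(** The gain tau is the same at each extension, so iteration exhausts the half line. Solutions not
    being unique, each extension is chosen to agree with the previous one, which makes the union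
    well defined. *)
Lemma sol_on_extend (R : realType) (m : nat) (K : set 'cV[R]_m) (F : 'cV[R]_m -> 'cV[R]_m)
    (tau : R) (p : 'cV[R]_m) : 0 < tau ->
  (forall (T : R) x, 0 <= T -> sol_on K F 0 T x -> x 0 = p ->
     exists y, sol_on K F 0 (T + tau) y /\ forall t, 0 <= t -> t <= T -> y t = x t) ->
  forall (T : R) x, 0 <= T -> sol_on K F 0 T x -> x 0 = p ->
    exists y, solution K F +oo%E y /\ forall t, 0 <= t -> t <= T -> y t = x t.
Proof.
move=> tau0 ext T x T0 sx xp.
pose Tk (k : nat) := T + k%:R * tau.
have Tk0 k : 0 <= Tk k by rewrite addr_ge0 // mulr_ge0 // ltW.
have TkS k : Tk k.+1 = Tk k + tau by rewrite /Tk -natr1; ring.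
(* Stated for all pairs so that [choice] applies; when the premises fail, x is a dummy value. *)
have H (kx : nat * (R -> 'cV[R]_m)) : exists y, sol_on K F 0 (Tk kx.1) kx.2 -> kx.2 0 = p ->
    sol_on K F 0 (Tk kx.1.+1) y /\ forall t, 0 <= t -> t <= Tk kx.1 -> y t = kx.2 t.
  have [[s1 s2]|ns] := pselect (sol_on K F 0 (Tk kx.1) kx.2 /\ kx.2 0 = p).
    by have [y Hy] := ext _ _ (Tk0 kx.1) s1 s2; exists y => _ _; rewrite TkS.
  by exists x => s1 s2; case: ns.
have [nxt Hnxt] := choice H.
pose X := fix X k := if k is j.+1 then nxt (j, X j) else x.
have XP k : sol_on K F 0 (Tk k) (X k) /\ X k 0 = p.
  elim: k => [|k [IH1 IH2]]; first by rewrite /Tk mul0r addr0.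
  have [h1 h2] := Hnxt (k, X k) IH1 IH2; split; first exact: h1.
  by rewrite -IH2; exact: (h2 0 (lexx _) (Tk0 k)).
have XE k j (t : R) : (k <= j)%N -> 0 <= t -> t <= Tk k -> X j t = X k t.
  elim: j => [|j IH]; first by rewrite leqn0 => /eqP->.
  rewrite leq_eqVlt => /orP[/eqP->//|]; rewrite ltnS => kj t0 tk; rewrite -IH //.
  have [h1 h2] := XP j; apply: (Hnxt (j, X j) h1 h2).2 => //; apply: le_trans tk _.
  by rewrite /Tk lerD2l ler_wpM2r ?(ltW tau0) // ler_nat.
pose kt (t : R) := (Num.truncn (t / tau)).+1.
have ktP (t : R) : 0 <= t -> t <= Tk (kt t).
  move=> t0; have := truncn_itv (divr_ge0 t0 (ltW tau0)) => /andP[_].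
  by rewrite ltr_pdivrMr // => /ltW h; apply: le_trans h _; rewrite /Tk /kt lerDr.
pose y t := X (kt t) t.
have yE k (t : R) : 0 <= t -> t <= Tk k -> y t = X k t.
  move=> t0 tk; rewrite /y; case: (leqP (kt t) k) => [h|/ltnW h].
    by rewrite (@XE (kt t) k) // ktP.
  by rewrite (@XE k (kt t)).
exists y; split; last by move=> t t0 tT; rewrite (yE 0%N) // /Tk mul0r addr0.
apply/solutionP => b _ t t0 tb.
have : sol_on K F 0 (Tk (kt t)) y.
  by apply: sol_on_eq (XP (kt t)).1 => u u0 uk; rewrite (yE (kt t)).
by apply => //; exact: ktP.
Qed.

(** A closed set that traps every solution from p, with bounded field and a uniform lifetime,
    excludes blocking in finite time: a solution on [[0, T[] has a limit at T, the limit is again in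
    the set, and the continuation starts there. *)
Lemma region_intro (R : realType) (m : nat) (K Good : set 'cV[R]_m) (F : 'cV[R]_m -> 'cV[R]_m)
    (tau M : R) (p : 'cV[R]_m) : 0 < tau -> closed Good -> Good `<=` K -> Good p ->
  (forall (b : R) x, 0 <= b -> sol_on K F 0 b x -> x 0 = p ->
     forall t, 0 <= t -> t <= b -> Good (x t)) ->
  (forall s, Good s -> `|F s| <= M) ->
  (forall s (T : R), Good s -> exists y, y T = s /\ sol_on K F T (T + tau) y) ->
  (forall x, solution K F +oo%E x -> x 0 = p -> x t @[t --> +oo%R] --> (0 : 'cV[R]_m)) ->
  region_of_attraction K F p.
Proof.
move=> tau0 cG GK Gp trap bF loc conv.
have ext (T : R) x : 0 <= T -> sol_on K F 0 T x -> x 0 = p ->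
     exists y, sol_on K F 0 (T + tau) y /\ forall t, 0 <= t -> t <= T -> y t = x t.
  move=> T0 sx xp; have GT := trap T x T0 sx xp T T0 (lexx T).
  have [y [yT sy]] := loc _ T GT.
  exists (fun t => if t <= T then x t else y t); split; last by move=> t _ ->.
  exact: sol_on_concat.
have s0 : exists2 x, sol_on K F 0 tau x & x 0 = p.
  by have [y [y0 sy]] := loc p 0 Gp; exists y => //; rewrite add0r in sy.
split=> //.
- have [x sx xp] := s0; have [y [sy yx]] := sol_on_extend tau0 ext (ltW tau0) sx xp.
  by exists y; split => //; rewrite yx // ltW.
- move=> [T||] x //; last by move=> _ sx xp; exists x; split.
  rewrite lte_fin => T0 /solutionP sx xp.
  have sxt (t : R) : t < T -> sol_on K F 0 t x by move=> tT; apply: sx; rewrite lte_fin.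
  have Gx (t : R) : 0 <= t -> t < T -> Good (x t).
    by move=> t0 tT; apply: (trap t x t0 (sxt t tT) xp).
  have [q [q1 q2]] := @sol_on_close R m K F 0 T M x T0 sxt (fun t t0 tT => bF _ (Gx t t0 tT)).
  have M0 : 0 <= M := le_trans (normr_ge0 _) (bF _ Gp).
  have Gq : Good q.
    apply: cG => A /nbhs_ballP[e /= e0 He].
    pose d := Num.min (T / 2) (e / (M + 1) / 2).
    have M10 : 0 < M + 1 by rewrite ltr_wpDl.
    have d0 : 0 < d by rewrite lt_min !divr_gt0.
    have dT : d < T by rewrite gt_min; apply/orP; left; rewrite ltr_pdivrMr // mulr_natr mulr2n ltrDl.
    exists (x (T - d)); split; first by apply: Gx; rewrite ?subr_ge0 ?ltW // gtrBl.
    apply: He; rewrite -ball_normE /= distrC.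
    have := q1 (T - d); rewrite subr_ge0 (ltW dT) gtrBl d0 => /(_ isT isT).
    rewrite [T - (T - d)](_ : _ = d); last by ring.
    move=> /le_lt_trans; apply.
    apply: (@le_lt_trans _ _ ((M + 1) * d)); first by rewrite ler_wpM2r ?(ltW d0) // lerDl.
    rewrite mulrC -ltr_pdivlMr //; apply: (@le_lt_trans _ _ (e / (M + 1) / 2)); first by rewrite ge_min lexx orbT.
    by rewrite ltr_pdivrMr // mulr_natr mulr2n ltrDl divr_gt0.
  have sz := q2 (GK _ Gq).
  have [y [sy yE]] := sol_on_extend tau0 ext (ltW T0) sz ltac:(by rewrite /= T0).
  exists y; split=> // t t0; rewrite lte_fin => tT.
  by rewrite yE // ?tT // ltW.
Qed.

(** * Iterated differentiability and the observability map *)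

(** Graded form of [smooth]: induction on k treats products and compositions, whose derivatives are
    sums of terms of the same kind with one order less. *)
Fixpoint ck (R : realType) (V W : normedModType R) (k : nat) (f : V -> W) : Prop :=
  (forall x, differentiable f x) /\ if k is j.+1 then forall v, ck j ('D_v f) else True.

Lemma ck_diff (R : realType) (V W : normedModType R) (k : nat) (f : V -> W) (x : V) :
  ck k f -> differentiable f x.
Proof. by case: k => [|k] []. Qed.

Lemma ckS (R : realType) (V W : normedModType R) (k : nat) (f : V -> W) : ck k.+1 f -> ck k f.
Proof.
elim: k f => [|k IH] f [df H]; first by split.
by split => // v; apply: IH; exact: H.
Qed.

Lemma ck_derive (R : realType) (V W : normedModType R) (k : nat) (f : V -> W) (v : V) :
  ck k.+1 f -> ck k ('D_v f).
Proof. by case=> _ H; exact: H. Qed.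

Lemma smooth_ck (R : realType) (V W : normedModType R) (k : nat) (f : V -> W) :
  smooth f -> ck k f.
Proof.
elim: k f => [|k IH] f sf; first by split=> // x; exact: (sf [::] x I).
split=> [x|v]; first exact: (sf [::] x I).
by apply: IH => vs x _; rewrite -foldr_rcons; exact: sf.
Qed.

Lemma ck_cst (R : realType) (V W : normedModType R) (k : nat) (c : W) : ck k (fun _ : V => c).
Proof.
elim: k c => [|k IH] c; split => // v.
by rewrite (_ : 'D_v _ = fun=> 0) //; apply/funext => x; rewrite derive_cst.
Qed.

Lemma ckD (R : realType) (V W : normedModType R) (k : nat) (f g : V -> W) :
  ck k f -> ck k g -> ck k (fun x => f x + g x).
Proof.
elim: k f g => [|k IH] f g [df Hf] [dg Hg]; split => //; try by move=> x; exact: differentiableD.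
move=> v.
rewrite (_ : 'D_v _ = fun x => 'D_v f x + 'D_v g x).
  by apply: IH; [exact: Hf | exact: Hg].
by apply/funext => x; rewrite -deriveD //; exact: diff_derivable.
Qed.

Lemma ckM (R : realType) (V : normedModType R) (k : nat) (f g : V -> R) :
  ck k f -> ck k g -> ck k (fun x => f x * g x).
Proof.
elim: k f g => [|k IH] f g Hf Hg.
  by split => // x; apply: differentiableM; [exact: ck_diff Hf|exact: ck_diff Hg].
split => [x|v]; first by apply: differentiableM; [exact: ck_diff Hf|exact: ck_diff Hg].
rewrite (_ : 'D_v _ = fun x => f x * 'D_v g x + g x * 'D_v f x).
  by apply: ckD; apply: IH; [exact: ckS|exact: (ck_derive v Hg)|exact: ckS|exact: (ck_derive v Hf)].
apply/funext => x; rewrite (_ : (fun x => f x * g x) = f * g) // deriveM //.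
  by apply: diff_derivable; exact: ck_diff Hf.
by apply: diff_derivable; exact: ck_diff Hg.
Qed.

Lemma ck_sum (R : realType) (V W : normedModType R) (k : nat) (I : Type) (r : seq I) (f : I -> V -> W) :
  (forall i, ck k (f i)) -> ck k (fun x => \sum_(i <- r) f i x).
Proof.
move=> Hf; elim: r => [|i r IH].
  rewrite (_ : (fun x => _) = fun=> 0); first exact: ck_cst.
  by apply/funext => x; rewrite big_nil.
rewrite (_ : (fun x => _) = fun x => f i x + \sum_(j <- r) f j x); first exact: ckD.
by apply/funext => x; rewrite big_cons.
Qed.

(** A directional derivative sees only the restriction to a line, so it can be moved between spaces
    by comparing two lines, without any differentiability. *)
Lemma derive_line (R : realType) (V V' W : normedModType R) (g : V -> W) (g' : V' -> W)
    (x v : V) (x' v' : V') :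
  (forall t : R, g (t *: v + x) = g' (t *: v' + x')) -> 'D_v g x = 'D_v' g' x'.
Proof.
move=> H; rewrite /derive.
have H0 : g x = g' x' by have := H 0; rewrite !scale0r !add0r.
have -> // : (fun h : R => h^-1 *: ((g \o shift x) (h *: v) - g x)) =
  (fun h => h^-1 *: ((g' \o shift x') (h *: v') - g' x')).
by apply/funext => t /=; rewrite H H0.
Qed.

Lemma ck_linear_comp (R : realType) (V V' W : normedModType R) (k : nat) (f : V' -> W) (A : V -> V') :
  (forall (t : R) u v, A (t *: u + v) = t *: A u + A v) -> (forall x, differentiable A x) ->
  ck k f -> ck k (fun x => f (A x)).
Proof.
move=> lA dA; elim: k f => [|k IH] f Hf.
  by split => // x; apply: (@differentiable_comp _ _ _ _ A f) => //; exact: ck_diff Hf.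
split => [x|v].
  by apply: (@differentiable_comp _ _ _ _ A f) => //; exact: ck_diff Hf.
rewrite (_ : 'D_v _ = fun x => 'D_(A v) f (A x)).
  by apply: (IH ('D_(A v) f)); exact: (ck_derive (A v) Hf).
by apply/funext => x; apply: derive_line => t; rewrite lA.
Qed.

Lemma ck_coord (R : realType) (V : normedModType R) (k m : nat) (f : V -> 'cV[R]_m) (i : 'I_m) :
  ck k f -> ck k (fun x => f x i 0).
Proof.
have dc (g : V -> 'cV[R]_m) x : differentiable g x -> differentiable (fun x => g x i 0) x.
  move=> dg; apply: (@differentiable_comp _ _ _ _ g (fun y : 'cV[R]_m => y i 0)) => //.
  exact: differentiable_coord.
elim: k f => [|k IH] f [df Hf]; split => //; try by move=> x; exact: dc.
move=> v.
rewrite (_ : 'D_v _ = fun x => 'D_v f x i 0).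
  by apply: (IH ('D_v f)); exact: Hf.
apply/funext => x; rewrite derive_mx ?mxE //.
exact: diff_derivable.
Qed.

Lemma differentiable_cV (R : realType) (V : normedModType R) (m : nat) (f : V -> 'cV[R]_m) (x : V) :
  (forall i, differentiable (fun x => f x i 0) x) -> differentiable f x.
Proof.
move=> df; rewrite (_ : f = \sum_(i < m) (fun x => f x i 0 *: (delta_mx i 0 : 'cV[R]_m))).
  apply: differentiable_sum => i; exact: differentiableZl.
apply/funext => y; rewrite [LHS]cV_sum_delta.
by elim/big_rec2: _ => // i a b _ ->.
Qed.

Lemma derive_comp_cV (R : realType) (V : normedModType R) (m : nat) (f : 'cV[R]_m -> R)
    (g : V -> 'cV[R]_m) (x v : V) : differentiable f (g x) -> (forall i, differentiable (fun x => g x i 0) x) ->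
  'D_v (fun x => f (g x)) x = \sum_i 'D_(delta_mx i 0) f (g x) * 'D_v (fun x => g x i 0) x.
Proof.
move=> df dg; have dg' : differentiable g x by exact: differentiable_cV.
rewrite deriveE; last by apply: (@differentiable_comp _ _ _ _ g f).
rewrite (@diff_comp _ _ _ _ g f) //= diff_cV; apply: eq_bigr => i _.
rewrite -deriveE //; congr (_ * _); rewrite -deriveE // derive_mx ?mxE //.
exact: diff_derivable.
Qed.

Lemma ck_comp (R : realType) (V : normedModType R) (k m : nat) (f : 'cV[R]_m -> R)
    (g : V -> 'cV[R]_m) : ck k f -> (forall i, ck k (fun x => g x i 0)) -> ck k (fun x => f (g x)).
Proof.
elim: k f => [|k IH] f Hf Hg.
  split => // x; apply: (@differentiable_comp _ _ _ _ g f); last exact: ck_diff Hf.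
  by apply: differentiable_cV => i; exact: ck_diff (Hg i).
split => [x|v].
  apply: (@differentiable_comp _ _ _ _ g f); last exact: ck_diff Hf.
  by apply: differentiable_cV => i; exact: ck_diff (Hg i).
rewrite (_ : 'D_v _ = fun x => \sum_i 'D_(delta_mx i 0) f (g x) * 'D_v (fun x => g x i 0) x).
  apply: ck_sum => i; apply: ckM; last exact: (ck_derive v (Hg i)).
  by apply: (IH ('D_(delta_mx i 0) f)); [exact: (ck_derive (delta_mx i 0) Hf)|move=> j; exact: ckS].
apply/funext => x; apply: derive_comp_cV; first exact: ck_diff Hf.
by move=> i; exact: ck_diff (Hg i).
Qed.

Lemma derive_coord (R : realType) (m : nat) (i : 'I_m) (x v : 'cV[R]_m) :
  'D_v (fun x : 'cV[R]_m => x i 0) x = v i 0.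
Proof.
rewrite deriveE; last exact: differentiable_coord.
have L : linear (fun x : 'cV[R]_m => x i 0 : R) by move=> t u w; rewrite !mxE.
pose A : {linear 'cV[R]_m -> R} := HB.pack (fun x : 'cV[R]_m => x i 0 : R) (GRing.isLinear.Build _ _ _ _ _ L).
transitivity ('d (A : 'cV[R]_m -> R) x v) => //; rewrite diff_lin //.
by move=> y; exact: coord_continuous.
Qed.

Lemma ck_coordE (R : realType) (k m : nat) (i : 'I_m) : ck k (fun x : 'cV[R]_m => x i 0).
Proof.
case: k => [|k]; split => //; try by move=> x; exact: differentiable_coord.
move=> v; rewrite (_ : 'D_v _ = fun=> v i 0); first exact: ck_cst.
by apply/funext => x; exact: derive_coord.
Qed.

Lemma ck_C1 (R : realType) (V W : normedModType R) (f : V -> W) : ck 1 f -> C1_on setT f.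
Proof.
move=> [df Hf] x _; split => // v; apply: differentiable_continuous.
exact: (@ck_diff _ _ _ 0 _ x (Hf v)).
Qed.

Lemma chain_lt (R : realType) (nu : nat) (z : 'cV[R]_nu) (v : R) (k : nat) (hk : (k < nu)%N) :
  chain z v k = z (Ordinal hk) 0.
Proof. by rewrite /chain insubT. Qed.

Lemma chain_ge (R : realType) (nu : nat) (z : 'cV[R]_nu) (v : R) (k : nat) : (nu <= k)%N ->
  chain z v k = v.
Proof. by move=> hk; rewrite /chain insubF // ltnNge hk. Qed.

Lemma obs_ext (R : realType) (n : nat) (f : 'cV[R]_n -> R -> 'cV[R]_n) (h : 'cV[R]_n -> R -> R)
    (i : nat) (x : 'cV[R]_n) (w w' : nat -> R) :
  (forall k, (k <= i)%N -> w k = w' k) -> obs_coord f h i x w = obs_coord f h i x w'.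
Proof.
elim: i x w w' => [|j IH] x w w' H /=; first by rewrite H.
rewrite H //; congr (_ + _).
  rewrite (_ : (fun x' => _) = fun x' => obs_coord f h j x' w') //.
  by apply/funext => x'; apply: IH => k kj; exact/H/leqW.
apply: eq_bigr => k _.
rewrite (_ : (fun s => _) = fun s => obs_coord f h j x (fun l => if l == k then s else w' l)).
  by rewrite !H // leqW // -ltnS.
by apply/funext => s; apply: IH => l lj; case: ifP => // _; exact/H/leqW.
Qed.

Lemma differentiable_usubmx (R : realType) (n m : nat) (p : 'cV[R]_(n + m)) :
  differentiable (fun q : 'cV[R]_(n + m) => usubmx q) p.
Proof.
apply: differentiable_cV => i; rewrite (_ : (fun x => _) = fun x : 'cV[R]_(n + m) => x (lshift m i) 0).
  exact: differentiable_coord.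
by apply/funext => q; rewrite mxE.
Qed.

Lemma differentiable_dsubmx (R : realType) (n m : nat) (p : 'cV[R]_(n + m)) :
  differentiable (fun q : 'cV[R]_(n + m) => dsubmx q) p.
Proof.
apply: differentiable_cV => i; rewrite (_ : (fun x => _) = fun x : 'cV[R]_(n + m) => x (rshift n i) 0).
  exact: differentiable_coord.
by apply/funext => q; rewrite mxE.
Qed.

Lemma ck_pair_col (R : realType) (W : normedModType R) (n k : nat) (g : 'cV[R]_n -> R -> W) :
  smooth (fun p : ('cV[R]_n * R)%type => g p.1 p.2) ->
  ck k (fun q : 'cV[R]_(n + 1) => g (usubmx q) (q (rshift n ord0) 0)).
Proof.
move=> /(@smooth_ck _ _ _ k) H.
apply: (@ck_linear_comp _ _ _ _ k (fun p : ('cV[R]_n * R)%type => g p.1 p.2)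
  (fun q : 'cV[R]_(n + 1) => (usubmx q, q (rshift n ord0) 0))) => //.
  move=> t u v; congr pair; last by rewrite !mxE.
  by apply/colP => i; rewrite !mxE.
move=> q; apply: differentiable_pair; first exact: differentiable_usubmx.
exact: differentiable_coord.
Qed.

Lemma ck_pair_comp (R : realType) (V : normedModType R) (n k : nat) (g : 'cV[R]_n -> R -> R)
    (X : V -> 'cV[R]_n) (u : V -> R) :
  smooth (fun p : ('cV[R]_n * R)%type => g p.1 p.2) ->
  (forall i, ck k (fun s => X s i 0)) -> ck k u -> ck k (fun s => g (X s) (u s)).
Proof.
move=> sg HX Hu.
rewrite (_ : (fun s => _) = fun s => (fun q : 'cV[R]_(n + 1) => g (usubmx q) (q (rshift n ord0) 0))
   (col_mx (X s) (const_mx (u s)))); last first.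
  by apply/funext => s /=; rewrite col_mxKu col_mxEd mxE.
apply: (@ck_comp _ _ _ _ (fun q : 'cV[R]_(n + 1) => g (usubmx q) (q (rshift n ord0) 0))
  (fun s => col_mx (X s) (const_mx (u s)))); first exact: ck_pair_col.
move=> i; case: (split_ordP i) => j ->.
  rewrite (_ : (fun s => _) = fun s => X s j 0) //; apply/funext => s; exact: col_mxEu.
by rewrite (_ : (fun s => _) = u) //; apply/funext => s; rewrite col_mxEd mxE.
Qed.

Lemma smooth_coord (R : realType) (V : normedModType R) (m : nat) (f : V -> 'cV[R]_m) (i : 'I_m) :
  smooth f -> smooth (fun x => f x i 0).
Proof.
move=> sf vs x _; have := ck_diff x (ck_coord i (smooth_ck 0 sf)) => _.
suff -> : foldr (fun v g => 'D_v g) (fun x => f x i 0) vs = (fun x => foldr (fun v g => 'D_v g) f vs x i 0).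
  apply: (@differentiable_comp _ _ _ _ _ (fun y : 'cV[R]_m => y i 0)); first exact: sf.
  exact: differentiable_coord.
elim: vs => [//|v vs IH] /=; rewrite IH; apply/funext => y.
by rewrite derive_mx ?mxE //; apply: diff_derivable; exact: sf.
Qed.

Lemma ck_chain (R : realType) (V : normedModType R) (nu k l : nat) (Z : V -> 'cV[R]_nu) (u : V -> R) :
  (forall i, ck k (fun s => Z s i 0)) -> ck k u -> ck k (fun s => chain (Z s) (u s) l).
Proof.
move=> HZ Hu; have [hl|hl] := ltnP l nu.
  rewrite (_ : (fun s => _) = fun s => Z s (Ordinal hl) 0) //.
  by apply/funext => s; exact: chain_lt.
by rewrite (_ : (fun s => _) = u) //; apply/funext => s; exact: chain_ge.
Qed.

Lemma derive_col0 (R : realType) (W : normedModType R) (n m : nat) (g : 'cV[R]_(n + m) -> W)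
    (p : 'cV[R]_(n + m)) (v : 'cV[R]_n) :
  'D_v (fun x => g (col_mx x (dsubmx p))) (usubmx p) = 'D_(col_mx v 0) g p.
Proof.
apply: derive_line => t; congr g; rewrite -[p in RHS]vsubmxK scale_col_mx add_col_mx.
by rewrite scaler0 add0r.
Qed.

Lemma derive_0col (R : realType) (W : normedModType R) (n m : nat) (g : 'cV[R]_(n + m) -> W)
    (p : 'cV[R]_(n + m)) (v : 'cV[R]_m) :
  'D_v (fun z => g (col_mx (usubmx p) z)) (dsubmx p) = 'D_(col_mx 0 v) g p.
Proof.
apply: derive_line => t; congr g; rewrite -[p in RHS]vsubmxK scale_col_mx add_col_mx.
by rewrite scaler0 add0r.
Qed.

Lemma derive_cV (R : realType) (m : nat) (g : 'cV[R]_m -> R) (x v : 'cV[R]_m) :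
  differentiable g x -> 'D_v g x = \sum_i 'D_(delta_mx i 0) g x * v i 0.
Proof.
by move=> dg; rewrite deriveE // diff_cV; apply: eq_bigr => i _; rewrite deriveE.
Qed.

Lemma delta_col_u (R : realType) (n m : nat) (i : 'I_n) :
  delta_mx (lshift m i) 0 = col_mx (delta_mx i 0) 0 :> 'cV[R]_(n + m).
Proof.
apply/colP => j; case: (split_ordP j) => l ->; rewrite !(col_mxEu, col_mxEd, mxE) !eqxx !andbT.
  by rewrite eq_lshift.
by rewrite eq_rlshift.
Qed.

Lemma delta_col_d (R : realType) (n m : nat) (i : 'I_m) :
  delta_mx (rshift n i) 0 = col_mx 0 (delta_mx i 0) :> 'cV[R]_(n + m).
Proof.
apply/colP => j; case: (split_ordP j) => l ->; rewrite !(col_mxEu, col_mxEd, mxE) !eqxx !andbT.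
  by rewrite eq_lrshift.
by rewrite eq_rshift.
Qed.

(** Each step of the recursion differentiates once, hence an induction on i for all k at a time. The
    sequence w is cut to N > i entries, so that derivatives in the inputs become directional
    derivatives on a space of columns; the default 0 of [chain] is never reached. *)
Lemma obs_ck (R : realType) (n : nat) (f : 'cV[R]_n -> R -> 'cV[R]_n) (h : 'cV[R]_n -> R -> R)
    (N i k : nat) :
  smooth (fun p : ('cV[R]_n * R)%type => f p.1 p.2) ->
  smooth (fun p : ('cV[R]_n * R)%type => h p.1 p.2) -> (i < N)%N ->
  ck k (fun p : 'cV[R]_(n + N) => obs_coord f h i (usubmx p) (chain (dsubmx p) 0)).
Proof.
move=> sf sh; elim: i k => [|j IH] k iN.
  apply: (ck_pair_comp (g := h)) => //.
    move=> i; rewrite (_ : (fun s => _) = fun s : 'cV[R]_(n + N) => s (lshift N i) 0).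
      exact: ck_coordE.
    by apply/funext => s; rewrite mxE.
  apply: ck_chain; last exact: ck_cst.
  move=> i; rewrite (_ : (fun s => _) = fun s : 'cV[R]_(n + N) => s (rshift n i) 0).
    exact: ck_coordE.
  by apply/funext => s; rewrite mxE.
have jN : (j < N)%N by exact: ltnW.
set Phi := fun p : 'cV[R]_(n + N) => obs_coord f h j (usubmx p) (chain (dsubmx p) 0) in IH.
have dPhi p : differentiable Phi p by exact: ck_diff (IH 0%N jN).
have ckZ l : ck k (fun p : 'cV[R]_(n + N) => chain (dsubmx p) 0 l).
  apply: ck_chain; last exact: ck_cst.
  move=> i; rewrite (_ : (fun s => _) = fun s : 'cV[R]_(n + N) => s (rshift n i) 0).
    exact: ck_coordE.
  by apply/funext => s; rewrite mxE.
have lN (l : 'I_j.+1) : (l < N)%N by exact: leq_trans (ltn_ord l) jN.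
rewrite (_ : (fun p => _) = fun p : 'cV[R]_(n + N) =>
   \sum_(l < n) 'D_(delta_mx (lshift N l) 0) Phi p * f (usubmx p) (chain (dsubmx p) 0 0) l 0
 + \sum_(l < j.+1) 'D_(delta_mx (rshift n (Ordinal (lN l))) 0) Phi p * chain (dsubmx p) 0 l.+1).
  apply: ckD; apply: ck_sum => l; apply: ckM => //.
  - by have [_ H] := IH k.+1 jN; exact: H.
  - apply: (ck_pair_comp (g := fun x u => f x u l 0)) => //; first exact: smooth_coord l sf.
    move=> i; rewrite (_ : (fun s => _) = fun s : 'cV[R]_(n + N) => s (lshift N i) 0).
      exact: ck_coordE.
    by apply/funext => s; rewrite mxE.
  - by have [_ H] := IH k.+1 jN; exact: H.
apply/funext => p /=; congr (_ + _).
  set v := f _ _; transitivity ('D_(col_mx v 0) Phi p).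
    rewrite -derive_col0 (_ : (fun x => Phi _) = fun x => obs_coord f h j x (chain (dsubmx p) 0)) //.
    by apply/funext => x; rewrite /Phi col_mxKu col_mxKd.
  rewrite derive_cV // big_split_ord /= [X in _ + X]big1 ?addr0; last first.
    by move=> l _; rewrite col_mxEd mxE mulr0.
  by apply: eq_bigr => l _; rewrite col_mxEu.
apply: eq_bigr => l _; congr (_ * _); rewrite derive1E.
apply: derive_line => t; rewrite /Phi.
have -> : usubmx (t *: delta_mx (rshift n (Ordinal (lN l))) 0 + p) = usubmx p.
  by rewrite delta_col_d -[p in LHS]vsubmxK scale_col_mx add_col_mx col_mxKu scaler0 add0r.
have -> : dsubmx (t *: delta_mx (rshift n (Ordinal (lN l))) 0 + p) =
    t *: delta_mx (Ordinal (lN l)) 0 + dsubmx p.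
  by rewrite delta_col_d -[p in LHS]vsubmxK scale_col_mx add_col_mx col_mxKd.
apply: obs_ext => q qj; have qN : (q < N)%N by exact: leq_ltn_trans qj jN.
rewrite !chain_lt !mxE eqxx andbT -val_eqE /=; case: eqP => [ql|_]; last by rewrite mulr0 add0r.
by congr (_ + p (rshift n _) 0); apply: val_inj.
Qed.

Lemma obs_comp_ck (R : realType) (V : normedModType R) (n nu i k : nat)
    (f : 'cV[R]_n -> R -> 'cV[R]_n) (h : 'cV[R]_n -> R -> R)
    (X : V -> 'cV[R]_n) (Z : V -> 'cV[R]_nu) (u : V -> R) :
  smooth (fun p : ('cV[R]_n * R)%type => f p.1 p.2) ->
  smooth (fun p : ('cV[R]_n * R)%type => h p.1 p.2) ->
  (forall i, ck k (fun s => X s i 0)) -> (forall i, ck k (fun s => Z s i 0)) -> ck k u ->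
  ck k (fun s => obs_coord f h i (X s) (chain (Z s) (u s))).
Proof.
move=> sf sh HX HZ Hu.
rewrite (_ : (fun s => _) = fun s =>
  (fun p : 'cV[R]_(n + i.+1) => obs_coord f h i (usubmx p) (chain (dsubmx p) 0))
  (col_mx (X s) (\col_(l < i.+1) chain (Z s) (u s) l))).
  apply: (@ck_comp _ _ _ _ (fun p : 'cV[R]_(n + i.+1) => obs_coord f h i (usubmx p) (chain (dsubmx p) 0))
    (fun s => col_mx (X s) (\col_(l < i.+1) chain (Z s) (u s) l))); first exact: obs_ck.
  move=> l; case: (split_ordP l) => j ->.
    rewrite (_ : (fun s => _) = fun s => X s j 0) //; apply/funext => s; exact: col_mxEu.
  rewrite (_ : (fun s => _) = fun s => chain (Z s) (u s) j); first exact: ck_chain.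
  by apply/funext => s; rewrite col_mxEd mxE.
apply/funext => s /=; rewrite col_mxKu col_mxKd; apply: obs_ext => l; rewrite -ltnS => li.
by rewrite [RHS]chain_lt mxE.
Qed.

Lemma big_ord_widen0 (R : realType) (T : nat -> R) (a M : nat) : (a <= M)%N ->
  (forall k, (a <= k)%N -> T k = 0) -> \sum_(k < M) T k = \sum_(k < a) T k.
Proof.
move=> aM T0; rewrite -!(big_mkord xpredT) (big_cat_nat (leq0n a) aM) /=.
rewrite [X in _ + X]big_nat_cond [X in _ + X]big1 ?addr0 // => k /andP[/andP[h _] _].
exact: T0.
Qed.

(** The recursion sums over k <= i, the chain rule over k < nu. Terms with k > i vanish because the
    i-th coordinate has no such input, terms with k >= nu by [depends_on_first], so both sums equal
    the one over the larger range. For i = n - 1 the result is no coordinate of H and may contain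
    v. *)
Lemma obs_derivative (R : realType) (n nu i : nat)
    (f : 'cV[R]_n -> R -> 'cV[R]_n) (h : 'cV[R]_n -> R -> R) (x : 'cV[R]_n) (z : 'cV[R]_nu) (v : R) :
  smooth (fun p : ('cV[R]_n * R)%type => f p.1 p.2) ->
  smooth (fun p : ('cV[R]_n * R)%type => h p.1 p.2) ->
  depends_on_first f h nu -> (i < n)%N ->
  'D_(col_mx (f x (chain z v 0)) (zdot z v))
     (fun q : 'cV[R]_(n + nu) => obs_coord f h i (usubmx q) (chain (dsubmx q) 0)) (col_mx x z) =
  obs_coord f h i.+1 x (chain z v).
Proof.
move=> sf sh dep i_n; set g := fun q => _; set q := col_mx x z; set w := chain z v.
have dg : differentiable g q.
  apply: ck_diff (_ : ck 0 g); apply: obs_comp_ck => //; try exact: ck_cst.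
  - move=> j; rewrite (_ : (fun s => _) = fun s : 'cV[R]_(n + nu) => s (lshift nu j) 0); first exact: ck_coordE.
    by apply/funext => s; rewrite mxE.
  - move=> j; rewrite (_ : (fun s => _) = fun s : 'cV[R]_(n + nu) => s (rshift n j) 0); first exact: ck_coordE.
    by apply/funext => s; rewrite mxE.
have depw y (w1 : nat -> R) : (forall l, (l < nu)%N -> w1 l = w l) -> obs_coord f h i y w1 = obs_coord f h i y w.
  by move=> H; exact: dep.
have wz l : (l < nu)%N -> chain z 0 l = w l by move=> lnu; rewrite /w !chain_lt.
rewrite -(addr0 (f x _)) -{1}(add0r (zdot z v)) -add_col_mx.
have -> : forall a c, 'D_(a + c) g q = 'D_a g q + 'D_c g q.
  by move=> a c; rewrite !deriveE // linearD.
rewrite /=; congr (_ + _).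
  rewrite -derive_col0 /q col_mxKu col_mxKd (_ : (fun y => g _) = fun y => obs_coord f h i y w) //.
  by apply/funext => y; rewrite /g col_mxKu col_mxKd; exact: depw.
pose T k := derive1 (fun s : R => obs_coord f h i x (fun l => if l == k then s else w l)) (w k) * w k.+1.
rewrite -[RHS]/(\sum_(k < i.+1) T k).
have T_i k : (i.+1 <= k)%N -> T k = 0.
  move=> ik; rewrite /T (_ : (fun s => _) = cst (obs_coord f h i x w)) ?derive1_cst ?mul0r //.
  apply/funext => s; apply: obs_ext => l li; case: eqP => // lk.
  by move: ik; rewrite -lk ltnNge li.
have T_nu k : (nu <= k)%N -> T k = 0.
  move=> nk; rewrite /T (_ : (fun s => _) = cst (obs_coord f h i x w)) ?derive1_cst ?mul0r //.
  apply/funext => s; apply: depw => l lnu; case: eqP => // lk.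
  by move: nk; rewrite -lk leqNgt lnu.
transitivity (\sum_(k < nu) T k); last first.
  rewrite -(@big_ord_widen0 R T nu (maxn nu i.+1)) ?leq_maxl //.
  by rewrite (@big_ord_widen0 R T i.+1 (maxn nu i.+1)) ?leq_maxr.
rewrite derive_cV // big_split_ord /= [X in X + _]big1 ?add0r; last first.
  by move=> l _; rewrite col_mxEu mxE mulr0.
apply: eq_bigr => k _; rewrite col_mxEd !mxE /T -/w; congr (_ * _).
rewrite derive1E; apply: derive_line => t.
rewrite /g delta_col_d /q scale_col_mx add_col_mx col_mxKu col_mxKd scaler0 add0r.
apply: dep => // l lnu; rewrite chain_lt !mxE eqxx andbT -val_eqE /=.
case: eqP => [lk|_]; last by rewrite mulr0 add0r /w chain_lt.
by rewrite /w (chain_lt _ _ (ltn_ord k)); congr (_ + z _ 0); apply: val_inj.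
Qed.

Lemma jac_mulE (R : realType) (m p : nat) (F : 'cV[R]_p -> 'cV[R]_m) (x v : 'cV[R]_p) (i : 'I_m) :
  differentiable (fun x' => F x' i 0) x -> (jac F x *m v) i 0 = 'D_v (fun x' => F x' i 0) x.
Proof.
by move=> dF; rewrite derive_cV // mxE; apply: eq_bigr => j _; rewrite mxE.
Qed.

Lemma grad_mulE (R : realType) (p : nat) (g : 'cV[R]_p -> R) (x v : 'cV[R]_p) :
  differentiable g x -> ((grad g x)^T *m v) 0 0 = 'D_v g x.
Proof.
by move=> dg; rewrite derive_cV // mxE; apply: eq_bigr => j _; rewrite !mxE.
Qed.

(** * Compactness and the constraint set *)

(** The finite subcover argument, made once: it turns local Lipschitz constants, bounds and
    lifetimes into uniform ones, P being inherited by smaller r. *)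
Lemma compact_unif (R : realType) (V : normedModType R) (A : set V) (P : R -> V -> Prop) :
  compact A -> (forall r r' x, 0 < r' -> r' <= r -> P r x -> P r' x) ->
  (forall x, A x -> exists2 d : R, 0 < d & forall x', A x' -> `|x' - x| < d -> P d x') ->
  exists2 r : R, 0 < r & forall x, A x -> P r x.
Proof.
move=> /compact_near_coveringP/near_covering_withinP cA mono loc.
have cover x : A x -> \forall x' \near x & r \near (0 : R)^'+, A x' -> P r x'.
  move=> Ax; have [d d0 Hd] := loc x Ax.
  exists (ball x d, [set r : R | 0 < r /\ r < d]).
    split; first exact: nbhsx_ballx.
    near=> r; split; first by near: r; exact: nbhs_right_gt.
    by near: r; exact: nbhs_right_lt.
  move=> [x' r] /= [bx [r0 rd]] Ax'; apply: (mono d) => //; first exact: ltW.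
  by apply: Hd => //; move: bx; rewrite -ball_normE /= distrC.
have H := cA R (0 : R)^'+ (fun r x => P r x) _ cover.
have /filter_ex[r [r0 Hr]] : \forall r \near (0 : R)^'+, 0 < r /\ A `<=` P r.
  by near=> r; split; [near: r; exact: nbhs_right_gt | near: r; exact: H].
by exists r.
Unshelve. all: by end_near. Qed.

Lemma dist_continuous (R : realType) (V W : normedModType R) (g : V -> W) :
  (forall x y, `|g x - g y| <= `|x - y|) -> continuous g.
Proof.
move=> H x; apply/cvgrPdist_lt => e e0; apply/nbhs_ballP; exists e => // y.
by rewrite -ball_normE /= => xy; exact: le_lt_trans xy.
Qed.

Lemma cV_compact (R : realType) (m : nat) (A : set 'cV[R]_m) (M : R) :
  closed A -> (forall x, A x -> `|x| <= M) -> compact A.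
Proof.
move=> cA bA.
have tr_le (p q : nat) (N : 'M[R]_(p, q)) : `|N^T| <= `|N|.
  rewrite /Num.Def.normr /= !mx_normrE; apply: bigmax_le => [|[i j] _] /=; first exact: bigmax_ge_id.
  by rewrite mxE; exact: (@le_bigmax _ _ _ 0 (fun k => `|N k.1 k.2|) (j, i)).
have cont_tr (p q : nat) : continuous (fun x : 'M[R]_(p, q) => x^T : 'M[R]_(q, p)).
  by apply: dist_continuous => x y; rewrite -linearB; exact: tr_le.
have -> : A = (fun x : 'rV[R]_m => x^T) @` [set x | A x^T].
  apply/seteqP; split=> [x Ax|x [y Ay <-//]]; by exists x^T; rewrite /= trmxK.
apply: continuous_compact; first by apply/continuous_subspaceT => x; exact: cont_tr.
apply: bounded_closed_compact.
  exists M; split; first exact: num_real.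
  move=> N MN x /= Ax; apply: le_trans (ltW MN); apply: le_trans (bA _ Ax).
  by rewrite -[x in `|x|]trmxK; exact: tr_le.
by apply: closed_comp => // x _; exact: cont_tr.
Qed.

Lemma rder_incr1 (R : realType) (q : R -> R) (a b v c : R) : a <= b ->
  (forall t, a < t -> t <= b -> lcont q t) ->
  (forall t, a <= t -> t < b -> exists2 w, rder q t w & `|w - v| <= c) ->
  `|q b - q a - (b - a) * v| <= c * (b - a).
Proof.
move=> ab lc rd; rewrite ler_norml.
have h1 : q b - q a <= (v + c) * (b - a).
  apply: rdle_le => // t at_ tb; have [w rw] := rd t at_ tb; rewrite ler_norml => /andP[? ?].
  by apply: rder_rdle rw _; lra.
have h2 : (- q b) - (- q a) <= (- v + c) * (b - a).
  apply: (@rdle_le R (fun t => - q t)) => // t at_ tb; first by apply: cvgN; exact: lc.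
  have [w rw] := rd t at_ tb; rewrite ler_norml => /andP[? ?].
  by apply: rder_rdle (rderN rw) _; lra.
by apply/andP; split; lra.
Qed.

(** Mean value inequality along the segment from q' to q, on which the partial derivatives stay
    close to those at p. Both points vary, as the comparison of [H x z] with [H x' z] demands. *)
Lemma strict_diff (R : realType) (m : nat) (g : 'cV[R]_m -> R) (p : 'cV[R]_m) (e : R) :
  C1_on setT g -> 0 < e -> exists2 d : R, 0 < d & forall q q', `|q - p| < d -> `|q' - p| < d ->
    `|g q - g q' - 'd g p (q - q')| <= e * `|q - q'|.
Proof.
move=> Cg e0; have dg x : differentiable g x by exact: (Cg x I).1.
pose eta := e / m.+1%:R.
have eta0 : 0 < eta by rewrite divr_gt0.
have Hi (i : 'I_m) : \forall x \near p, `|'D_(delta_mx i 0) g p - 'D_(delta_mx i 0) g x| <= eta.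
  by have := (Cg p I).2 (delta_mx i 0); move=> /cvgrPdist_le; apply.
have : \forall x \near p, forall i : 'I_m, `|'D_(delta_mx i 0) g p - 'D_(delta_mx i 0) g x| <= eta.
  by near=> x; near: x; exact: filter_forall Hi.
move=> /nbhs_ballP[d /= d0 Hd]; exists d => // q q' qp q'p.
pose c t := q' + t *: (q - q').
have cb t : 0 <= t -> t <= 1 -> `|c t - p| < d.
  move=> t0 t1; have -> : c t - p = (1 - t) *: (q' - p) + t *: (q - p).
    by apply/colP => i; rewrite !mxE; ring.
  apply: le_lt_trans (ler_normD _ _) _; rewrite !normrZ (ger0_norm t0) ger0_norm ?subr_ge0 //.
  have := ler_wpM2l t0 (ltW qp); have t1' : 0 <= 1 - t by rewrite subr_ge0.
  have := ler_wpM2l t1' (ltW q'p).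
  have [t00|tn0] := eqVneq t 0; first by rewrite t00 mul0r addr0 subr0 !mul1r.
  by have : 0 < t; [rewrite lt_def tn0|nra].
have rc t : rder c t (q - q').
  move=> h h0; exists 1 => // s s0 _.
  have -> : c (t + s) - c t - s *: (q - q') = 0 by apply/colP => i; rewrite !mxE; ring.
  by rewrite normr0 mulr_ge0 // ltW.
have cc t : {for t, continuous c}.
  apply: contD; first exact: continuous_cst_at.
  apply: contZ; [exact: cvg_id|exact: continuous_cst_at].
have := @rder_incr1 R (g \o c) 0 1 ('d g p (q - q')) (e * `|q - q'|) ler01.
rewrite subr0 mul1r mulr1 /= /c scale0r addr0 scale1r [q' + (q - q')]addrC subrK; apply.
  move=> t _ _; apply: continuous_lcont; apply: (@continuous_comp _ _ _ c g); first exact: cc.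
  exact: differentiable_continuous.
move=> t t0 t1; exists ('D_(q - q') g (c t)); first exact: rder_comp (rc t) (dg _).
rewrite derive_cV // -deriveE // derive_cV // -sumrB.
apply: le_trans (ler_norm_sum _ _ _) _.
apply: (@le_trans _ _ (\sum_(i < m) eta * `|q - q'|)).
  apply: ler_sum => i _; rewrite -mulrBl normrM; apply: ler_pM => //; last exact: cV_coord_le.
  by rewrite distrC; apply: Hd; rewrite -ball_normE /= distrC; apply: cb => //; exact: ltW.
rewrite sumr_const card_ord -mulr_natl mulrA ler_wpM2r //.
rewrite /eta mulrCA ler_piMr ?(ltW e0) // ler_pdivrMr // mul1r ler_nat //.
Unshelve. all: by end_near. Qed.

Lemma C1_locally_lipschitz (R : realType) (m : nat) (g : 'cV[R]_m -> R) (p : 'cV[R]_m) :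
  C1_on setT g -> exists2 d : R, 0 < d & forall q q', `|q - p| < d -> `|q' - p| < d ->
    d * `|g q - g q'| <= `|q - q'|.
Proof.
move=> Cg; have [d d0 Hd] := strict_diff p Cg ltr01.
have [k k0 Hk] := linear_lipschitz (diff_continuous (Cg p I).1).
have k10 : 0 < k + 1 by rewrite addr_gt0.
exists (Num.min d (k + 1)^-1); first by rewrite lt_min d0 invr_gt0.
move=> q q'; rewrite !lt_min => /andP[qp _] /andP[q'p _].
have H : `|g q - g q'| <= (k + 1) * `|q - q'|.
  rewrite -[g q - g q'](subrK ('d g p (q - q'))); apply: le_trans (ler_normD _ _) _.
  by rewrite mulrDl addrC; apply: lerD; [exact: Hk|exact: Hd].
apply: (@le_trans _ _ ((k + 1)^-1 * `|g q - g q'|)); first by rewrite ler_wpM2r // ge_min lexx orbT.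
by rewrite ler_pdivrMl.
Qed.

(** On the compact square of A, pairs near the diagonal obey the local estimate; near any other pair
    the distance is bounded below and the difference of values is bounded. *)
Lemma lipschitz_on_compact (R : realType) (m : nat) (g : 'cV[R]_m -> R) (A : set 'cV[R]_m) :
  C1_on setT g -> compact A -> exists2 L : R, 0 < L & forall q q', A q -> A q' ->
    `|g q - g q'| <= L * `|q - q'|.
Proof.
move=> Cg cA; have cAA := compact_setX cA cA.
have dg x : differentiable g x by exact: (Cg x I).1.
have near1 p : exists2 d : R, 0 < d & forall q, `|q - p| < d -> `|g q - g p| <= 1.
  have /cvgrPdist_le /(_ 1 ltr01) /nbhs_ballP[d /= d0 Hd] := differentiable_continuous (dg p).
  by exists d => // q; rewrite distrC => qp; rewrite distrC; apply: Hd; rewrite -ball_normE.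
have loc (x : ('cV[R]_m * 'cV[R]_m)%type) : (A `*` A) x -> exists2 d : R, 0 < d &
    forall x', (A `*` A) x' -> `|x' - x| < d -> d * `|g x'.1 - g x'.2| <= `|x'.1 - x'.2|.
  case: x => p p' [/= Ap Ap'].
  have near_pair (d : R) (x : ('cV[R]_m * 'cV[R]_m)%type) : `|x - (p, p')| < d -> `|x.1 - p| < d /\ `|x.2 - p'| < d.
    by rewrite prod_normE /= gt_max => /andP[].
  have [pp|npp] := eqVneq p p'.
    have [d d0 Hd] := C1_locally_lipschitz p Cg; exists d => // x _ /near_pair[h1 h2].
    by apply: Hd => //; rewrite pp.
  have [d1 d10 H1] := near1 p; have [d2 d20 H2] := near1 p'.
  have D0 : 0 < `|p - p'| by rewrite normr_gt0 subr_eq0.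
  pose G := `|g p - g p'| + 2; have G0 : 0 < G by rewrite ltr_wpDl.
  pose d := Num.min (Num.min d1 d2) (Num.min (`|p - p'| / 4) (`|p - p'| / (2 * G))).
  have d0 : 0 < d by rewrite !lt_min d10 d20 !divr_gt0 // mulr_gt0.
  have [dd1 dd2 dd3 dd4] : [/\ d <= d1, d <= d2, d <= `|p - p'| / 4 & d <= `|p - p'| / (2 * G)].
    by rewrite /d; split; rewrite !ge_min lexx ?orbT.
  exists d => // x _ /near_pair[h1 h2].
  have h3 := lt_le_trans h1 dd3; have h4 := lt_le_trans h2 dd3.
  have e1 : `|g x.1 - g x.2| <= G.
    have -> : g x.1 - g x.2 = (g x.1 - g p) - (g x.2 - g p') + (g p - g p') by ring.
    apply: le_trans (ler_normD _ _) _; rewrite /G addrC lerD2l.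
    by apply: le_trans (ler_normB _ _) _; apply: lerD; [apply: H1; exact: lt_le_trans dd1|apply: H2; exact: lt_le_trans dd2].
  have e2 : `|p - p'| / 2 <= `|x.1 - x.2|.
    have : `|p - p'| <= `|x.1 - p| + `|x.1 - x.2| + `|x.2 - p'|.
      have -> : p - p' = - (x.1 - p) + (x.1 - x.2) + (x.2 - p') by apply/colP => i; rewrite !mxE; ring.
      apply: le_trans (ler_normD _ _) _; rewrite lerD2r.
      by apply: le_trans (ler_normD _ _) _; rewrite normrN.
    lra.
  apply: le_trans e2; apply: le_trans (ler_wpM2l (ltW d0) e1) _.
  apply: (@le_trans _ _ (`|p - p'| / (2 * G) * G)).
    by rewrite ler_pM2r.
  by rewrite invfM mulrA divfK // gt_eqF.
have [r r0 Hr] := @compact_unif R ('cV[R]_m * 'cV[R]_m)%type _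
  (fun r x => r * `|g x.1 - g x.2| <= `|x.1 - x.2|) cAA
  (fun r r' x r'0 r'r h => le_trans (ler_wpM2r (normr_ge0 _) r'r) h) loc.
exists r^-1; first by rewrite invr_gt0.
by move=> q q' Aq Aq'; rewrite ler_pdivlMl //; exact: (Hr (q, q')).
Qed.

(** Compactness of each [C z] says nothing uniform in z. For z near z0, b is positive on a sphere
    that encloses [C z0], while [c z] stays inside it; by convexity a point of [C z] outside would
    produce a point of [C z] on the sphere. *)
Lemma convex_level_bounded (R : realType) (n nu : nat) (Oz : set 'cV[R]_nu)
    (C : 'cV[R]_nu -> set 'cV[R]_n) (b : 'cV[R]_n -> 'cV[R]_nu -> R) (c : 'cV[R]_nu -> 'cV[R]_n) :
  compact Oz -> continuous c ->
  continuous (fun p : ('cV[R]_n * 'cV[R]_nu)%type => b p.1 p.2) ->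
  (forall z, Oz z -> [/\ C z (c z), C z = [set xi | b xi z <= 0], @convex_set R 'cV[R]_n (C z)
     & compact (C z)]) ->
  exists2 M : R, 0 < M & forall z xi, Oz z -> C z xi -> `|xi| <= M.
Proof.
move=> cOz cc cb HC.
have loc z0 : Oz z0 -> exists2 d : R, 0 < d & forall z, Oz z -> `|z - z0| < d ->
    forall xi, C z xi -> d * `|xi| <= 1.
  move=> Oz0; have [Cc0 CE _ Cc] := HC z0 Oz0.
  have [M0 [_ HM0]] := compact_bounded Cc.
  pose M := Num.max (M0 + 1) 1.
  have M1 : 0 < M by rewrite lt_max ltr01 orbT.
  have CM xi : C z0 xi -> `|xi| <= M.
    by move=> h; apply: (HM0 M) => //; rewrite lt_max ltrDl ltr01.
  pose S := [set xi : 'cV[R]_n | `|xi| = M + 1].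
  have cS : compact S.
    apply: (@cV_compact _ _ _ (M + 1)) => [|x ->//].
    apply: (@closed_comp _ _ (fun x : 'cV[R]_n => `|x|) [set M + 1]); last exact: closed_eq.
    by move=> x _; exact: norm_continuous.
  have locS xi0 : S xi0 -> exists2 d : R, 0 < d & forall xi, S xi -> `|xi - xi0| < d ->
      forall z, `|z - z0| < d -> 0 < b xi z.
    move=> Sx; have b0 : 0 < b xi0 z0.
      rewrite ltNge; apply/negP => bx; have : C z0 xi0 by rewrite CE.
      by move=> /CM; rewrite Sx leNgt ltrDl ltr01.
    have /cvgrPdist_lt /(_ _ b0) /nbhs_ballP[d /= d0 Hd] := cb (xi0, z0).
    exists d => // xi _ hx z hz; have := Hd (xi, z); rewrite -ball_normE /= prod_normE /= gt_max.
    rewrite distrC hx distrC hz => /(_ isT); rewrite ltr_norml => /andP[_] /=; lra.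
  have [r r0 Hr] := compact_unif cS (fun r r' x r'0 r'r h z hz => h z (lt_le_trans hz r'r)) locS.
  have /cvgrPdist_lt /(_ 1 ltr01) /nbhs_ballP[d /= d0 Hd] := cc z0.
  pose e := Num.min (Num.min r d) (M + 1)^-1.
  have e0 : 0 < e by rewrite !lt_min r0 d0 invr_gt0 addr_gt0.
  exists e => // z Ozz ze xi Cxi.
  have zr : `|z - z0| < r by apply: lt_le_trans ze _; rewrite /e !ge_min lexx.
  have zd : `|z - z0| < d by apply: lt_le_trans ze _; rewrite /e !ge_min lexx orbT.
  suff xM : `|xi| <= M + 1.
    apply: (@le_trans _ _ ((M + 1)^-1 * (M + 1))); last by rewrite mulVf // gt_eqF // addr_gt0.
    by apply: ler_pM => //; [exact: ltW|rewrite ge_min lexx orbT].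
  rewrite leNgt; apply/negP => xM.
  have [Ccz CEz convz _] := HC z Ozz.
  have cM : `|c z| <= M + 1.
    rewrite -[c z](subrK (c z0)); apply: le_trans (ler_normD _ _) _; rewrite addrC; apply: lerD; first exact: CM.
    by rewrite distrC; apply: ltW; apply: Hd; rewrite -ball_normE /= distrC.
  pose seg (t : R) := c z + t *: (xi - c z).
  have cseg (t : R) : {for t, continuous seg}.
    apply: contD; first exact: continuous_cst_at.
    by apply: contZ; [exact: cvg_id|exact: continuous_cst_at].
  have [t] : exists2 t, t \in `[0, 1] & `|seg t| = M + 1.
    apply: (@IVT R (fun t => `|seg t|) 0 1 (M + 1)); first exact: ler01.
      apply: continuous_subspaceT => t.
      apply: (@continuous_comp _ _ _ seg (fun x : 'cV[R]_n => `|x|)); first exact: cseg.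
      exact: norm_continuous.
    rewrite /seg scale0r addr0 scale1r addrC subrK.
    by rewrite ge_min le_max cM (ltW xM) orbT.
  rewrite in_itv /= => /andP[t0 t1] St.
  have : C z (seg t).
    have := convz xi (c z) (Itv01 t0 t1); rewrite !inE => /(_ Cxi Ccz).
    suff -> : conv (Itv01 t0 t1) (xi : convex_lmodType 'cV[R]_n) (c z) = seg t by [].
    transitivity (t *: xi + (1 - t) *: c z); first by [].
    by apply/colP => i; rewrite !mxE; ring.
  by rewrite CEz /= leNgt (Hr (seg t) St z zr).
have [r r0 Hr] := compact_unif cOz (fun r r' z r'0 r'r h xi Cx => le_trans (ler_wpM2r (normr_ge0 xi) r'r) (h xi Cx)) loc.
exists r^-1; first by rewrite invr_gt0.
by move=> z xi Ozz Cx; rewrite -[leRHS]mulr1 ler_pdivlMl //; exact: Hr Cx.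
Qed.

Lemma mulmx_bound (R : realType) (m p : nat) (M : 'M[R]_(m, p)) :
  exists2 k : R, 0 < k & forall v : 'cV[R]_p, `|M *m v| <= k * `|v|.
Proof.
pose k : R := \sum_i \sum_j `|M i j| + 1.
have S0 : 0 <= \sum_i \sum_j `|M i j| by apply: sumr_ge0 => i _; exact: sumr_ge0.
have k0 : 0 < k by rewrite ltr_wpDl.
exists k => // v; apply/cV_norm_le => [|i]; first by rewrite mulr_ge0 // ltW.
rewrite mxE; apply: le_trans (ler_norm_sum _ _ _) _.
apply: (@le_trans _ _ ((\sum_j `|M i j|) * `|v|)).
  rewrite mulr_suml; apply: ler_sum => j _; rewrite normrM ler_wpM2l //; exact: cV_coord_le.
rewrite ler_wpM2r // /k (bigD1 i) //= -addrA lerDl addr_ge0 //.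
by apply: sumr_ge0 => l _; exact: sumr_ge0.
Qed.

Lemma cont_pair (T A B : topologicalType) (f : T -> A) (g : T -> B) (p : T) :
  {for p, continuous f} -> {for p, continuous g} -> {for p, continuous (fun x => (f x, g x))}.
Proof.
move=> cf cg N [[N1 N2] /= [h1 h2] sub].
have h3 : nbhs p (f @^-1` N1) by exact: cf.
have h4 : nbhs p (g @^-1` N2) by exact: cg.
suff : nbhs p ((fun x => (f x, g x)) @^-1` N) by [].
by apply: filterS (filterI h3 h4) => x [? ?]; exact: sub.
Qed.

Lemma cV_subE (R : realType) (m : nat) (u v : 'cV[R]_m) i : (u - v) i 0 = u i 0 - v i 0.
Proof. by rewrite !mxE. Qed.

Lemma strict_diff_cV (R : realType) (m p : nat) (g : 'cV[R]_m -> 'cV[R]_p) (x : 'cV[R]_m) (e : R) :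
  (forall i, C1_on setT (fun q => g q i 0)) -> 0 < e ->
  exists2 d : R, 0 < d & forall q q' i, `|q - x| < d -> `|q' - x| < d ->
    `|g q i 0 - g q' i 0 - 'd (fun q => g q i 0) x (q - q')| <= e * `|q - q'|.
Proof.
move=> Cg e0.
have [d Hd] := choice (fun i => let: ex_intro2 d h1 h2 := strict_diff x (Cg i) e0 in ex_intro _ d (conj h1 h2)).
exists (\big[Num.min/1]_i d i); first by apply: lt_bigmin => // i _; case: (Hd i).
move=> q q' i h1 h2; apply: (Hd i).2; [apply: lt_le_trans h1 _|apply: lt_le_trans h2 _]; exact: bigmin_le.
Qed.

Lemma usubmx_le (R : realType) (n m : nat) (s : 'cV[R]_(n + m)) : `|usubmx s| <= `|s|.
Proof. by apply/cV_norm_le => // i; rewrite mxE; exact: cV_coord_le. Qed.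

Lemma dsubmx_le (R : realType) (n m : nat) (s : 'cV[R]_(n + m)) : `|dsubmx s| <= `|s|.
Proof. by apply/cV_norm_le => // i; rewrite mxE; exact: cV_coord_le. Qed.

Lemma col_mx_le (R : realType) (n m : nat) (x : 'cV[R]_n) (y : 'cV[R]_m) (c : R) :
  `|x| <= c -> `|y| <= c -> `|col_mx x y| <= c.
Proof.
move=> xc yc; have c0 := le_trans (normr_ge0 _) xc; apply/cV_norm_le => // i.
case: (split_ordP i) => j ->; rewrite ?col_mxEu ?col_mxEd.
  by apply: le_trans xc; exact: cV_coord_le.
by apply: le_trans yc; exact: cV_coord_le.
Qed.

Lemma usubmx_continuous (R : realType) (n m : nat) : continuous (fun s : 'cV[R]_(n + m) => usubmx s).
Proof. by apply: dist_continuous => x y; rewrite -linearB; exact: usubmx_le. Qed.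

Lemma dsubmx_continuous (R : realType) (n m : nat) : continuous (fun s : 'cV[R]_(n + m) => dsubmx s).
Proof. by apply: dist_continuous => x y; rewrite -linearB; exact: dsubmx_le. Qed.

Lemma ck_usub (R : realType) (V : normedModType R) (n m k : nat) (g : V -> 'cV[R]_(n + m)) i :
  (forall i, ck k (fun s => g s i 0)) -> ck k (fun s => usubmx (g s) i 0).
Proof.
by move=> Hg; rewrite (_ : (fun s => _) = fun s => g s (lshift m i) 0) //; apply/funext => s; rewrite mxE.
Qed.

Lemma ck_dsub (R : realType) (V : normedModType R) (n m k : nat) (g : V -> 'cV[R]_(n + m)) i :
  (forall i, ck k (fun s => g s i 0)) -> ck k (fun s => dsubmx (g s) i 0).
Proof.
by move=> Hg; rewrite (_ : (fun s => _) = fun s => g s (rshift n i) 0) //; apply/funext => s; rewrite mxE.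
Qed.

Lemma ck_obs_map (R : realType) (V : normedModType R) (n nu k : nat) (f : 'cV[R]_n -> R -> 'cV[R]_n)
    (h : 'cV[R]_n -> R -> R) (X : V -> 'cV[R]_n) (Z : V -> 'cV[R]_nu) i :
  smooth (fun p : ('cV[R]_n * R)%type => f p.1 p.2) ->
  smooth (fun p : ('cV[R]_n * R)%type => h p.1 p.2) ->
  (forall i, ck k (fun s => X s i 0)) -> (forall i, ck k (fun s => Z s i 0)) ->
  ck k (fun s => obs_map f h (X s) (Z s) i 0).
Proof.
move=> sf sh HX HZ.
rewrite (_ : (fun s => _) = fun s => obs_coord f h i (X s) (chain (Z s) 0)).
  by apply: obs_comp_ck => //; exact: ck_cst.
by apply/funext => s; rewrite mxE.
Qed.

(** * The compact set of admissible states *)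

Section domain.
Variables (R : realType) (n nu : nat) (f : 'cV[R]_n -> R -> 'cV[R]_n) (h : 'cV[R]_n -> R -> R).
Variables (X : set 'cV[R]_n) (U : set 'cV[R]_nu).
Variables (D : set 'cV[R]_(n + nu)) (V : 'cV[R]_(n + nu) -> R) (F : 'cV[R]_(n + nu) -> 'cV[R]_(n + nu)).
Variables (a : \bar R) (alpha1 alpha2 alpha3 : R -> R) (c2 : R).
Variables (C : 'cV[R]_nu -> set 'cV[R]_n) (b : 'cV[R]_n -> 'cV[R]_nu -> R).
Let H := obs_map (nu := nu) f h.
Let Om := sublevel D V c2.
Let Ox := [set usubmx chi | chi in Om].
Let Oz := [set dsubmx chi | chi in Om].
Hypothesis sf : smooth (fun p : ('cV[R]_n * R)%type => f p.1 p.2).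
Hypothesis sh : smooth (fun p : ('cV[R]_n * R)%type => h p.1 p.2).
Hypothesis obsH : observable H X U.
Hypothesis lyap : lyapunov_function F D V a alpha1 alpha2 alpha3.
Hypothesis Om0 : Om 0.
Hypothesis adm : admissible_sets H X U Ox Oz C.
Hypothesis bf : boundary_function Oz C b.

Notation St := 'cV[R]_(n + nu + n).
Notation zz s := (dsubmx (usubmx s)).
Notation xh s := (dsubmx s).

(* H(., z) is injective on X only, so a state of the closed loop may have xhat
   outside X; such states are excluded here. *)
Definition branch : set St :=
  [set s | [/\ Om (usubmx s), X (xh s) & C (zz s) (H (xh s) (zz s))]].

(** V is controlled on D only, so closedness in the whole space rests on the behaviour at the
    boundary of D: outside a compact subset Q of D, [alpha1] and hence V exceed c2. *)
Lemma Om_compact : compact Om.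
Proof.
have [[oD C1V] _ _ bQ bV] := lyap.
have [Q [cQ QD HQ]] := bQ c2.
have OmQ : Om `<=` Q.
  move=> chi [Dc Vc]; apply: contrapT => nQ; have := HQ chi Dc nQ.
  by have [h1 _ _] := bV chi Dc; rewrite ltNge (le_trans h1 Vc).
have closedQ : closed Q by apply: compact_closed => //; exact: norm_hausdorff.
apply: (subclosed_compact _ cQ OmQ) => p clp.
have Qp : Q p.
  by apply: closedQ; move=> N /clp [q [Oq Nq]]; exists q; split => //; exact: OmQ.
have Dp := QD _ Qp; split => //.
have cV : {for p, continuous V} by apply: differentiable_continuous; exact: (C1V p Dp).1.
apply/ler_addgt0Pr => e e0; move/cvgrPdist_lt: cV => /(_ e e0) /clp[q [[_ Vq] /=]].
by rewrite ltr_norml => /andP[? ?]; lra.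
Qed.

Lemma Oz_compact : compact Oz.
Proof.
apply: continuous_compact Om_compact; apply: continuous_subspaceT; exact: dsubmx_continuous.
Qed.

Lemma b_continuous : continuous (fun p : ('cV[R]_n * 'cV[R]_nu)%type => b p.1 p.2).
Proof. by move=> p; apply: differentiable_continuous; exact: (bf.1 p I).1. Qed.

Lemma H_C1 i : C1_on setT (fun q : 'cV[R]_(n + nu) => H (usubmx q) (dsubmx q) i 0).
Proof.
apply: ck_C1; apply: ck_obs_map => // j; [apply: ck_usub|apply: ck_dsub] => l; exact: ck_coordE.
Qed.

Lemma H_cont (T : topologicalType) (x : T -> 'cV[R]_n) (z : T -> 'cV[R]_nu) (t : T) :
  {for t, continuous x} -> {for t, continuous z} -> {for t, continuous (fun t => H (x t) (z t))}.
Proof.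
move=> cx cz; apply: cV_continuous => i.
pose q t := col_mx (x t) (z t).
rewrite (_ : (fun t => _) = (fun q : 'cV[R]_(n + nu) => H (usubmx q) (dsubmx q) i 0) \o q); last first.
  by apply/funext => u; rewrite /q /= col_mxKu col_mxKd.
apply: continuous_comp; last by apply: differentiable_continuous; exact: (H_C1 i I).1.
have coord m (y : T -> 'cV[R]_m) j : {for t, continuous y} -> {for t, continuous (fun t => y t j 0)}.
  move=> cy; apply: (@continuous_comp _ _ _ y (fun v : 'cV[R]_m => v j 0)) => //.
  exact: coord_continuous.
apply: cV_continuous => j; case: (split_ordP j) => l ->.
  by rewrite (_ : (fun t => _) = fun t => x t l 0); [exact: coord|apply/funext => u; rewrite col_mxEu].
by rewrite (_ : (fun t => _) = fun t => z t l 0); [exact: coord|apply/funext => u; rewrite col_mxEd].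
Qed.

(** By strict differentiability [H x z - H x' z] is [J *m (x - x')] up to an error of |x - x'| / (2
    k), where k bounds the inverse of the Jacobian J at (x0, z0); half of the lower bound given by J
    survives, uniformly in z. *)
Lemma local_injective x0 z0 : X x0 -> U z0 -> exists2 d : R, 0 < d & forall x x' z,
  `|x - x0| < d -> `|x' - x0| < d -> `|z - z0| < d -> d * `|x - x'| <= `|H x z - H x' z|.
Proof.
move=> Xx Uz; have [_ _ /(_ x0 z0 Xx Uz)] := obsH; set J := jac _ _ => uJ.
have [k k0 Hk] := mulmx_bound (invmx J).
have e0 : 0 < (2 * k)^-1 by rewrite invr_gt0 mulr_gt0.
have [d d0 Hd] := @strict_diff_cV _ _ _ (fun q : 'cV[R]_(n + nu) => H (usubmx q) (dsubmx q)) (col_mx x0 z0) _ H_C1 e0.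
exists (Num.min d (2 * k)^-1); first by rewrite lt_min d0.
move=> x x' z; rewrite !lt_min => /andP[hx _] /andP[hx' _] /andP[hz _].
have near y : `|y - x0| < d -> `|col_mx y z - col_mx x0 z0| < d.
  move=> hy; rewrite opp_col_mx add_col_mx.
  apply: (@le_lt_trans _ _ (Num.max `|y - x0| `|z - z0|)); last by rewrite gt_max hy.
  by apply: col_mx_le; rewrite le_max lexx ?orbT.
have Jd : J *m (x - x') = \col_i 'd (fun q : 'cV[R]_(n + nu) => H (usubmx q) (dsubmx q) i 0) (col_mx x0 z0)
    (col_mx x z - col_mx x' z).
  apply/colP => i; rewrite [RHS]mxE /J.
  have dg := (H_C1 i (x := col_mx x0 z0) I).1.
  rewrite jac_mulE; last first.
    apply: (@ck_diff _ _ _ 0); apply: (@ck_obs_map _ _ _ _ 0 f h id (fun=> z0)) => // j.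
      exact: ck_coordE.
  rewrite -deriveE // opp_col_mx add_col_mx subrr -derive_col0 col_mxKu col_mxKd.
  by rewrite (_ : (fun y => H (usubmx _) _ i 0) = fun y => H y z0 i 0) //; apply/funext => y; rewrite col_mxKu col_mxKd.
have h1 : `|J *m (x - x')| <= `|H x z - H x' z| + (2 * k)^-1 * `|x - x'|.
  apply/cV_norm_le => [|i]; first by rewrite addr_ge0 // mulr_ge0 // ltW.
  have := Hd _ _ i (near x hx) (near x' hx'); rewrite !col_mxKu !col_mxKd.
  have -> : `|col_mx x z - col_mx x' z| = `|x - x'|.
    rewrite opp_col_mx add_col_mx subrr; apply/le_anti/andP; split.
      by apply: col_mx_le; rewrite ?normr0.
    by have := usubmx_le (col_mx (x - x') (0 : 'cV[R]_nu)); rewrite col_mxKu.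
  have -> : (J *m (x - x')) i 0 = 'd (fun q : 'cV[R]_(n + nu) => H (usubmx q) (dsubmx q) i 0) (col_mx x0 z0)
    (col_mx x z - col_mx x' z) by rewrite Jd [LHS]mxE.
  move: ('d _ _ _) => dd g2.
  have : `|H x z i 0 - H x' z i 0| <= `|H x z - H x' z|.
    have -> : H x z i 0 - H x' z i 0 = (H x z - H x' z) i 0 by rewrite cV_subE.
    exact: cV_coord_le.
  move: (H x z i 0) (H x' z i 0) g2 => u v g2 g1.
  rewrite -[dd](subrK (u - v)); apply: le_trans (ler_normD _ _) _; rewrite addrC; apply: lerD => //.
  by rewrite distrC.
have h2 : `|x - x'| <= k * (`|H x z - H x' z| + (2 * k)^-1 * `|x - x'|).
  rewrite -{1}[x - x'](mulKmx uJ); apply: le_trans (Hk _) _; by rewrite ler_pM2l.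
apply: (@le_trans _ _ ((2 * k)^-1 * `|x - x'|)); first by rewrite ler_wpM2r // ge_min lexx orbT.
have e2 : k * (2 * k)^-1 = 2^-1 by rewrite invfM mulrCA divff ?mulr1 // gt_eqF.
rewrite ler_pdivrMl ?mulr_gt0 //; move: h2; rewrite mulrDr mulrA e2; lra.
Qed.

Lemma C_sub z xi : Oz z -> C z xi -> exists2 x, X x & H x z = xi.
Proof. by move=> Ozz Cx; have [/(_ z Ozz)[_ /(_ xi Cx)[x Xx Hx] _ _] _ _] := adm; exists x. Qed.

Lemma OzU z : Oz z -> U z.
Proof. by move=> Ozz; have [_ _] := adm; apply. Qed.

Lemma Om_zz chi : Om chi -> Oz (dsubmx chi).
Proof. by move=> Oc; exists chi. Qed.

Lemma Ox_C x z : Ox x -> Oz z -> C z (H x z).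
Proof. by move=> Oxx Ozz; have [/(_ z Ozz)[H1 _ _ _] _ _] := adm; apply: H1; exists x. Qed.

Lemma Ox_X x : Ox x -> X x.
Proof. by have [_ H1 _] := adm; apply: H1. Qed.

Lemma CE z xi : Oz z -> C z xi <-> b xi z <= 0.
Proof. by move=> Ozz; have [-> _ _] := bf.2 z Ozz. Qed.

Lemma Ox0 : Ox 0.
Proof. by exists 0 => //; rewrite linear0. Qed.

Lemma C_bounded : exists2 M : R, 0 < M & forall z xi, Oz z -> C z xi -> `|xi| <= M.
Proof.
(* 0 is in Ox, so [H 0 z] is a point of [C z] that depends continuously on z. *)
apply: (@convex_level_bounded R n nu Oz C b (H 0)) => //.
- exact: Oz_compact.
- by move=> z; apply: (@H_cont _ (fun=> 0) id z); [exact: continuous_cst_at|exact: cvg_id].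
- exact: b_continuous.
move=> z Ozz; have [/(_ z Ozz)[_ _ H3 H4] _ _] := adm; split => //.
  by apply: Ox_C => //; exact: Ox0.
by have [-> _ _] := bf.2 z Ozz.
Qed.

Lemma Oz_O (Hinv : 'cV[R]_n -> 'cV[R]_nu -> 'cV[R]_n) (Dom : set ('cV[R]_n * 'cV[R]_nu)%type) :
  (forall x z, X x -> U z -> Dom (H x z, z) /\ Hinv (H x z) z = x) ->
  forall z xi, Oz z -> C z xi -> [/\ Dom (xi, z), X (Hinv xi z) & H (Hinv xi z) z = xi].
Proof.
move=> HI z xi Ozz Cx; have [x Xx <-] := C_sub Ozz Cx.
by have [h1 h2] := HI x z Xx (OzU Ozz); rewrite h2.
Qed.

(** X may fail to be closed, so closedness cannot be read off the definition. In the coordinates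
    (chi, xi) the set N is closed and bounded, and the branch is its continuous image under
    [Hinv]. *)
Lemma branch_compact : compact branch.
Proof.
have [_ [Hinv [Dom [openO sO HI]]] _] := obsH.
have HI' := Oz_O HI.
pose N : set St := [set s | Om (usubmx s) /\ b (xh s) (zz s) <= 0].
have cb : continuous (fun s : St => b (xh s) (zz s)).
  move=> s; apply: (@continuous_comp _ _ _ (fun s : St => (xh s, zz s)) (fun p => b p.1 p.2)); last exact: b_continuous.
  apply: cont_pair; first exact: dsubmx_continuous.
  apply: (@continuous_comp _ _ _ (fun s : St => usubmx s) (fun q => dsubmx q)); first exact: usubmx_continuous.
  exact: dsubmx_continuous.
have cN : compact N.
  have [M M0 HM] := C_bounded.
  have [M1 [_ HM1]] := compact_bounded Om_compact.
  apply: (@cV_compact _ _ _ (Num.max (M1 + 1) M)).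
    apply: closedI.
      apply: (@closed_comp _ _ (fun s : St => usubmx s) Om); first by move=> s _; exact: usubmx_continuous.
      by apply: compact_closed Om_compact; exact: norm_hausdorff.
    apply: (@closed_comp _ _ (fun s : St => b (xh s) (zz s)) [set r | r <= 0]); last exact: closed_le.
    by move=> s _; exact: cb.
  move=> s [Os bs]; rewrite -[s]vsubmxK; apply: col_mx_le.
    by apply: (@le_trans _ _ (M1 + 1)); [apply: HM1; rewrite ?ltrDl|rewrite le_max lexx].
  have Ozz := Om_zz Os; have := HM _ _ Ozz ((CE _ Ozz).2 bs) => /le_trans; apply.
  by rewrite le_max lexx orbT.
pose g (s : St) : St := col_mx (usubmx s) (Hinv (xh s) (zz s)).
have -> : branch = g @` N.
  apply/seteqP; split=> s.
    move=> [h1 h2 h3]; have Ozz := Om_zz h1.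
    exists (col_mx (usubmx s) (H (xh s) (zz s))).
      by rewrite /N /= !col_mxKu !col_mxKd; split => //; apply/CE.
    rewrite /g !col_mxKu !col_mxKd (HI _ _ h2 (OzU Ozz)).2.
    by rewrite vsubmxK.
  move=> [t [Ot bt] <-]; have Ozz := Om_zz Ot; have Ct := (CE _ Ozz).2 bt.
  have [_ h1 h2] := HI' _ _ Ozz Ct.
  by rewrite /branch /g /= !col_mxKu !col_mxKd h2.
apply: continuous_compact cN; apply: continuous_in_subspaceT => s; rewrite inE => -[Os bs].
have Ozz := Om_zz Os; have [Os' _ _] := HI' _ _ Ozz ((CE _ Ozz).2 bs).
have cH : {for s, continuous (fun s : St => Hinv (xh s) (zz s))}.
  apply: (@continuous_comp _ _ _ (fun s : St => (xh s, zz s)) (fun p => Hinv p.1 p.2)).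
    apply: cont_pair; first exact: dsubmx_continuous.
    apply: (@continuous_comp _ _ _ (fun s : St => usubmx s) (fun q => dsubmx q)); first exact: usubmx_continuous.
    exact: dsubmx_continuous.
  by apply: differentiable_continuous; exact: (sO [::] _ Os').
have coord m (y : St -> 'cV[R]_m) j : {for s, continuous y} -> {for s, continuous (fun t => y t j 0)}.
  move=> cy; apply: (@continuous_comp _ _ _ y (fun v : 'cV[R]_m => v j 0)) => //.
  exact: coord_continuous.
apply: cV_continuous => j; case: (split_ordP j) => l ->.
  rewrite (_ : (fun t => _) = fun t : St => usubmx t l 0); last by apply/funext => u; rewrite col_mxEu.
  by apply: coord; exact: usubmx_continuous.
rewrite (_ : (fun t => _) = fun t : St => Hinv (xh t) (zz t) l 0); last by apply/funext => u; rewrite col_mxEd.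
exact: coord.
Qed.

(** For s near s0, both [xh s] and the preimage of [H (xh s) (zz s)] that lies in X are near
    [xh s0]; having the same image they coincide by [local_injective], so xhat cannot slip to
    another preimage. *)
Lemma branch_open s0 : branch s0 -> exists2 d : R, 0 < d & forall s, `|s - s0| < d ->
  Om (usubmx s) -> C (zz s) (H (xh s) (zz s)) -> branch s.
Proof.
move=> [Osz X0 C0]; have Oz0 := Om_zz Osz.
have [_ [Hinv [Dom [openO sO HI]]] _] := obsH.
have [d d0 Hd] := local_injective X0 (OzU Oz0).
have [OH0 HK0] := HI _ _ X0 (OzU Oz0).
have cz : {for s0, continuous (fun s : St => zz s)}.
  apply: (@continuous_comp _ _ _ (fun s : St => usubmx s) (fun q => dsubmx q)); first exact: usubmx_continuous.
  exact: dsubmx_continuous.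
have cH : {for s0, continuous (fun s : St => Hinv (H (xh s) (zz s)) (zz s))}.
  apply: (@continuous_comp _ _ _ (fun s : St => (H (xh s) (zz s), zz s)) (fun p => Hinv p.1 p.2)).
    apply: cont_pair; last exact: cz.
    by apply: H_cont; [exact: dsubmx_continuous|exact: cz].
  by apply: differentiable_continuous; exact: (sO [::] _ OH0).
move: cH => /cvgrPdist_lt /(_ d d0) /nbhs_ballP[e /= e0 He].
exists (Num.min d e); first by rewrite lt_min d0.
move=> s; rewrite lt_min => /andP[sd se] Os Cs.
have Ozz := Om_zz Os; have [_ h1 h2] := Oz_O HI Ozz Cs.
split=> //; suff -> : xh s = Hinv (H (xh s) (zz s)) (zz s) by [].
apply/eqP; rewrite -subr_eq0 -normr_le0; have := Hd (xh s) (Hinv (H (xh s) (zz s)) (zz s)) (zz s).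
rewrite h2 subrr normr0 pmulr_rle0 //; apply.
- by apply: le_lt_trans sd; rewrite -linearB; exact: dsubmx_le.
- by rewrite distrC; have := He s; rewrite -ball_normE /= (distrC s0 s) se HK0 => /(_ isT).
- by apply: le_lt_trans sd; rewrite -!linearB; apply: le_trans (dsubmx_le _) (usubmx_le _).
Qed.

(** Near states with xhat = x this is [local_injective]. Elsewhere injectivity on X, provided by
    [Hinv], keeps the right-hand side away from 0, and compactness makes the constant uniform. *)
Lemma branch_inv_lipschitz : exists2 k : R, 0 < k & forall s, branch s ->
  `|xh s - usubmx (usubmx s)| <= k * `|H (xh s) (zz s) - H (usubmx (usubmx s)) (zz s)|.
Proof.
pose P (r : R) (s : St) := r * `|xh s - usubmx (usubmx s)| <=
   `|H (xh s) (zz s) - H (usubmx (usubmx s)) (zz s)|.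
have mono (r r' : R) x : 0 < r' -> r' <= r -> P r x -> P r' x.
  by move=> r'0 r'r; apply: le_trans; rewrite ler_wpM2r.
have cz (s : St) : {for s, continuous (fun s : St => zz s)}.
  apply: (@continuous_comp _ _ _ (fun s : St => usubmx s) (fun q => dsubmx q)); first exact: usubmx_continuous.
  exact: dsubmx_continuous.
have cx (s : St) : {for s, continuous (fun s : St => usubmx (usubmx s))}.
  apply: (@continuous_comp _ _ _ (fun s : St => usubmx s) (fun q => usubmx q)); exact: usubmx_continuous.
have [|r r0 Hr] := compact_unif branch_compact mono.
  move=> s0 [Osz X0 C0]; have Oz0 := Om_zz Osz.
  have Xx : X (usubmx (usubmx s0)) by apply: Ox_X; exists (usubmx s0).
  have Uz := OzU Oz0.
  have [ee|ne] := eqVneq (xh s0) (usubmx (usubmx s0)).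
    have [d d0 Hd] := local_injective X0 Uz; exists d => // s _ sd; apply: Hd.
    - by apply: le_lt_trans sd; rewrite -linearB; exact: dsubmx_le.
    - by apply: le_lt_trans sd; rewrite ee -!linearB; apply: le_trans (usubmx_le _) (usubmx_le _).
    - by apply: le_lt_trans sd; rewrite -!linearB; apply: le_trans (dsubmx_le _) (usubmx_le _).
  have [_ [Hinv [Dom [openO sO HI]]] _] := obsH.
  pose N (s : St) := `|H (xh s) (zz s) - H (usubmx (usubmx s)) (zz s)|.
  pose E (s : St) := `|xh s - usubmx (usubmx s)|.
  have N0 : 0 < N s0.
    rewrite normr_gt0 subr_eq0; apply/eqP => HH; move/eqP: ne; apply.
    by rewrite -(HI _ _ X0 Uz).2 HH (HI _ _ Xx Uz).2.
  have N20 : 0 < N s0 / 2 by rewrite divr_gt0.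
  have cN : {for s0, continuous N}.
    apply: (@continuous_comp _ _ _ (fun s : St => H (xh s) (zz s) - H (usubmx (usubmx s)) (zz s))
      (fun x => `|x|)); last exact: norm_continuous.
    apply: contB.
      by apply: H_cont; [exact: dsubmx_continuous|exact: cz].
    by apply: H_cont; [exact: cx|exact: cz].
  have cE : {for s0, continuous E}.
    apply: (@continuous_comp _ _ _ (fun s : St => xh s - usubmx (usubmx s)) (fun x => `|x|));
      last exact: norm_continuous.
    by apply: contB; [exact: dsubmx_continuous|exact: cx].
  have /nbhs_ballP[d /= d0 Hd] : \forall s \near s0, `|N s0 - N s| < N s0 / 2 /\ `|E s0 - E s| < 1.
    by apply: filterI; [move/cvgrPdist_lt: cN|move/cvgrPdist_lt: cE]; apply.
  have E10 : 0 < E s0 + 1 by rewrite ltr_wpDl // normr_ge0.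
  exists (Num.min d (N s0 / 2 / (E s0 + 1))); first by rewrite lt_min d0 divr_gt0.
  move=> s _; rewrite lt_min => /andP[sd _]; have := Hd s; rewrite -ball_normE /= (distrC s0 s) => /(_ sd)[h1 h2].
  rewrite /P -/(N s) -/(E s).
  have NN : N s0 / 2 <= N s by move: h1; rewrite ltr_norml => /andP[? ?]; lra.
  apply: le_trans NN; have EE : E s <= E s0 + 1 by move: h2; rewrite ltr_norml => /andP[? ?]; lra.
  apply: (@le_trans _ _ (N s0 / 2 / (E s0 + 1) * (E s0 + 1))); last by rewrite divfK // gt_eqF.
  apply: ler_pM => //; [by rewrite le_min (ltW d0) /= ltW // divr_gt0|exact: normr_ge0|by rewrite ge_min lexx orbT].
exists r^-1; first by rewrite invr_gt0.
by move=> s Bs; rewrite ler_pdivlMl //; exact: Hr.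
Qed.

Lemma branch_true s : branch s -> branch (col_mx (usubmx s) (usubmx (usubmx s))).
Proof.
move=> [h1 h2 h3]; rewrite /branch /= !col_mxKu !col_mxKd.
have Oxx : Ox (usubmx (usubmx s)) by exists (usubmx s).
by split => //; [exact: Ox_X|apply: Ox_C => //; exact: Om_zz].
Qed.

End domain.

(** * The closed-loop field *)

Definition contmx (R : realType) (T : topologicalType) (p q : nat) (M : T -> 'M[R]_(p, q)) (t : T) : Prop :=
  forall i j, {for t, continuous (fun t => M t i j)}.

Lemma contmx_cst (R : realType) (T : topologicalType) (p q : nat) (M : 'M[R]_(p, q)) (t : T) :
  contmx (fun=> M) t.
Proof. by move=> i j; exact: continuous_cst_at. Qed.

Lemma contmxD (R : realType) (T : topologicalType) (p q : nat) (M N : T -> 'M[R]_(p, q)) (t : T) :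
  contmx M t -> contmx N t -> contmx (fun t => M t + N t) t.
Proof.
move=> cM cN i j; rewrite (_ : (fun t => _) = fun t => M t i j + N t i j); first exact: contD.
by apply/funext => u; rewrite mxE.
Qed.

Lemma contmxZ (R : realType) (T : topologicalType) (p q : nat) (k : T -> R) (M : T -> 'M[R]_(p, q)) (t : T) :
  {for t, continuous k} -> contmx M t -> contmx (fun t => k t *: M t) t.
Proof.
move=> ck cM i j; rewrite (_ : (fun t => _) = fun t => k t * M t i j); first exact: contM.
by apply/funext => u; rewrite mxE.
Qed.

Lemma contmxM (R : realType) (T : topologicalType) (p q l : nat) (M : T -> 'M[R]_(p, q))
    (N : T -> 'M[R]_(q, l)) (t : T) :
  contmx M t -> contmx N t -> contmx (fun t => M t *m N t) t.
Proof.
move=> cM cN i j; rewrite (_ : (fun t => _) = fun t => \sum_k M t i k * N t k j).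
  by apply: cont_sum => k _; exact: contM.
by apply/funext => u; rewrite mxE.
Qed.

Lemma contmxT (R : realType) (T : topologicalType) (p q : nat) (M : T -> 'M[R]_(p, q)) (t : T) :
  contmx M t -> contmx (fun t => (M t)^T) t.
Proof.
move=> cM i j; rewrite (_ : (fun t => _) = fun t => M t j i) //.
by apply/funext => u; rewrite mxE.
Qed.

Lemma cont_det (R : realType) (T : topologicalType) (p : nat) (M : T -> 'M[R]_p) (t : T) :
  contmx M t -> {for t, continuous (fun t => \det (M t))}.
Proof.
move=> cM; rewrite /determinant; apply: cont_sum => s _; apply: contM; first exact: continuous_cst_at.
by apply: cont_prod => i _; exact: cM.
Qed.

(** Cramer's formula, which agrees with [invmx] near t because the determinant stays nonzero
    there. *)
Lemma contmx_inv (R : realType) (T : topologicalType) (p : nat) (M : T -> 'M[R]_p) (t : T) :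
  contmx M t -> M t \in unitmx -> contmx (fun t => invmx (M t)) t.
Proof.
move=> cM uM i j.
have cdet := cont_det cM.
have det0 : \det (M t) != 0 by move: uM; rewrite unitmxE unitfE.
have near_unit : \forall u \near t, M u \in unitmx.
  have d0 : 0 < `|\det (M t)| by rewrite normr_gt0.
  move/cvgrPdist_lt: cdet => /(_ _ d0); apply: filterS => u.
  rewrite unitmxE unitfE; apply: contraTneq => ->.
  by rewrite subr0 ltxx.
pose g u := (\det (M u))^-1 * ((-1) ^+ (j + i) * \det (row' j (col' i (M u)))).
have cg : {for t, continuous g}.
  apply: contM; first exact: cvgV.
  apply: contM; first exact: continuous_cst_at.
  apply: cont_det => k l; rewrite (_ : (fun t => _) = fun t => M t (lift j k) (lift i l)); first exact: cM.
  by apply/funext => u; rewrite !mxE.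
have E u : M u \in unitmx -> invmx (M u) i j = g u.
  by move=> uu; rewrite /invmx uu !mxE.
have : (fun u => invmx (M u) i j) u @[u --> t] --> g t.
  apply: cvg_trans cg; apply: near_eq_cvg.
  by move: near_unit; apply: filterS => u uu; rewrite E.
by rewrite /= -(E t uM).
Qed.

Lemma contmx_cV (R : realType) (T : topologicalType) (m : nat) (g : T -> 'cV[R]_m) (t : T) :
  contmx g t <-> {for t, continuous g}.
Proof.
split=> [cg|cg i j]; first by apply: cV_continuous => i; exact: cg.
rewrite ord1; apply: (@continuous_comp _ _ _ g (fun x : 'cV[R]_m => x i 0)) => //.
exact: coord_continuous.
Qed.

Lemma contmx_col (R : realType) (T : topologicalType) (m p : nat) (g : T -> 'cV[R]_m) (k : T -> 'cV[R]_p) (t : T) :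
  contmx g t -> contmx k t -> contmx (fun t => col_mx (g t) (k t)) t.
Proof.
move=> cg ck i j; rewrite ord1; case: (split_ordP i) => l ->.
  by rewrite (_ : (fun t => _) = fun t => g t l 0) //; apply/funext => u; rewrite col_mxEu.
by rewrite (_ : (fun t => _) = fun t => k t l 0) //; apply/funext => u; rewrite col_mxEd.
Qed.

Lemma ck_contmx (R : realType) (V : normedModType R) (m : nat) (g : V -> 'cV[R]_m) (t : V) :
  (forall i, ck 0 (fun s => g s i 0)) -> contmx g t.
Proof. by move=> Hg i j; rewrite ord1; apply: differentiable_continuous; exact: ck_diff (Hg i). Qed.

Section loop_field.
Variables (R : realType) (n nu : nat) (f : 'cV[R]_n -> R -> 'cV[R]_n) (h : 'cV[R]_n -> R -> R).
Variables (phi : 'cV[R]_(n + nu) -> R) (L : 'cV[R]_n) (S : 'M[R]_n) (rho : R).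
Variable (b : 'cV[R]_n -> 'cV[R]_nu -> R).
Hypothesis sf : smooth (fun p : ('cV[R]_n * R)%type => f p.1 p.2).
Hypothesis sh : smooth (fun p : ('cV[R]_n * R)%type => h p.1 p.2).
Hypothesis sphi : smooth phi.
Hypothesis bC1 : C1_on setT (fun p : ('cV[R]_n * 'cV[R]_nu)%type => b p.1 p.2).
Let H := obs_map (nu := nu) f h.
Notation St := 'cV[R]_(n + nu + n).
Notation zz s := (dsubmx (usubmx s)).
Notation xx s := (usubmx (usubmx s)).
Notation xh s := (dsubmx s).

Definition vin (s : St) : R := phi (col_mx (xh s) (zz s)).
Definition ofield (s : St) : 'cV[R]_n :=
  observer_field f h L rho (xh s) (zz s) (vin s) (ext_output h (usubmx s) (vin s)).
Definition free_field (s : St) : St := col_mx (ext_field f (usubmx s) (vin s)) (ofield s).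
Definition Hx (s : St) : 'M[R]_n := jac (H ^~ (zz s)) (xh s).
Definition Hz (s : St) : 'M[R]_(n, nu) := jac (H (xh s)) (zz s).
Definition xih (s : St) : 'cV[R]_n := H (xh s) (zz s).
Definition dzf (s : St) : 'cV[R]_nu := zdot (zz s) (vin s).
Definition dxi (s : St) : 'cV[R]_n := Hx s *m ofield s + Hz s *m dzf s.
Definition nrm (s : St) : 'cV[R]_n := grad (b ^~ (zz s)) (xih s).
Definition nrmz (s : St) : 'cV[R]_nu := grad (b (xih s)) (zz s).
Definition rate (s : St) : R := ((nrm s)^T *m dxi s + (nrmz s)^T *m dzf s) 0 0.
Definition level (s : St) : R := b (xih s) (zz s).
Definition gnn (s : St) : R := ((nrm s)^T *m Gam S rho *m nrm s) 0 0.
(** Direction of the projection in the state space: chi is not moved, and the factor [(gnn s)^-1]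
    gives the level derivative 1 along it, as [reflected_exists] requires. *)
Definition push (s : St) : St := col_mx 0 ((gnn s)^-1 *: (invmx (Hx s) *m (Gam S rho *m nrm s))).

Lemma closed_loop_reflected s : Hx s \in unitmx ->
  closed_loop f h phi L S b rho s = reflected free_field push level rate s.
Proof.
move=> uH; rewrite /closed_loop /projected_observer_field -/(vin s) -/(ofield s) -/(Hx s) -/(Hz s).
rewrite -/(dzf s) -/(dxi s) /projection -/(xih s) -/(nrm s) -/(nrmz s) -/(rate s) -/(level s) -/(gnn s).
have E : invmx (Hx s) *m (dxi s - Hz s *m dzf s) = ofield s by rewrite /dxi addrK mulKmx.
rewrite /reflected; case: ifP => _; last by rewrite E.
rewrite /free_field /push scale_col_mx scaler0 opp_col_mx add_col_mx subr0; congr col_mx.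
by rewrite addrAC mulmxBr E -scalemxAr scalerA.
Qed.

Lemma ck_xh k i : ck k (fun s : St => xh s i 0).
Proof. by apply: ck_dsub => j; exact: ck_coordE. Qed.
Lemma ck_zz k i : ck k (fun s : St => zz s i 0).
Proof. by apply: ck_dsub => j; apply: ck_usub => l; exact: ck_coordE. Qed.
Lemma ck_xx k i : ck k (fun s : St => xx s i 0).
Proof. by apply: ck_usub => j; apply: ck_usub => l; exact: ck_coordE. Qed.

Lemma ck_vin k : ck k vin.
Proof.
apply: (@ck_comp _ _ _ _ phi (fun s => col_mx (xh s) (zz s))); first exact: smooth_ck.
move=> i; case: (split_ordP i) => j ->.
  rewrite (_ : (fun t => _) = fun s : St => xh s j 0); first exact: ck_xh.
  by apply/funext => u; rewrite col_mxEu.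
rewrite (_ : (fun t => _) = fun s : St => zz s j 0); first exact: ck_zz.
by apply/funext => u; rewrite col_mxEd.
Qed.

Lemma ck_u k l : ck k (fun s => chain (zz s) (vin s) l).
Proof. by apply: ck_chain; [exact: ck_zz|exact: ck_vin]. Qed.

Lemma ck_ext k i : ck k (fun s => ext_field f (usubmx s) (vin s) i 0).
Proof.
case: (split_ordP i) => j ->.
  rewrite (_ : (fun t => _) = fun s => f (xx s) (chain (zz s) (vin s) 0) j 0).
    apply: (ck_pair_comp (g := fun x u => f x u j 0)); [exact: smooth_coord sf|exact: ck_xx|exact: ck_u].
  by apply/funext => u; rewrite col_mxEu.
rewrite (_ : (fun t => _) = fun s => chain (zz s) (vin s) j.+1); first exact: ck_u.
by apply/funext => u; rewrite col_mxEd mxE.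
Qed.

Lemma ck_xih k i : ck k (fun s => xih s i 0).
Proof. by apply: ck_obs_map => //; [exact: ck_xh|exact: ck_zz]. Qed.

Lemma ck_dzf k i : ck k (fun s => dzf s i 0).
Proof.
rewrite (_ : (fun t => _) = fun s => chain (zz s) (vin s) i.+1); first exact: ck_u.
by apply/funext => u; rewrite mxE.
Qed.

Lemma H_ck k i : ck k (fun q : 'cV[R]_(n + nu) => H (usubmx q) (dsubmx q) i 0).
Proof. by apply: ck_obs_map => // j; [apply: ck_usub|apply: ck_dsub] => l; exact: ck_coordE. Qed.

Lemma ck_pair_pt k i : ck k (fun s : St => col_mx (xh s) (zz s) i 0).
Proof.
case: (split_ordP i) => j ->.
  rewrite (_ : (fun t => _) = fun s : St => xh s j 0); first exact: ck_xh.
  by apply/funext => u; rewrite col_mxEu.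
rewrite (_ : (fun t => _) = fun s : St => zz s j 0); first exact: ck_zz.
by apply/funext => u; rewrite col_mxEd.
Qed.

Lemma HxE s i j : Hx s i j = 'D_(col_mx (delta_mx j 0) 0) (fun q : 'cV[R]_(n + nu) => H (usubmx q) (dsubmx q) i 0)
  (col_mx (xh s) (zz s)).
Proof.
rewrite -derive_col0 col_mxKu col_mxKd /Hx [LHS]mxE.
by rewrite (_ : (fun y => H (usubmx _) _ i 0) = fun y => H y (zz s) i 0) //; apply/funext => y; rewrite col_mxKu col_mxKd.
Qed.

Lemma HzE s i j : Hz s i j = 'D_(col_mx 0 (delta_mx j 0)) (fun q : 'cV[R]_(n + nu) => H (usubmx q) (dsubmx q) i 0)
  (col_mx (xh s) (zz s)).
Proof.
rewrite -derive_0col col_mxKu col_mxKd /Hz [LHS]mxE.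
by rewrite (_ : (fun y => H (usubmx _) _ i 0) = fun y => H (xh s) y i 0) //; apply/funext => y; rewrite col_mxKu col_mxKd.
Qed.

Lemma HxzE s i w wz : (Hx s *m w + Hz s *m wz) i 0 =
  'D_(col_mx w wz) (fun q : 'cV[R]_(n + nu) => H (usubmx q) (dsubmx q) i 0) (col_mx (xh s) (zz s)).
Proof.
rewrite derive_cV; last exact: ck_diff (H_ck 0 i).
rewrite big_split_ord /= [LHS]mxE [X in X + _]mxE [X in _ + X]mxE.
congr (_ + _); apply: eq_bigr => j _.
  by rewrite HxE col_mxEu delta_col_u.
by rewrite HzE col_mxEd delta_col_d.
Qed.

Lemma derive_xih s i (w : St) : 'D_w (fun s => xih s i 0) s = (Hx s *m xh w + Hz s *m zz w) i 0.
Proof.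
rewrite HxzE; apply: derive_line => t; rewrite /xih.
have -> : xh (t *: w + s) = t *: xh w + xh s by apply/colP => j; rewrite !mxE.
have -> : zz (t *: w + s) = t *: zz w + zz s by apply/colP => j; rewrite !mxE.
by rewrite scale_col_mx add_col_mx col_mxKu col_mxKd.
Qed.

Lemma contmx_Hx s : contmx Hx s.
Proof.
move=> i j.
rewrite (_ : (fun t => _) = fun s => 'D_(col_mx (delta_mx j 0) 0) (fun q : 'cV[R]_(n + nu) => H (usubmx q) (dsubmx q) i 0)
  (col_mx (xh s) (zz s))); last by apply/funext => t; rewrite HxE.
apply: differentiable_continuous; apply: (@ck_diff _ _ _ 0).
apply: (@ck_comp _ _ _ _ ('D_(col_mx (delta_mx j 0) 0) _) (fun s : St => col_mx (xh s) (zz s))); last exact: ck_pair_pt.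
exact: ck_derive (H_ck 1 i).
Qed.

Lemma contmx_Hz s : contmx Hz s.
Proof.
move=> i j.
rewrite (_ : (fun t => _) = fun s => 'D_(col_mx 0 (delta_mx j 0)) (fun q : 'cV[R]_(n + nu) => H (usubmx q) (dsubmx q) i 0)
  (col_mx (xh s) (zz s))); last by apply/funext => t; rewrite HzE.
apply: differentiable_continuous; apply: (@ck_diff _ _ _ 0).
apply: (@ck_comp _ _ _ _ ('D_(col_mx 0 (delta_mx j 0)) _) (fun s : St => col_mx (xh s) (zz s))); last exact: ck_pair_pt.
exact: ck_derive (H_ck 1 i).
Qed.

Lemma contmx_ofield s : Hx s \in unitmx -> contmx ofield s.
Proof.
move=> uH; apply: contmxD.
  apply: ck_contmx => i; apply: (ck_pair_comp (g := fun x u => f x u i 0)); [exact: smooth_coord sf|exact: ck_xh|exact: ck_u].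
apply: contmxZ.
  apply: contB; apply: differentiable_continuous; apply: (@ck_diff _ _ _ 0).
    by apply: (ck_pair_comp (g := h)); [exact: sh|exact: ck_xx|exact: ck_u].
  by apply: (ck_pair_comp (g := h)); [exact: sh|exact: ck_xh|exact: ck_u].
apply: contmxM; last exact: contmx_cst.
apply: contmxM; last exact: contmx_cst.
by apply: contmx_inv => //; exact: contmx_Hx.
Qed.

Lemma cont_pt s : {for s, continuous (fun s : St => (xih s, zz s))}.
Proof.
apply: cont_pair; apply/contmx_cV; apply: ck_contmx => i; [exact: ck_xih|exact: ck_zz].
Qed.

Lemma contmx_nrm s : contmx nrm s.
Proof.
move=> i j; rewrite (_ : (fun t => _) = fun s => 'D_((delta_mx i 0 : 'cV[R]_n), (0 : 'cV[R]_nu))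
   (fun p : ('cV[R]_n * 'cV[R]_nu)%type => b p.1 p.2) (xih s, zz s)).
  apply: (@continuous_comp _ _ _ (fun s : St => (xih s, zz s)) ('D_((delta_mx i 0 : 'cV[R]_n), (0 : 'cV[R]_nu)) _)); first exact: cont_pt.
  exact: (bC1 I).2.
apply/funext => t; rewrite [LHS]mxE; apply: derive_line => r /=.
by rewrite scaler0 add0r.
Qed.

Lemma contmx_nrmz s : contmx nrmz s.
Proof.
move=> i j; rewrite (_ : (fun t => _) = fun s => 'D_((0 : 'cV[R]_n), (delta_mx i 0 : 'cV[R]_nu))
   (fun p : ('cV[R]_n * 'cV[R]_nu)%type => b p.1 p.2) (xih s, zz s)).
  apply: (@continuous_comp _ _ _ (fun s : St => (xih s, zz s)) ('D_((0 : 'cV[R]_n), (delta_mx i 0 : 'cV[R]_nu)) _)); first exact: cont_pt.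
  exact: (bC1 I).2.
apply/funext => t; rewrite [LHS]mxE; apply: derive_line => r /=.
by rewrite scaler0 add0r.
Qed.

Lemma cont_free s : Hx s \in unitmx -> {for s, continuous free_field}.
Proof.
move=> uH; apply/contmx_cV; apply: contmx_col; last exact: contmx_ofield.
by apply: ck_contmx => i; exact: ck_ext.
Qed.

Lemma cont_rate s : Hx s \in unitmx -> {for s, continuous rate}.
Proof.
move=> uH.
have cdz : contmx dzf s by apply: ck_contmx => i; exact: ck_dzf.
have cdx : contmx dxi s.
  apply: contmxD; apply: contmxM; [exact: contmx_Hx|exact: contmx_ofield|exact: contmx_Hz|exact: cdz].
have : contmx (fun s => (nrm s)^T *m dxi s + (nrmz s)^T *m dzf s) s.
  apply: contmxD; apply: contmxM => //; apply: contmxT; [exact: contmx_nrm|exact: contmx_nrmz].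
by move=> /(_ 0 0).
Qed.

Lemma cont_gnn s : {for s, continuous gnn}.
Proof.
have : contmx (fun s => (nrm s)^T *m Gam S rho *m nrm s) s.
  apply: contmxM; last exact: contmx_nrm.
  apply: contmxM; last exact: contmx_cst.
  by apply: contmxT; exact: contmx_nrm.
by move=> /(_ 0 0).
Qed.

Lemma cont_push s : Hx s \in unitmx -> gnn s != 0 -> {for s, continuous push}.
Proof.
move=> uH g0; apply/contmx_cV; apply: contmx_col; first exact: contmx_cst.
apply: contmxZ; first exact: (cvgV g0 (@cont_gnn s)).
apply: contmxM; first by apply: contmx_inv => //; exact: contmx_Hx.
by apply: contmxM; [exact: contmx_cst|exact: contmx_nrm].
Qed.

Lemma diff_level s : differentiable level s.
Proof.
apply: (@differentiable_comp _ _ _ _ (fun s : St => (xih s, zz s)) (fun p => b p.1 p.2)); last exact: (bC1 I).1.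
apply: differentiable_pair; apply: differentiable_cV => i.
  exact: ck_diff (ck_xih 0 i).
exact: ck_diff (ck_zz 0 i).
Qed.

Lemma derive_level s (w : St) :
  'D_w level s = ((nrm s)^T *m (Hx s *m xh w + Hz s *m zz w) + (nrmz s)^T *m zz w) 0 0.
Proof.
pose g (s : St) : 'cV[R]_(n + nu) := col_mx (xih s) (zz s).
pose b' (q : 'cV[R]_(n + nu)) := b (usubmx q) (dsubmx q).
have -> : level = (fun s => b' (g s)).
  by apply/funext => t; rewrite /b' /g col_mxKu col_mxKd.
have db' : differentiable b' (g s).
  apply: (@differentiable_comp _ _ _ _ (fun q : 'cV[R]_(n + nu) => (usubmx q, dsubmx q)) (fun p => b p.1 p.2)); last exact: (bC1 I).1.
  by apply: differentiable_pair; [exact: differentiable_usubmx|exact: differentiable_dsubmx].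
have gu i : (fun s => g s (lshift nu i) 0) = (fun s => xih s i 0) by apply/funext => t; rewrite col_mxEu.
have gd i : (fun s => g s (rshift n i) 0) = (fun s => zz s i 0) by apply/funext => t; rewrite col_mxEd.
rewrite derive_comp_cV //; last first.
  move=> i; case: (split_ordP i) => j ->; rewrite ?gu ?gd.
    exact: ck_diff (ck_xih 0 j).
  exact: ck_diff (ck_zz 0 j).
rewrite big_split_ord /= [RHS]mxE [X in _ = X + _]mxE [X in _ = _ + X]mxE.
congr (_ + _); apply: eq_bigr => i _; rewrite [X in _ = X * _]mxE [X in _ = X * _]mxE.
  rewrite gu derive_xih; congr (_ * _).
  rewrite delta_col_u -derive_col0 /g col_mxKu col_mxKd.
  by rewrite (_ : (fun x => b' _) = b^~ (zz s)) //; apply/funext => y; rewrite /b' col_mxKu col_mxKd.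
rewrite gd; congr (_ * _).
  rewrite delta_col_d -derive_0col /g col_mxKu col_mxKd.
  by rewrite (_ : (fun x => b' _) = b (xih s)) //; apply/funext => y; rewrite /b' col_mxKu col_mxKd.
have -> : 'D_w (fun s : St => zz s i 0) s = 'D_w (fun s : St => s (lshift n (rshift n i)) 0) s.
  rewrite (_ : (fun s : St => zz s i 0) = fun s : St => s (lshift n (rshift n i)) 0) //.
  by apply/funext => t; rewrite !mxE.
by rewrite derive_coord !mxE.
Qed.

Lemma derive_level_free s : 'D_(free_field s) level s = rate s.
Proof. by rewrite derive_level /free_field col_mxKd /ext_field !col_mxKu !col_mxKd. Qed.

Lemma derive_level_push s : Hx s \in unitmx -> gnn s != 0 -> 'D_(push s) level s = 1.
Proof.
move=> uH g0; rewrite derive_level /push col_mxKu col_mxKd linear0 !mulmx0 !addr0.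
rewrite -scalemxAr mulKVmx // -scalemxAr mxE mulmxA -/(gnn s) mulVf //.
Qed.

End loop_field.

Lemma dot_ge0 (R : realType) (m : nat) (v : 'cV[R]_m) : 0 <= (v^T *m v) 0 0.
Proof. by rewrite mxE; apply: sumr_ge0 => i _; rewrite mxE -expr2 sqr_ge0. Qed.

Lemma dot_ge_coord (R : realType) (m : nat) (v : 'cV[R]_m) : `|v| ^+ 2 <= (v^T *m v) 0 0.
Proof.
have H i : v i 0 ^+ 2 <= (v^T *m v) 0 0.
  rewrite mxE (bigD1 i) //= mxE -expr2 lerDl; apply: sumr_ge0 => j _.
  by rewrite mxE -expr2 sqr_ge0.
have [->|vn0] := eqVneq v 0; first by rewrite normr0 expr0n dot_ge0.
have : `|v| <= Num.sqrt ((v^T *m v) 0 0).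
  apply/cV_norm_le => [|i]; first exact: sqrtr_ge0.
  by rewrite -sqrtr_sqr ler_wsqrtr.
rewrite -(ler_pXn2r (n := 2)) ?nnegrE ?sqrtr_ge0 // => /le_trans; apply.
by rewrite sqr_sqrtr // dot_ge0.
Qed.

Lemma dot_gt0 (R : realType) (m : nat) (v : 'cV[R]_m) : v != 0 -> 0 < (v^T *m v) 0 0.
Proof.
move=> vn0; apply: lt_le_trans (dot_ge_coord v).
by rewrite exprn_gt0 // normr_gt0.
Qed.

Lemma E'rho_unit (R : realType) (n : nat) (rho : R) : rho != 0 -> E'rho n rho \in unitmx.
Proof.
move=> r0; rewrite unitmxE det_diag unitfE; apply/prodf_neq0 => i _.
by rewrite mxE invr_neq0 // expf_neq0.
Qed.

Lemma Erho_unit (R : realType) (n : nat) (rho : R) : rho != 0 -> Erho n rho \in unitmx.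
Proof.
move=> r0; rewrite unitmxE det_diag unitfE; apply/prodf_neq0 => i _.
by rewrite mxE expf_neq0.
Qed.

Lemma Gam_pos (R : realType) (n : nat) (S : 'M[R]_n) (rho : R) (v : 'cV[R]_n) :
  S \in unitmx -> rho != 0 -> v != 0 -> 0 < (v^T *m Gam S rho *m v) 0 0.
Proof.
move=> uS r0 vn0; have uM : S *m E'rho n rho \in unitmx by rewrite unitmx_mul uS E'rho_unit.
rewrite /Gam; set M := invmx _.
have -> : v^T *m (M *m M^T) *m v = (M^T *m v)^T *m (M^T *m v) by rewrite trmx_mul trmxK !mulmxA.
apply: dot_gt0; apply: contra vn0 => /eqP Mv.
have uMt : M^T \in unitmx by rewrite unitmx_tr unitmx_inv.
by rewrite -[v](mulKmx uMt) Mv mulmx0.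
Qed.

(** * Local existence for the closed loop *)

Section local_flow.
Variables (R : realType) (n nu : nat) (f : 'cV[R]_n -> R -> 'cV[R]_n) (h : 'cV[R]_n -> R -> R).
Variables (X : set 'cV[R]_n) (U : set 'cV[R]_nu) (phi : 'cV[R]_(n + nu) -> R).
Variables (D : set 'cV[R]_(n + nu)) (V : 'cV[R]_(n + nu) -> R) (F : 'cV[R]_(n + nu) -> 'cV[R]_(n + nu)).
Variables (a : \bar R) (alpha1 alpha2 alpha3 : R -> R) (c2 : R).
Variables (C : 'cV[R]_nu -> set 'cV[R]_n) (b : 'cV[R]_n -> 'cV[R]_nu -> R).
Variables (L : 'cV[R]_n) (S : 'M[R]_n) (rho : R).
Let H := obs_map (nu := nu) f h.
Let Om := sublevel D V c2.
Let Ox := [set usubmx chi | chi in Om].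
Let Oz := [set dsubmx chi | chi in Om].
Hypothesis n0 : (0 < n)%N.
Hypothesis sf : smooth (fun p : ('cV[R]_n * R)%type => f p.1 p.2).
Hypothesis sh : smooth (fun p : ('cV[R]_n * R)%type => h p.1 p.2).
Hypothesis sphi : smooth phi.
Hypothesis obsH : observable H X U.
Hypothesis lyap : lyapunov_function F D V a alpha1 alpha2 alpha3.
Hypothesis Om0 : Om 0.
Hypothesis adm : admissible_sets H X U Ox Oz C.
Hypothesis bf : boundary_function Oz C b.
Hypothesis uS : S \in unitmx.
Hypothesis rho0 : 0 < rho.

Notation St := 'cV[R]_(n + nu + n).
Notation zz s := (dsubmx (usubmx s)).
Notation xh s := (dsubmx s).
Let Br := branch f h X D V c2 C.
Let K := closed_loop_states (nu := nu) f h C.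
Let G := closed_loop f h phi L S b rho.
Let F0 := free_field f h phi L rho.
Let B := level f h b (nu := nu).
Let kr := rate f h phi L rho b.
Let pu := push f h S rho b.

Definition good (c : R) : set St := [set s | Br s /\ V (usubmx s) <= c].

Lemma V_cont chi : D chi -> {for chi, continuous V}.
Proof. by have [[_ C1V] _ _ _ _] := lyap => Dc; apply: differentiable_continuous; exact: (C1V _ Dc).1. Qed.

Lemma good_compact c : compact (good c).
Proof.
have cB : compact Br := branch_compact sf sh obsH lyap Om0 adm bf.
apply: (subclosed_compact _ cB); last by move=> s [].
move=> p clp.
have Bp : Br p.
  have clB : closed Br by apply: compact_closed => //; exact: norm_hausdorff.
  by apply: clB => N /clp[q [[Bq _] Nq]]; exists q.
split => //; have [[Dp _] _ _] := Bp.
have cV : {for p, continuous (fun s : St => V (usubmx s))}.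
  apply: (@continuous_comp _ _ _ (fun s : St => usubmx s) V); first exact: usubmx_continuous.
  exact: V_cont.
apply/ler_addgt0Pr => e e0; move/cvgrPdist_lt: cV => /(_ e e0) /clp[q [[_ Vq] /=]].
by rewrite ltr_norml => /andP[? ?]; lra.
Qed.

Lemma branch_unit s : Br s -> Hx f h s \in unitmx.
Proof.
move=> [Os Xs _]; have [_ _] := obsH; apply => //.
have [_ _] := adm; apply; exact: Om_zz Os.
Qed.

Lemma branch_level s : Br s -> B s <= 0.
Proof. by move=> [Os _ Cs]; apply: (CE bf _ (Om_zz Os)).1 Cs. Qed.

Lemma near_Om (s : St) : D (usubmx s) -> V (usubmx s) < c2 -> \forall p \near s, Om (usubmx (p : St)).
Proof.
move=> Ds Vs; have [[oD _] _ _ _ _] := lyap.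
have nD : nbhs (usubmx s) D by apply: open_nbhs_nbhs; split.
have nV : nbhs (usubmx s) [set q | V q < c2].
  have e0 : 0 < c2 - V (usubmx s) by rewrite subr_gt0.
  have /cvgrPdist_lt /(_ _ e0) := V_cont Ds; apply: filterS => q /=.
  by rewrite ltr_norml => /andP[? ?]; lra.
have : nbhs s ((fun s : St => usubmx s) @^-1` (D `&` [set q | V q < c2])).
  by apply: usubmx_continuous; exact: filterI.
by apply: filterS => p [Dp Vp]; split => //; exact: ltW.
Qed.

Lemma near_bounded (W : normedModType R) (g : St -> W) (s : St) : {for s, continuous g} ->
  \forall p \near s, `|g p| <= `|g s| + 1.
Proof.
move=> /cvgrPdist_le /(_ 1 ltr01); apply: filterS => p h1.
rewrite -[g p](subrK (g s)) addrC; apply: le_trans (ler_normD _ _) _.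
by rewrite lerD2l distrC.
Qed.

(* At an interior point any B' with B' < 0 nearby does: the reflection is then
   inactive. *)
Lemma local_data s0 : Br s0 -> V (usubmx s0) < c2 ->
  exists (r M : R) (B' k' : St -> R) (pu' : St -> St), [/\ 0 < r, 0 < M &
    forall p, `|p - s0| <= r ->
    [/\ [/\ {for p, continuous F0}, {for p, continuous pu'}, {for p, continuous k'} & differentiable B' p],
        [/\ `|F0 p| + `|k' p| * `|pu' p| <= M, 'D_(F0 p) B' p = k' p & 'D_(pu' p) B' p = 1],
        B' p <= 0 -> K p /\ G p = reflected F0 pu' B' k' p & Br p -> B' p <= 0]].
Proof.
move=> Bs Vs; have [[Ds _] Xs Cs] := Bs.
have uH := branch_unit Bs.
have nOm := near_Om Ds Vs.
have bC1 := bf.1.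
have nH : \forall p \near s0, Hx f h p \in unitmx.
  have det0 : \det (Hx f h s0) != 0 by move: uH; rewrite unitmxE unitfE.
  have d0 : 0 < `|\det (Hx f h s0)| by rewrite normr_gt0.
  have := cont_det (@contmx_Hx _ _ nu _ _ sf sh s0); move=> /cvgrPdist_lt /(_ _ d0); apply: filterS => u.
  by rewrite unitmxE unitfE; apply: contraTneq => ->; rewrite subr0 ltxx.
have cF : {for s0, continuous F0} by exact: cont_free.
have nF := near_bounded cF.
have Klev p : Om (usubmx p) -> B p <= 0 -> K p.
  by move=> Op Bp; apply: (CE bf _ (Om_zz Op)).2.
(* The normal is known to be nonzero on the boundary only, and [push] is continuous near such
   points. Inside it may be singular, so an artificial level and direction replace it. *)
have := branch_level Bs; rewrite le_eqVlt => /orP[/eqP Bs0|Bneg].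
  have Nn0 : nrm f h b s0 != 0.
    have [Os _ _] := Bs; have [_ _ H3] := bf.2 _ (Om_zz Os); exact: H3.
  have g0 : gnn f h S rho b s0 != 0 by rewrite gt_eqF // Gam_pos // gt_eqF.
  have cg : {for s0, continuous (gnn f h S rho b (nu := nu))} by exact: cont_gnn.
  have ng : \forall p \near s0, gnn f h S rho b p != 0.
    have d0 : 0 < `|gnn f h S rho b s0| by rewrite normr_gt0.
    move: cg => /cvgrPdist_lt /(_ _ d0); apply: filterS => u.
    by apply: contraTneq => ->; rewrite subr0 ltxx.
  have nk := near_bounded (@cont_rate _ _ _ _ _ _ L rho _ sf sh sphi bC1 s0 uH).
  have np := near_bounded (@cont_push _ _ _ _ _ S rho _ sf sh bC1 s0 uH g0).
  have /nbhs_ballP[e /= e0 He] : \forall p \near s0, (Om (usubmx p) /\ Hx f h p \in unitmx) /\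
      ((`|F0 p| <= `|F0 s0| + 1 /\ gnn f h S rho b p != 0) /\
      (`|kr p| <= `|kr s0| + 1 /\ `|pu p| <= `|pu s0| + 1)).
    near=> p; split; first by split; near: p; [exact: nOm | exact: nH].
    by split; split; near: p; [exact: nF | exact: ng | exact: nk | exact: np].
  pose M := (`|F0 s0| + 1) + (`|kr s0| + 1) * (`|pu s0| + 1).
  exists (e / 2), M, B, kr, pu; split; first by rewrite divr_gt0.
    by rewrite /M addr_gt0 ?mulr_gt0 // ltr_wpDl.
  move=> p pe; have [] := He p.
    rewrite -ball_normE /= distrC; apply: le_lt_trans pe _.
    by rewrite ltr_pdivrMr // mulr_natr mulr2n ltrDl.
  move=> [Op uHp] [[bF gp] [bk bp]]; split.
  - split; [exact: cont_free|exact: cont_push|exact: cont_rate|exact: diff_level].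
  - split; [|exact: derive_level_free|exact: derive_level_push].
    by apply: lerD => //; apply: ler_pM.
  - by move=> Bp; split; [exact: Klev|exact: closed_loop_reflected].
  - exact: branch_level.
have cB : {for s0, continuous B} by apply: differentiable_continuous; exact: diff_level.
have nB : \forall p \near s0, B p < 0.
  have d0 : 0 < - B s0 by rewrite oppr_gt0.
  move: cB => /cvgrPdist_lt /(_ _ d0); apply: filterS => u.
  by rewrite ltr_norml => /andP[? ?]; lra.
have /nbhs_ballP[e /= e0 He] : \forall p \near s0, (Om (usubmx p) /\ Hx f h p \in unitmx) /\
    (`|F0 p| <= `|F0 s0| + 1 /\ B p < 0).
  near=> p; split; first by split; near: p; [exact: nOm | exact: nH].
  by split; near: p; [exact: nF | exact: nB].
pose r := e / 2.
have r0 : 0 < r by rewrite divr_gt0.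
pose i0 : 'I_(n + nu + n) := rshift (n + nu) (Ordinal n0).
(* Affine, with derivative 1 along the i0-th basis vector, and at most [- r] on the ball of radius
   r. *)
pose B' (p : St) := p i0 0 + (- s0 i0 0 - 2 * r).
pose k' (p : St) := F0 p i0 0.
exists r, ((`|F0 s0| + 1) + (`|F0 s0| + 1) * (`|delta_mx i0 0 : St| + 1)), B', k', (fun=> delta_mx i0 0).
split; [exact: r0 | by rewrite addr_gt0 ?mulr_gt0 // ltr_wpDl |].
have B'neg p : `|p - s0| <= r -> B' p < 0.
  move=> pr; have := (cV_norm_le _ (ltW r0)).1 pr i0; rewrite !mxE ler_norml => /andP[_].
  by rewrite /B'; lra.
have dB' p : differentiable B' p.
  apply: differentiableD; [exact: differentiable_coord|exact: differentiable_cst].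
have DB' p w : 'D_w B' p = w i0 0.
  have -> : B' = (fun p : St => p i0 0) + cst (- s0 i0 0 - 2 * r) by [].
  rewrite deriveD; last first.
  - exact: derivable_cst.
  - by apply: diff_derivable; exact: differentiable_coord.
  by rewrite derive_cst addr0 derive_coord.
move=> p pr; have [] := He p.
  rewrite -ball_normE /= distrC; apply: le_lt_trans pr _.
  by rewrite ltr_pdivrMr // mulr_natr mulr2n ltrDl.
move=> [Op uHp] [bF Bp]; split.
- split; [exact: cont_free|exact: continuous_cst_at| |exact: dB'].
  apply: (@continuous_comp _ _ _ F0 (fun v : St => v i0 0)); first exact: cont_free.
  exact: coord_continuous.
- split; [|by rewrite DB'|by rewrite DB' mxE !eqxx].
  apply: lerD => //; apply: ler_pM => //; last by rewrite lerDl.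
  by apply: le_trans (cV_coord_le _ _) _.
- move=> _; split; first by apply: Klev => //; exact: ltW.
  rewrite /G closed_loop_reflected // /reflected (lt_eqF (B'neg p pr)) andbF.
  by rewrite (lt_eqF Bp) andbF.
- by move=> _; exact: ltW (B'neg p pr).
Unshelve. all: by end_near. Qed.

(** The lifetime is uniform by compactness. The strict bound c < c2 leaves room: near a point of
    [good c], chi stays in Omega c2 by itself, so only the level set of b constrains the motion. *)
Lemma local_existence c : c < c2 -> exists2 tau : R, 0 < tau &
  forall s (T : R), good c s -> exists y, y T = s /\ sol_on K G T (T + tau) y.
Proof.
move=> cc2.
pose P (r : R) (s : St) := forall T : R, exists y, y T = s /\ sol_on K G T (T + r) y.
have mono (r r' : R) x : 0 < r' -> r' <= r -> P r x -> P r' x.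
  move=> _ r'r HP T; have [y [yT sy]] := HP T; exists y; split => // t tT tr.
  by apply: sy => //; apply: le_trans tr _; rewrite lerD2l.
have [|r r0 Hr] := compact_unif (@good_compact c) mono.
  move=> s0 [Bs Vs]; have [r [M [B' [k' [pu' [r0 M0 HB]]]]]] := local_data Bs (le_lt_trans Vs cc2).
  have r20 : 0 < r / 2 by rewrite divr_gt0.
  (* One half of the radius is spent on moving the initial point, the other is the radius given to
     [reflected_sol]. *)
  exists (Num.min (r / 2) (r / 2 / M)); first by rewrite lt_min r20 divr_gt0.
  move=> s [Bs' _]; rewrite lt_min => /andP[ss _].
  have inb p : `|p - s| <= r / 2 -> `|p - s0| <= r.
    move=> ps; rewrite -[p](subrK s) -addrA (splitr r); apply: le_trans (ler_normD _ _) _.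
    by apply: lerD => //; exact: ltW.
  apply: (mono (r / 2 / M)).
  - by rewrite lt_min r20 divr_gt0.
  - by rewrite ge_min lexx orbT.
  apply: (@reflected_sol R _ F0 pu' B' k' s (r / 2) M K G) => //.
  - by move=> p /inb /HB[h1 h2 _ _].
  - by have [_ _ _] := HB s (inb s ltac:(by rewrite subrr normr0 ltW)); apply.
  - by move=> p /inb /HB[_ _ h3 _].
by exists r => // s T gs; exact: Hr.
Qed.

End local_flow.

(** * Error of the observer *)

Definition Bcol (R : realType) (n : nat) : 'cV[R]_n := \col_i (i.+1 == n)%:R.

(** Consecutive weights differ by a factor rho, so the shift picks up 1 / rho. In the injection term
    [E'rho n rho *m invmx (Erho n rho)] is rho^-n times the identity while the first weight is
    rho^-(n-1), which leaves the same factor. *)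
Lemma E'_conj (R : realType) (n : nat) (rho : R) (L : 'cV[R]_n) : rho != 0 ->
  E'rho n rho *m (Ac R n - invmx (Erho n rho) *m L *m Cc R n) =
  rho^-1 *: ((Ac R n - L *m Cc R n) *m E'rho n rho).
Proof.
move=> r0.
have invE : invmx (Erho n rho) = diag_mx (\row_i rho ^- i.+1).
  have uE : Erho n rho \in unitmx by exact: Erho_unit.
  apply: (can_inj (mulKmx uE)); rewrite mulmxV // /Erho mulmx_diag -diag_const_mx.
  congr diag_mx; apply/rowP => i; rewrite !mxE divff // expf_neq0 //.
rewrite mulmxBr mulmxBl scalerBr invE; congr (_ - _).
  apply/matrixP => i j; rewrite /E'rho mul_diag_mx mul_mx_diag !mxE.
  case: (altP (j =P i.+1 :> nat)) => [ji|_]; last by rewrite mulr0 mul0r mulr0.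
  have := ltn_ord j; rewrite mulr1 mul1r ji => jn.
  by rewrite -subnSK // exprS invfM.
rewrite !mulmxA /E'rho mulmx_diag; apply/matrixP => i j.
rewrite -mulmxA mul_diag_mx mul_mx_diag !mxE !big_ord1 !mxE.
case: (altP (j =P 0%N :> nat)) => [j0|_]; last by rewrite !(mulr0, mul0r).
have ni : (n - i.+1 + i.+1)%N = (n - 1).+1 by have := ltn_ord i; rewrite subnK // subn1 => ni; rewrite prednK // (leq_trans _ ni).
by rewrite j0 !mulr1 mulrCA mulrC -invfM -exprD -invfM -exprS ni.
Qed.

(** The last weight is 1: the nonlinearity, which enters through the last coordinate, is not
    amplified by the scaling. *)
Lemma E'_Bcol (R : realType) (n : nat) (rho : R) : E'rho n rho *m Bcol R n = Bcol R n.
Proof.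
apply/colP => i; rewrite /E'rho mul_diag_mx !mxE.
case: eqP => [->|_]; last by rewrite mulr0.
by rewrite subnn expr0 invr1 mulr1.
Qed.

Lemma E'_ge (R : realType) (n : nat) (rho : R) (v : 'cV[R]_n) : 0 < rho -> rho <= 1 ->
  `|v| <= `|E'rho n rho *m v|.
Proof.
move=> r0 r1; apply/cV_norm_le => // i; apply: le_trans (cV_coord_le _ i).
rewrite /E'rho mul_diag_mx !mxE normrM ler_peMl // normfV normrX (gtr0_norm r0).
by rewrite invf_ge1 ?exprn_gt0 // exprn_ile1 // ltW.
Qed.

Lemma E'_le (R : realType) (n : nat) (rho : R) (v : 'cV[R]_n) : 0 < rho -> rho <= 1 ->
  `|E'rho n rho *m v| <= rho ^- n * `|v|.
Proof.
move=> r0 r1; apply/cV_norm_le => [|i]; first by rewrite mulr_ge0 // invr_ge0 exprn_ge0 // ltW.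
rewrite /E'rho mul_diag_mx !mxE normrM normfV normrX (gtr0_norm r0).
apply: ler_pM; [by rewrite invr_ge0 exprn_ge0 // ltW|exact: normr_ge0| |exact: cV_coord_le].
by rewrite lef_pV2 ?posrE ?exprn_gt0 // ler_wiXn2l ?(ltW r0) // leq_subr.
Qed.

Section quadratic.
Variables (R : realType) (n : nat) (A P S : 'M[R]_n).
Hypothesis lyapE : P *m A + A^T *m P = - 1%:M.
Hypothesis ST : S^T = S.
Hypothesis SS : S *m S = P.

(** A vector v annihilated by S is annihilated by P, and the Lyapunov equation evaluated at v reads
    0 = - |v|^2. *)
Lemma lyap_S_unit : S \in unitmx.
Proof.
rewrite -unitmx_tr ST -row_free_unit -kermx_eq0; apply/rowV0P => v /sub_kermxP vS.
apply/eqP; rewrite -[v]trmxK; apply/eqP; rewrite -[RHS]trmx0; congr trmx.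
apply/eqP; apply: contraT => vn0.
have := dot_gt0 vn0; rewrite trmxK.
suff -> : v *m v^T = 0 by rewrite mxE ltxx.
have vP : v *m P = 0 by rewrite -SS mulmxA vS mul0mx.
have Pv : P *m v^T = 0.
  have PT : P^T = P by rewrite -SS trmx_mul ST.
  by rewrite -PT -trmx_mul vP trmx0.
have : v *m (P *m A + A^T *m P) *m v^T = 0.
  by rewrite mulmxDr mulmxDl mulmxA vP mul0mx mul0mx add0r mulmxA -mulmxA Pv mulmx0.
by rewrite lyapE mulmxN mulmx1 mulNmx => /eqP; rewrite oppr_eq0 => /eqP.
Qed.

Lemma lyap_quad (v : 'cV[R]_n) : 2 * ((S *m v)^T *m (S *m (A *m v))) 0 0 = - (v^T *m v) 0 0.
Proof.
have E1 : (S *m v)^T *m (S *m (A *m v)) = v^T *m (P *m A) *m v.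
  by rewrite trmx_mul ST -SS !mulmxA.
have E2 : v^T *m (A^T *m P) *m v = (v^T *m (P *m A) *m v)^T.
  by rewrite !trmx_mul trmxK -SS trmx_mul ST !mulmxA.
rewrite E1.
have : (v^T *m (P *m A + A^T *m P) *m v) 0 0 = - (v^T *m v) 0 0.
  by rewrite lyapE mulmxN mulmx1 mulNmx mxE.
rewrite mulmxDr mulmxDl E2; move: (v^T *m (P *m A) *m v) => Q.
by rewrite [LHS]mxE [X in _ + X]mxE mulr_natl mulr2n => ->.
Qed.

End quadratic.

Lemma derive_mulmx (R : realType) (W : normedModType R) (m p : nat) (M : 'M[R]_(p, m))
    (g : W -> 'cV[R]_m) (x w : W) (i : 'I_p) :
  (forall j, differentiable (fun s => g s j 0) x) ->
  'D_w (fun s => (M *m g s) i 0) x = (M *m \col_j 'D_w (fun s => g s j 0) x) i 0.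
Proof.
move=> dg; rewrite (_ : (fun s => _) = \sum_j (M i j \*: (fun s => g s j 0))); last first.
  by apply/funext => s; rewrite mxE fct_sumE.
rewrite derive_sum; last by move=> j; apply: derivableZ; exact: diff_derivable.
rewrite mxE; apply: eq_bigr => j _; rewrite deriveZ ?mxE //; exact: diff_derivable.
Qed.

Lemma differentiable_mulmx (R : realType) (W : normedModType R) (m p : nat) (M : 'M[R]_(p, m))
    (g : W -> 'cV[R]_m) (x : W) (i : 'I_p) :
  (forall j, differentiable (fun s => g s j 0) x) -> differentiable (fun s => (M *m g s) i 0) x.
Proof.
move=> dg; rewrite (_ : (fun s => _) = \sum_j (M i j \*: (fun s => g s j 0))); last first.
  by apply/funext => s; rewrite mxE fct_sumE.
by apply: differentiable_sum => j; exact: differentiableZ.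
Qed.

Lemma derive_dot (R : realType) (W : normedModType R) (m : nat) (g : W -> 'cV[R]_m) (x w : W) :
  (forall j, differentiable (fun s => g s j 0) x) ->
  'D_w (fun s => ((g s)^T *m g s) 0 0) x = 2 * ((g x)^T *m \col_j 'D_w (fun s => g s j 0) x) 0 0.
Proof.
move=> dg; rewrite (_ : (fun s => _) = \sum_j ((fun s => g s j 0) * (fun s => g s j 0))); last first.
  by apply/funext => s; rewrite mxE fct_sumE; apply: eq_bigr => j _; rewrite mxE.
rewrite derive_sum; last by move=> j; apply: derivableM; exact: diff_derivable.
rewrite mxE mulr_sumr; apply: eq_bigr => j _; rewrite deriveM; try exact: diff_derivable.
by rewrite !mxE /GRing.scale /=; ring.
Qed.

Lemma dot_le (R : realType) (m : nat) (u v : 'cV[R]_m) :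
  `|(u^T *m v) 0 0| <= m%:R * (`|u| * `|v|).
Proof.
rewrite mxE; apply: le_trans (ler_norm_sum _ _ _) _.
have -> : m%:R * (`|u| * `|v|) = \sum_(i < m) (`|u| * `|v|) by rewrite sumr_const card_ord mulr_natl.
apply: ler_sum => i _.
by rewrite mxE normrM; apply: ler_pM => //; exact: cV_coord_le.
Qed.

Lemma Ac_mulE (R : realType) (n : nat) (v : 'cV[R]_n) (i : 'I_n) (hi : (i.+1 < n)%N) :
  (Ac R n *m v) i 0 = v (Ordinal hi) 0.
Proof.
rewrite mxE (bigD1 (Ordinal hi)) //= mxE eqxx mul1r big1 ?addr0 // => j ne.
rewrite mxE (_ : (j == i.+1 :> nat) = false) ?mul0r //.
by apply/negbTE; apply: contraNneq ne => ji; apply/eqP/val_inj.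
Qed.

Lemma Ac_mul_last (R : realType) (n : nat) (v : 'cV[R]_n) (i : 'I_n) : i.+1 = n ->
  (Ac R n *m v) i 0 = 0.
Proof.
move=> hi; rewrite mxE big1 // => j _; rewrite mxE (_ : (j == i.+1 :> nat) = false) ?mul0r //.
by rewrite hi; apply/negbTE; rewrite neq_ltn ltn_ord.
Qed.

Lemma Cc_mul (R : realType) (n : nat) (n0 : (0 < n)%N) (v : 'cV[R]_n) :
  (Cc R n *m v) 0 0 = v (Ordinal n0) 0.
Proof.
rewrite mxE (bigD1 (Ordinal n0)) //= mxE eqxx mul1r big1 ?addr0 // => j ne.
rewrite mxE (_ : (j == 0 :> nat) = false) ?mul0r //.
by apply/negbTE; apply: contraNneq ne => ji; apply/eqP/val_inj.
Qed.

(** If g had a positive derivative at x towards y, it would be positive just after x on the segment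
    to y, which lies in A. *)
Lemma convex_level_normal (R : realType) (n : nat) (A : set 'cV[R]_n) (g : 'cV[R]_n -> R) (x y : 'cV[R]_n) :
  @convex_set R 'cV[R]_n A -> A = [set xi | g xi <= 0] -> differentiable g x ->
  g x = 0 -> A y -> 0 <= ((x - y)^T *m grad g x) 0 0.
Proof.
move=> cA AE dg gx Ay.
have Ax : A x by rewrite AE /= gx.
have -> : ((x - y)^T *m grad g x) 0 0 = - 'D_(y - x) g x.
  rewrite -grad_mulE // -opprB linearN /= mulNmx mxE; congr (- _).
  by rewrite !mxE; apply: eq_bigr => i _; rewrite !mxE mulrC.
rewrite oppr_ge0 leNgt; apply/negP => Dpos; set d := 'D_(y - x) g x in Dpos.
pose e := d / 2 / (`|y - x| + 1).
have w0 : 0 < `|y - x| + 1 by rewrite ltr_wpDl.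
have e0 : 0 < e by rewrite !divr_gt0.
have [r r0 Hr] := diff_eps dg e0.
pose t := Num.min 1 (r / 2 / (`|y - x| + 1)).
have t0 : 0 < t by rewrite lt_min ltr01 !divr_gt0.
have t1 : t <= 1 by rewrite ge_min lexx.
have tr : t * `|y - x| < r.
  apply: (@le_lt_trans _ _ (r / 2 / (`|y - x| + 1) * (`|y - x| + 1))).
    by apply: ler_pM; rewrite ?(ltW t0) ?lerDl // ge_min lexx orbT.
  by rewrite divfK ?gt_eqF // ltr_pdivrMr // mulr_natr mulr2n ltrDl.
have xt : t *: (y - x) + x - x = t *: (y - x) by rewrite addrK.
have := Hr (t *: (y - x) + x); rewrite xt normrZ gtr0_norm // => /(_ tr).
have Axt : A (t *: (y - x) + x).
  have := cA y x (Itv01 (ltW t0) t1); rewrite !inE => /(_ Ay Ax).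
  suff -> : conv (Itv01 (ltW t0) t1) (y : convex_lmodType 'cV[R]_n) x = t *: (y - x) + x by [].
  transitivity (t *: y + (1 - t) *: x); first by [].
  by apply/colP => i; rewrite !mxE; ring.
have gxt : g (t *: (y - x) + x) <= 0 by move: Axt; rewrite {1}AE.
rewrite gx subr0 linearZ /= -deriveE // -/d /GRing.scale /= ler_norml => /andP[h1 _].
have h2 : t * d <= e * (t * `|y - x|) by lra.
have : t * d <= t * (d / 2).
  apply: le_trans h2 _; rewrite mulrCA ler_pM2l // /e mulrAC ler_pdivrMr // ler_pM2l ?divr_gt0 // lerDl //.
by rewrite ler_pM2l //; lra.
Qed.

(** * Error equation in the observability coordinates *)

Section error_dynamics.
Variables (R : realType) (n nu : nat) (f : 'cV[R]_n -> R -> 'cV[R]_n) (h : 'cV[R]_n -> R -> R).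
Variables (phi : 'cV[R]_(n + nu) -> R) (L : 'cV[R]_n) (S : 'M[R]_n) (rho : R).
Variable (b : 'cV[R]_n -> 'cV[R]_nu -> R).
Hypothesis n0 : (0 < n)%N.
Hypothesis sf : smooth (fun p : ('cV[R]_n * R)%type => f p.1 p.2).
Hypothesis sh : smooth (fun p : ('cV[R]_n * R)%type => h p.1 p.2).
Hypothesis sphi : smooth phi.
Hypothesis dep : depends_on_first f h nu.
Let H := obs_map (nu := nu) f h.
Notation St := 'cV[R]_(n + nu + n).
Notation zz s := (dsubmx (usubmx s)).
Notation xx s := (usubmx (usubmx s)).
Notation xh s := (dsubmx s).

(** By [obs_derivative] each coordinate of H has the next one as derivative; v does not enter these,
    so the chain may end with 0 instead of v. Only the n-th derivative leaves the linear form. *)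
Lemma obs_map_drift (x : 'cV[R]_n) (z : 'cV[R]_nu) (v : R) (i : 'I_n) :
  'D_(col_mx (f x (chain z v 0)) (zdot z v)) (fun q : 'cV[R]_(n + nu) => H (usubmx q) (dsubmx q) i 0) (col_mx x z)
  = (Ac R n *m H x z) i 0 + obs_coord f h n x (chain z v) * Bcol R n i 0.
Proof.
rewrite (_ : (fun q => _) = fun q : 'cV[R]_(n + nu) => obs_coord f h i (usubmx q) (chain (dsubmx q) 0)); last first.
  by apply/funext => q; rewrite mxE.
rewrite obs_derivative // [in X in _ = _ + X]mxE.
have [hi|hi] := ltnP i.+1 n.
  rewrite (Ac_mulE _ hi) [in X in _ = X + _]mxE (ltn_eqF hi) mulr0 addr0 /=.
  by apply: (@dep i.+1 x (chain z v) (chain z 0) hi) => k kn; rewrite !(chain_lt _ _ kn).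
have hi' : i.+1 = n by apply/anti_leq; rewrite hi ltn_ord.
by rewrite Ac_mul_last // add0r hi' eqxx mulr1.
Qed.

Definition err (s : St) : 'cV[R]_n := H (xh s) (zz s) - H (xx s) (zz s).
(** The only nonlinear term of the error equation without projection. Both values use the same input
    v, which observer and plant share. *)
Definition top_gap (s : St) : R :=
  obs_coord f h n (xh s) (chain (zz s) (vin phi s)) - obs_coord f h n (xx s) (chain (zz s) (vin phi s)).

Lemma ck_Hxx k i : ck k (fun s : St => H (xx s) (zz s) i 0).
Proof. by apply: ck_obs_map => // j; [exact: ck_xx|exact: ck_zz]. Qed.

Lemma diff_err i s : differentiable (fun s => err s i 0) s.
Proof.
rewrite (_ : (fun s => _) = (fun s => xih f h s i 0) - (fun s : St => H (xx s) (zz s) i 0)); last first.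
  by apply/funext => t; rewrite /err cV_subE.
apply: differentiableB; [exact: (@ck_diff _ _ _ 0 _ _ (ck_xih nu sf sh 0 i))|exact: (@ck_diff _ _ _ 0 _ _ (ck_Hxx 0 i))].
Qed.

Lemma derive_err s w i : 'D_w (fun s => err s i 0) s = (Hx f h s *m xh w + Hz f h s *m zz w) i 0
  - 'D_(usubmx w) (fun q : 'cV[R]_(n + nu) => H (usubmx q) (dsubmx q) i 0) (usubmx s).
Proof.
rewrite (_ : (fun s => _) = (fun s => xih f h s i 0) - (fun s : St => H (xx s) (zz s) i 0)); last first.
  by apply/funext => t; rewrite /err cV_subE.
rewrite deriveB; last first.
- by apply: diff_derivable; exact: (@ck_diff _ _ _ 0 _ _ (ck_Hxx 0 i)).
- by apply: diff_derivable; exact: (@ck_diff _ _ _ 0 _ _ (ck_xih nu sf sh 0 i)).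
have E : 'D_w (fun s : St => H (xx s) (zz s) i 0) s =
    'D_(usubmx w) (fun q : 'cV[R]_(n + nu) => H (usubmx q) (dsubmx q) i 0) (usubmx s).
  by apply: derive_line => t; rewrite linearD linearZ.
by rewrite E derive_xih.
Qed.

Lemma derive_err_free s i : Hx f h s \in unitmx ->
  'D_(free_field f h phi L rho s) (fun s => err s i 0) s =
  ((Ac R n - invmx (Erho n rho) *m L *m Cc R n) *m err s) i 0 + top_gap s * Bcol R n i 0.
Proof.
move=> uH; rewrite derive_err /free_field col_mxKd col_mxKu.
have -> : 'D_(ext_field f (usubmx s) (vin phi s)) (fun q : 'cV[R]_(n + nu) => H (usubmx q) (dsubmx q) i 0) (usubmx s)
  = (Ac R n *m H (xx s) (zz s)) i 0 + obs_coord f h n (xx s) (chain (zz s) (vin phi s)) * Bcol R n i 0.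
  by have := obs_map_drift (xx s) (zz s) (vin phi s) i; rewrite vsubmxK.
(* The first coordinate of H is the output. When nu = 0 the loop feeds v to h whereas [obs_map]
   feeds 0; [dep] identifies the two values. *)
have Cerr : Cc R n *m err s = const_mx (h (xh s) (chain (zz s) (vin phi s) 0) - h (xx s) (chain (zz s) (vin phi s) 0)).
  apply/matrixP => k l; rewrite !ord1 (Cc_mul n0) /err cV_subE [RHS]mxE.
  by congr (_ - _); rewrite mxE; apply: (@dep 0%N _ (chain (zz s) 0) (chain (zz s) (vin phi s)) n0) => j jn; rewrite !(chain_lt _ _ jn).
have -> : Hx f h s *m ofield f h phi L rho s + Hz f h s *m dsubmx (ext_field f (usubmx s) (vin phi s))
  = (Hx f h s *m f (xh s) (chain (zz s) (vin phi s) 0) + Hz f h s *m zdot (zz s) (vin phi s))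
    - invmx (Erho n rho) *m L *m (Cc R n *m err s).
  have E2 : Hx f h s *m (invmx (Hx f h s) *m invmx (Erho n rho) *m L) = invmx (Erho n rho) *m L.
    by rewrite !mulmxA mulmxV // mul1mx.
  rewrite /ext_field col_mxKd /ofield /observer_field mulmxDr -scalemxAr -/(Hx f h s) E2.
  rewrite Cerr addrAC; congr (_ + _); rewrite /ext_output -opprB scaleNr; congr (- _).
  apply/matrixP => k l; rewrite [RHS]mxE big_ord1 [X in _ = _ * X]mxE [LHS]mxE !ord1 mulrC.
  by [].
rewrite [X in X - _ = _]cV_subE HxzE // obs_map_drift /top_gap mulmxBl [X in _ = X + _]cV_subE !mulmxA.
have -> : (Ac R n *m err s) i 0 = (Ac R n *m H (xh s) (zz s)) i 0 - (Ac R n *m H (xx s) (zz s)) i 0.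
  by rewrite /err mulmxBr cV_subE.
ring.
Qed.

Lemma derive_err_push s i : Hx f h s \in unitmx ->
  'D_(push f h S rho b s) (fun s => err s i 0) s = (gnn f h S rho b s)^-1 * (Gam S rho *m nrm f h b s) i 0.
Proof.
move=> uH; rewrite derive_err /push col_mxKd col_mxKu.
have -> : 'D_(0 : 'cV[R]_(n + nu)) (fun q : 'cV[R]_(n + nu) => H (usubmx q) (dsubmx q) i 0) (usubmx s) = 0.
  by rewrite deriveE ?linear0 //; exact: (@ck_diff _ _ _ 0 _ _ (H_ck nu sf sh 0 i)).
by rewrite linear0 mulmx0 addr0 subr0 -scalemxAr mulKVmx // mxE.
Qed.

Definition push_gain (s : St) : R :=
  if (0 <= rate f h phi L rho b s) && (level f h b s == 0)
  then rate f h phi L rho b s / gnn f h S rho b s else 0.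

Lemma derive_err_loop s : Hx f h s \in unitmx ->
  (\col_i 'D_(closed_loop f h phi L S b rho s) (fun s => err s i 0) s) =
  (Ac R n - invmx (Erho n rho) *m L *m Cc R n) *m err s + top_gap s *: Bcol R n
  - push_gain s *: (Gam S rho *m nrm f h b s).
Proof.
move=> uH; apply/colP => i; rewrite [LHS]mxE closed_loop_reflected // /reflected /push_gain.
rewrite cV_subE [X in _ = X - _]mxE [X in _ = _ + X - _]mxE [X in _ = _ - X]mxE.
case: ifP => _; last by rewrite derive_err_free // mul0r subr0.
rewrite derive_comb; last exact: diff_err.
by rewrite derive_err_free // derive_err_push // mulrA.
Qed.

Definition err_energy (s : St) : R :=
  ((S *m E'rho n rho *m err s)^T *m (S *m E'rho n rho *m err s)) 0 0.

Lemma ck_err k i : ck k (fun s => err s i 0).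
Proof.
rewrite (_ : (fun s => _) = (fun s => xih f h s i 0 + -1 * H (xx s) (zz s) i 0)); last first.
  by apply/funext => t; rewrite /err cV_subE mulN1r.
by apply: ckD; [exact: ck_xih|apply: ckM; [exact: ck_cst|exact: ck_Hxx]].
Qed.

Lemma ck_err_energy k : ck k err_energy.
Proof.
pose u s j := \sum_i (S *m E'rho n rho) j i * err s i 0.
have cu j : ck k (fun s => u s j).
  by apply: ck_sum => i; apply: ckM; [exact: ck_cst|exact: ck_err].
rewrite /err_energy (_ : (fun s => _) = fun s => \sum_j u s j * u s j).
  by apply: ck_sum => j; apply: ckM; exact: cu.
by apply/funext => t; rewrite mxE; apply: eq_bigr => j _; rewrite [X in X * _]mxE [X in X * _]mxE [X in _ * X]mxE.
Qed.

Lemma derive_err_energy s w : 'D_w err_energy s =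
  2 * ((S *m E'rho n rho *m err s)^T *m (S *m E'rho n rho *m \col_i 'D_w (fun s => err s i 0) s)) 0 0.
Proof.
rewrite /err_energy derive_dot; last first.
  by move=> i; apply: differentiable_mulmx => j; exact: diff_err.
congr (_ * (_ *m _) 0 0); apply/colP => i; rewrite [LHS]mxE derive_mulmx //.
by move=> j; exact: diff_err.
Qed.

End error_dynamics.

Section error_contraction.
Variables (R : realType) (n nu : nat) (f : 'cV[R]_n -> R -> 'cV[R]_n) (h : 'cV[R]_n -> R -> R).
Variables (X : set 'cV[R]_n) (U : set 'cV[R]_nu) (phi : 'cV[R]_(n + nu) -> R).
Variables (D : set 'cV[R]_(n + nu)) (V : 'cV[R]_(n + nu) -> R) (F : 'cV[R]_(n + nu) -> 'cV[R]_(n + nu)).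
Variables (a : \bar R) (alpha1 alpha2 alpha3 : R -> R) (c2 : R).
Variables (C : 'cV[R]_nu -> set 'cV[R]_n) (b : 'cV[R]_n -> 'cV[R]_nu -> R).
Variables (L : 'cV[R]_n) (P S : 'M[R]_n).
Let H := obs_map (nu := nu) f h.
Let Om := sublevel D V c2.
Let Ox := [set usubmx chi | chi in Om].
Let Oz := [set dsubmx chi | chi in Om].
Let A := Ac R n - L *m Cc R n.
Hypothesis n0 : (0 < n)%N.
Hypothesis sf : smooth (fun p : ('cV[R]_n * R)%type => f p.1 p.2).
Hypothesis sh : smooth (fun p : ('cV[R]_n * R)%type => h p.1 p.2).
Hypothesis sphi : smooth phi.
Hypothesis dep : depends_on_first f h nu.
Hypothesis obsH : observable H X U.
Hypothesis lyap : lyapunov_function F D V a alpha1 alpha2 alpha3.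
Hypothesis Om0 : Om 0.
Hypothesis adm : admissible_sets H X U Ox Oz C.
Hypothesis bf : boundary_function Oz C b.
Hypothesis PA : P *m A + A^T *m P = - 1%:M.
Hypothesis ST : S^T = S.
Hypothesis SS : S *m S = P.

Notation St := 'cV[R]_(n + nu + n).
Notation zz s := (dsubmx (usubmx s)).
Notation xx s := (usubmx (usubmx s)).
Notation xh s := (dsubmx s).
Notation er := (err (nu := nu) f h).
Let Br := branch f h X D V c2 C.

Let uS : S \in unitmx := lyap_S_unit PA ST SS.
Let cBr : compact Br := branch_compact sf sh obsH lyap Om0 adm bf.

(** Both terms are values of one C^1 function, on two compact images of the branch, at points that
    differ by xhat - x only; [branch_inv_lipschitz] replaces this difference by the error. *)
Lemma top_gap_bound : exists2 k : R, 0 < k & forall s, Br s -> `|top_gap f h phi s| <= k * `|er s|.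
Proof.
pose g (q : 'cV[R]_(n + nu + n + n)) := obs_coord f h n (dsubmx q) (chain (zz (usubmx q)) (vin phi (usubmx q))).
have ckq k i : ck k (fun q : 'cV[R]_(n + nu + n + n) => usubmx q i 0).
  by apply: ck_usub => j; exact: ck_coordE.
have Cg : C1_on setT g.
  apply: ck_C1; apply: (@obs_comp_ck _ _ _ nu _ _ _ _ (fun q : 'cV[R]_(n + nu + n + n) => dsubmx q)) => //.
  - by move=> i; apply: ck_dsub => j; exact: ck_coordE.
  - by move=> i; apply: ck_dsub => j; apply: ck_usub => l; exact: ckq.
  - apply: (@ck_comp _ _ _ _ (vin phi) (fun q : 'cV[R]_(n + nu + n + n) => usubmx q)); last exact: ckq.
    exact: ck_vin.
pose p1 (s : St) := col_mx s (xh s); pose p2 (s : St) := col_mx s (xx s).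
have cp (w : St -> 'cV[R]_n) : continuous w -> continuous (fun s => col_mx s (w s)).
  move=> cw s; apply/contmx_cV; apply: contmx_col; apply/contmx_cV; [exact: cvg_id|exact: cw].
have c1 : compact (p1 @` Br).
  apply: continuous_compact cBr; apply: continuous_subspaceT; apply: cp; exact: dsubmx_continuous.
have c2' : compact (p2 @` Br).
  apply: continuous_compact cBr; apply: continuous_subspaceT; apply: cp => s.
  by apply: (@continuous_comp _ _ _ (fun s : St => usubmx s) (fun q => usubmx q)); exact: usubmx_continuous.
have [k1 k10 H1] := lipschitz_on_compact Cg (compactU c1 c2').
have [k2 k20 H2] := branch_inv_lipschitz sf sh obsH lyap Om0 adm bf.
exists (k1 * k2); first exact: mulr_gt0.
move=> s Bs.
have -> : top_gap f h phi s = g (p1 s) - g (p2 s) by rewrite /g /p1 /p2 !col_mxKu !col_mxKd.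
apply: le_trans (H1 _ _ _ _) _; [by left; exists s|by right; exists s|].
rewrite -mulrA ler_pM2l //; apply: le_trans (H2 s Bs).
by rewrite /p1 /p2 opp_col_mx add_col_mx subrr; apply: col_mx_le; rewrite ?normr0.
Qed.

Lemma diff_level_fiber z xi : differentiable (b ^~ z) xi.
Proof.
apply: (@differentiable_comp _ _ _ _ (fun x : 'cV[R]_n => (x, z)) (fun p => b p.1 p.2)); last exact: (bf.1 _ I).1.
by apply: differentiable_pair; [exact: ex_diff|exact: differentiable_cst].
Qed.

Lemma push_gain_ge0 rho s : 0 < rho -> Br s -> 0 <= push_gain f h phi L S rho b s.
Proof.
move=> r0 [Os _ _]; rewrite /push_gain; case: ifP => // /andP[k0 /eqP Bs0].
have Nn0 : nrm f h b s != 0 by have [_ _ H3] := bf.2 _ (Om_zz Os); exact: H3.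
by rewrite divr_ge0 // ltW // /gnn Gam_pos // gt_eqF.
Qed.

(** x comes from Omega c2, so [H x z] lies in the convex set C(z), and the outward normal at H(xhat,
    z) makes no obtuse angle with the error. *)
Lemma push_gain_normal rho s : 0 < rho -> Br s ->
  0 <= push_gain f h phi L S rho b s * ((er s)^T *m nrm f h b s) 0 0.
Proof.
move=> r0 Bs; have := push_gain_ge0 r0 Bs; rewrite /push_gain; case: ifP; last by rewrite mul0r.
move=> /andP[_ /eqP Bs0] h1; apply: mulr_ge0 => //.
have [Os Xs Cs] := Bs; have Ozz := Om_zz Os.
have [/(_ _ Ozz)[_ _ cvx _] _ _] := adm.
apply: (@convex_level_normal _ _ (C (zz s)) (b ^~ (zz s)) (H (xh s) (zz s)) (H (xx s) (zz s))) => //.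
- by have [-> _ _] := bf.2 _ Ozz.
- exact: diff_level_fiber.
- by apply: (Ox_C adm) => //; exists (usubmx s).
Qed.

(** In scaled coordinates the linear part contributes the term in [- rho^-1], by [lyap_quad]. The
    nonlinearity enters through [Bcol] unscaled and is bounded by means of |e| <= |E' e|, which is
    why k does not depend on rho. *)
Lemma err_energy_drift : exists2 k : R, 0 < k & forall rho s, 0 < rho -> rho <= 1 -> Br s ->
  let nu_ := E'rho n rho *m er s in
  'D_(closed_loop f h phi L S b rho s) (err_energy f h S rho) s <= (k - rho^-1) * (nu_^T *m nu_) 0 0.
Proof.
have [k1 k10 H1] := top_gap_bound.
have [k2 k20 H2] := mulmx_bound S.
pose B := S *m Bcol R n.
exists (2 * k1 * (n%:R * (k2 * (`|B| + 1)))).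
  by rewrite !mulr_gt0 // ?ltr0n // ltr_wpDl.
move=> rho s r0 r1 Bs; have uH := branch_unit obsH adm Bs.
have rn0 : rho != 0 by rewrite gt_eqF.
have HD := derive_err_energy S rho sf sh s (closed_loop f h phi L S b rho s).
rewrite (derive_err_loop phi L S rho b n0 sf sh dep uH) in HD.
have Hg := H1 s Bs; have Hn := push_gain_normal r0 Bs.
rewrite {}HD; move: (er s) (top_gap f h phi s) (push_gain f h phi L S rho b s) (nrm f h b s) Hg Hn => e g ka N Hg Hn /=.
set nu_ := E'rho n rho *m e.
have E1 : S *m E'rho n rho *m ((Ac R n - invmx (Erho n rho) *m L *m Cc R n) *m e) = rho^-1 *: (S *m (A *m nu_)).
  by rewrite -mulmxA [X in S *m X]mulmxA E'_conj // -scalemxAl -scalemxAr -[_ *m E'rho n rho *m e]mulmxA.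
have E2 : S *m E'rho n rho *m Bcol R n = B by rewrite -mulmxA E'_Bcol.
(* [Gam] inverts the Gram matrix of [S *m E'rho n rho], so in this inner product the projection term
   pairs e with the bare normal N. *)
have E3 : (S *m E'rho n rho *m e)^T *m (S *m E'rho n rho *m (Gam S rho *m N)) = e^T *m N.
  have uM : S *m E'rho n rho \in unitmx by rewrite unitmx_mul uS E'rho_unit.
  have uMt : (S *m E'rho n rho)^T \in unitmx by rewrite unitmx_tr.
  rewrite /Gam; move: (S *m E'rho n rho) uM uMt => M uM uMt.
  rewrite trmx_mul -[invmx M *m _ *m N]mulmxA mulKVmx // trmx_inv -mulmxA mulKVmx //.
have E4 : S *m E'rho n rho *m e = S *m nu_ by rewrite -mulmxA.
rewrite mulmxBr [X in _ *m (X - _)]mulmxDr E1 -!scalemxAr E2 mulmxBr mulmxDr -!scalemxAr E3 E4.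
rewrite cV_subE [X in X - _]mxE [X in X + _ - _]mxE [X in _ + X - _]mxE [X in _ - X]mxE.
have := lyap_quad PA ST SS nu_; have := dot_ge_coord nu_.
move: (((S *m nu_)^T *m (S *m (A *m nu_))) 0 0) => q1.
move: ((nu_^T *m nu_) 0 0) => Q Q1 Q2.
have q2b : `|((S *m nu_)^T *m B) 0 0| <= n%:R * (k2 * `|nu_| * (`|B| + 1)).
  apply: le_trans (dot_le _ _) _; apply: ler_wpM2l; first exact: ler0n.
  by apply: ler_pM => //; rewrite lerDl.
have gb : `|g| <= k1 * `|nu_| by apply: le_trans Hg _; rewrite ler_pM2l //; exact: E'_ge.
move: (((S *m nu_)^T *m B) 0 0) q2b ((e^T *m N) 0 0) Hn => q2 q2b q3 Hn.
have gq : g * q2 <= k1 * (n%:R * (k2 * (`|B| + 1))) * Q.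
  apply: le_trans (ler_norm _) _; rewrite normrM.
  apply: (@le_trans _ _ (k1 * `|nu_| * (n%:R * (k2 * `|nu_| * (`|B| + 1))))); first exact: ler_pM.
  have -> : k1 * `|nu_| * (n%:R * (k2 * `|nu_| * (`|B| + 1))) =
    k1 * (n%:R * (k2 * (`|B| + 1))) * `|nu_| ^+ 2 by ring.
  apply: ler_wpM2l => //; rewrite !mulr_ge0 ?(ltW k10) ?(ltW k20) ?ler0n //.
have -> : 2 * (rho^-1 * q1 + g * q2 - ka * q3) = rho^-1 * (2 * q1) + 2 * (g * q2) - 2 * (ka * q3) by ring.
rewrite Q2 mulrBl; move: gq; set kk := n%:R * _ => gq.
have -> : 2 * k1 * kk * Q = 2 * (k1 * kk * Q) by ring.
lra.
Qed.

Lemma err_contraction : exists c kp rho1 : R, [/\ 0 < c, 0 < kp, 0 < rho1 &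
  forall rho s, 0 < rho -> rho <= 1 -> rho <= rho1 -> Br s ->
  [/\ 'D_(closed_loop f h phi L S b rho s) (err_energy f h S rho) s <= - (c / rho) * err_energy f h S rho s,
      `|er s| ^+ 2 <= kp * err_energy f h S rho s
    & err_energy f h S rho s <= kp * (rho ^- n * `|er s|) ^+ 2]].
Proof.
have [k k0 Hk] := err_energy_drift.
have [k2 k20 H2] := mulmx_bound S.
have [k3 k30 H3] := mulmx_bound (invmx S).
pose p2 := n%:R * k2 ^+ 2.
have p20 : 0 < p2 by rewrite mulr_gt0 ?ltr0n // exprn_gt0.
have W1 rho s : err_energy f h S rho s = ((S *m (E'rho n rho *m er s))^T *m (S *m (E'rho n rho *m er s))) 0 0.
  by rewrite /err_energy -!mulmxA.
have W2 rho s : err_energy f h S rho s <= p2 * `|E'rho n rho *m er s| ^+ 2.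
  rewrite W1; apply: le_trans (ler_norm _) _; apply: le_trans (dot_le _ _) _.
  rewrite /p2 -mulrA ler_wpM2l ?ler0n // -exprMn expr2; apply: ler_pM => //.
(* For rho <= (2 k)^-1, k uses up at most half of the decay 1 / rho. p2 bounds the energy by the
   squared scaled error, and k3 bounds the inverse of S. *)
exists (2 * p2)^-1, (Num.max (k3 ^+ 2) p2), (2 * k)^-1; split.
- by rewrite invr_gt0 mulr_gt0.
- by rewrite lt_max p20 orbT.
- by rewrite invr_gt0 mulr_gt0.
move=> rho s r0 r1 rk Bs; split.
- apply: le_trans (Hk rho s r0 r1 Bs) _ => /=.
  have krho : k <= (2 * rho)^-1.
    by rewrite -[k]invrK lef_pV2 ?posrE ?invr_gt0 ?mulr_gt0 // -ler_pdivlMl // mulrC -invfM mulrC.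
  have h1 := dot_ge_coord (E'rho n rho *m er s).
  have h2 := W2 rho s; move: h1 h2; set Q := (_ *m _) 0 0; set W := err_energy _ _ _ _ _; move=> h1 h2.
  have h3 : W <= p2 * Q by apply: le_trans h2 _; rewrite ler_pM2l.
  have Q0 : 0 <= Q by exact: dot_ge0.
  have e1 : (2 * p2)^-1 / rho * W <= (2 * rho)^-1 * Q.
    have -> : (2 * rho)^-1 * Q = (2 * p2)^-1 / rho * (p2 * Q) by field; rewrite !gt_eqF.
    by rewrite ler_pM2l // divr_gt0 // invr_gt0 mulr_gt0.
  have e2 : (k - rho^-1) * Q <= ((2 * rho)^-1 - rho^-1) * Q by rewrite ler_wpM2r // lerD2r.
  have e3 : ((2 * rho)^-1 - rho^-1) * Q = - ((2 * rho)^-1 * Q) by field; rewrite gt_eqF.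
  rewrite mulNr; apply: le_trans e2 _; rewrite e3; lra.
- have h1 := E'_ge (er s) r0 r1.
  have h2 : `|er s| <= k3 * `|S *m (E'rho n rho *m er s)|.
    by apply: le_trans h1 _; rewrite -{1}[E'rho n rho *m er s](mulKmx uS); exact: H3.
  have h3 : `|S *m (E'rho n rho *m er s)| ^+ 2 <= err_energy f h S rho s by rewrite W1; exact: dot_ge_coord.
  apply: (@le_trans _ _ (k3 ^+ 2 * `|S *m (E'rho n rho *m er s)| ^+ 2)).
    by rewrite -exprMn ler_pXn2r ?nnegrE // mulr_ge0 // ltW.
  by apply: ler_pM => //; rewrite ?sqr_ge0 // le_max lexx.
- apply: le_trans (W2 rho s) _; apply: ler_pM; rewrite ?(ltW p20) ?sqr_ge0 //.
    by rewrite le_max lexx orbT.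
  rewrite ler_pXn2r ?nnegrE //; first exact: E'_le.
  by rewrite mulr_ge0 // invr_ge0 exprn_ge0 // ltW.
Qed.

End error_contraction.

(** * Trajectories of the closed loop *)

(* The field need not be continuous along the solution: only a continuous
   majorant psi of the derivative is needed. *)
Lemma sol_rdle_along (R : realType) (m : nat) (K A : set 'cV[R]_m) (F : 'cV[R]_m -> 'cV[R]_m)
    (a b : R) (y : R -> 'cV[R]_m) (t M : R) (g psi : 'cV[R]_m -> R) :
  a <= t -> t < b -> sol_on K F a b y ->
  (forall r, t <= r -> r <= b -> A (y r)) -> (forall p, A p -> `|F p| <= M) ->
  (forall p, A p -> differentiable g p) -> (forall v, {for y t, continuous ('D_v g)}) ->
  {for y t, continuous psi} -> (forall p, A p -> 'D_(F p) g p <= psi p) ->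
  rdle (g \o y) t (psi (y t)).
Proof.
move=> at_ tb sy Ay FM dg cg cpsi Hpsi.
have At : A (y t) by apply: Ay => //; exact: ltW.
have M0 : 0 <= M by apply: le_trans (FM _ At).
apply: (@sol_on_rdle _ _ K F a b y t M) => //; first exact: dg.
  by move=> r tr rb; apply: FM; apply: Ay => //; exact: ltW.
move=> e e0.
pose e2 := e / 2 / (m%:R * M + 1).
have mM : 0 < m%:R * M + 1 by rewrite ltr_wpDl // mulr_ge0.
have e20 : 0 < e2 by rewrite !divr_gt0.
have cgrad : {for y t, continuous (grad g)}.
  apply: cV_continuous => i; rewrite (_ : (fun x => _) = 'D_(delta_mx i 0) g); first exact: cg.
  by apply/funext => x; rewrite mxE.
have e1 : 0 < e / 2 by rewrite divr_gt0.
have /nbhs_ballP[d /= d0 Hd] : \forall p \near y t, `|psi (y t) - psi p| < e / 2 /\ `|grad g (y t) - grad g p| < e2.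
  by apply: filterI; [move/cvgrPdist_lt: cpsi|move/cvgrPdist_lt: cgrad]; apply.
have [d' d'0 Hd'] := sol_on_cont at_ (ltW tb) sy d0.
exists d' => // r tr rd rb.
have Ar : A (y r) by apply: Ay => //; exact: ltW.
have [|h1 h2] := Hd (y r).
  rewrite -ball_normE /= distrC; apply: Hd' => //; first exact: le_trans at_ (ltW tr).
  by rewrite gtr0_norm ?subr_gt0 // ltrBlDr addrC.
have E : 'd g (y t) (F (y r)) = ((grad g (y t) - grad g (y r))^T *m F (y r)) 0 0 + 'D_(F (y r)) g (y r).
  rewrite -grad_mulE; last exact: dg.
  rewrite -deriveE; last exact: dg.
  rewrite -grad_mulE; last exact: dg.
  by rewrite linearB /= mulmxBl [X in _ = X + _]mxE [X in _ = _ + X + _]mxE subrK.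
have h3 : ((grad g (y t) - grad g (y r))^T *m F (y r)) 0 0 <= e / 2.
  apply: le_trans (ler_norm _) _; apply: le_trans (dot_le _ _) _.
  apply: (@le_trans _ _ (m%:R * (e2 * M))).
    apply: ler_wpM2l; first exact: ler0n.
    by apply: ler_pM => //; [exact: ltW|exact: FM].
  have -> : m%:R * (e2 * M) = e / 2 * (m%:R * M) / (m%:R * M + 1) by rewrite /e2; ring.
  by rewrite ler_pdivrMr // ler_pM2l // lerDl.
have h4 := Hpsi _ Ar; move: h1; rewrite ltr_norml => /andP[h1 _].
by rewrite E; lra.
Qed.

Lemma rdleD (R : realType) (q1 q2 : R -> R) (t c1 c2 : R) :
  rdle q1 t c1 -> rdle q2 t c2 -> rdle (fun r => q1 r + q2 r) t (c1 + c2).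
Proof.
move=> H1 H2 e e0; have e20 : 0 < e / 2 by rewrite divr_gt0.
have [d1 d10 {}H1] := H1 _ e20; have [d2 d20 {}H2] := H2 _ e20.
exists (Num.min d1 d2); first by rewrite lt_min d10.
move=> k k0; rewrite lt_min => /andP[k1 k2].
have := H1 k k0 k1; have := H2 k k0 k2.
have -> : (c1 + c2 + e) * k = (c1 + e / 2) * k + (c2 + e / 2) * k by field.
lra.
Qed.

Lemma rdle_weaken (R : realType) (q : R -> R) (t c c' : R) : rdle q t c -> c <= c' -> rdle q t c'.
Proof.
move=> H cc e e0; have [d d0 {}H] := H e e0; exists d => // k k0 kd.
by apply: le_trans (H k k0 kd) _; rewrite ler_pM2r // lerD2r.
Qed.

Lemma rdle_expR (R : realType) (A w t : R) : rdle (fun r => A * expR (- (w * r))) t (- (A * w * expR (- (w * t)))).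
Proof.
pose g := fun r : R => A * expR (- (w * r)).
have dg : is_derive t (1 : R) g (- (A * w * expR (- (w * t)))).
  by apply: is_derive_eq; rewrite /GRing.scale /=; ring.
have rg : rder g t ('D_1 g t).
  have rid : rder (fun r : R => r) t (1 : R).
    move=> e e0; exists 1 => // k k0 _.
    have -> : t + k - t - k *: (1 : R) = 0 by rewrite /GRing.scale /= mulr1; ring.
    by rewrite normr0 mulr_ge0 // ltW.
  by apply: (rder_comp (g := g) rid); apply/derivable1_diffP; exact: ex_derive.
by apply: (rder_rdle rg); rewrite derive_val.
Qed.

Lemma class_K_ge0 (R : realType) (a : \bar R) (alpha : R -> R) (r : R) :
  class_K a alpha -> 0 <= r -> (r%:E < a)%E -> 0 <= alpha r.
Proof.
move=> [a0 ai _]; rewrite le_eqVlt => /orP[/eqP <-|r0] ra; first by rewrite a0.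
by rewrite -a0 ltW // ai.
Qed.

Lemma expR_vanish (R : realType) (A w e : R) : 0 <= A -> 0 < w -> 0 < e ->
  exists2 T : R, 0 <= T & forall t, T <= t -> A * expR (- (w * t)) <= e.
Proof.
move=> A0 w0 e0; exists (A / e / w); first by rewrite !divr_ge0 // ltW.
move=> t Tt; rewrite expRN ler_pdivrMr ?expR_gt0 //.
have h1 : A / e <= w * t by rewrite [w * t]mulrC -ler_pdivrMr.
have h2 := expR_ge1Dx (w * t).
have : A / e <= expR (w * t) by apply: le_trans h1 (le_trans _ h2); rewrite lerDr.
by rewrite ler_pdivrMr // mulrC.
Qed.

(** The term of order n + 1 of the exponential series at [beta / rho] beats rho^-n and leaves one
    factor rho. *)
Lemma gain_vanish (R : realType) (n : nat) (B beta e : R) : 0 <= B -> 0 < beta -> 0 < e ->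
  exists2 r : R, 0 < r & forall rho, 0 < rho -> rho <= r -> B * rho ^- n * expR (- (beta / rho)) <= e.
Proof.
move=> B0 b0 e0; pose Q := B * n.+1`!%:R / beta ^+ n.+1.
have Q0 : 0 <= Q by rewrite divr_ge0 ?mulr_ge0 ?exprn_ge0 // ltW.
exists (e / (Q + 1)); first by rewrite divr_gt0 // ltr_wpDl.
move=> rho r0 rr.
have x0 : 0 <= beta / rho by rewrite divr_ge0 // ltW.
have h1 : (beta / rho) ^+ n.+1 / n.+1`!%:R <= expR (beta / rho).
  by apply: le_trans (expR_ge1Dxn n x0); rewrite lerDr.
have h2 : rho * Q <= e.
  apply: (@le_trans _ _ (e / (Q + 1) * (Q + 1))); last by rewrite divfK // gt_eqF // ltr_wpDl.
  by apply: ler_pM => //; rewrite ?(ltW r0) // lerDl.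
apply: le_trans h2; rewrite expRN ler_pdivrMr ?expR_gt0 //.
have r0' := ltW r0.
apply: (@le_trans _ _ (rho * Q * ((beta / rho) ^+ n.+1 / n.+1`!%:R))); last first.
  by rewrite ler_wpM2l // mulr_ge0.
have f0 : (n.+1`!%:R : R) != 0 by rewrite pnatr_eq0 -lt0n fact_gt0.
rewrite le_eqVlt; apply/orP; left; apply/eqP.
have bn0 : beta ^+ n != 0 by rewrite expf_neq0 // gt_eqF.
have rn0 : rho ^+ n != 0 by rewrite expf_neq0 // gt_eqF.
rewrite /Q expr_div_n !exprS; field.
by rewrite rn0 bn0 f0 !gt_eqF.
Qed.

Lemma enorm_ge (R : realType) (m : nat) (v : 'cV[R]_m) : `|v| <= enorm v.
Proof.
apply/cV_norm_le => [|i]; first exact: sqrtr_ge0.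
rewrite -sqrtr_sqr ler_wsqrtr // (bigD1 i) //= lerDl sumr_ge0 // => j _; exact: sqr_ge0.
Qed.

Lemma enorm_le (R : realType) (m : nat) (v : 'cV[R]_m) : enorm v <= m.+1%:R * `|v|.
Proof.
rewrite /enorm -[leRHS]ger0_norm ?mulr_ge0 // -sqrtr_sqr ler_wsqrtr //.
apply: (@le_trans _ _ (\sum_(i < m) `|v| ^+ 2)).
  by apply: ler_sum => i _; rewrite -[leLHS]real_normK ?num_real // ler_pXn2r ?nnegrE //; exact: cV_coord_le.
rewrite sumr_const card_ord exprMn -[leLHS]mulr_natl ler_wpM2r ?sqr_ge0 //.
by rewrite expr2 -natrM ler_nat mulSn leqW // leq_addr.
Qed.

Section trajectories.
Variables (R : realType) (n nu : nat) (f : 'cV[R]_n -> R -> 'cV[R]_n) (h : 'cV[R]_n -> R -> R).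
Variables (X : set 'cV[R]_n) (U : set 'cV[R]_nu) (phi : 'cV[R]_(n + nu) -> R).
Variables (D : set 'cV[R]_(n + nu)) (V : 'cV[R]_(n + nu) -> R).
Variables (a : \bar R) (alpha1 alpha2 alpha3 : R -> R) (c2 : R).
Variables (C : 'cV[R]_nu -> set 'cV[R]_n) (b : 'cV[R]_n -> 'cV[R]_nu -> R).
Variables (L : 'cV[R]_n) (P S : 'M[R]_n).
Let H := obs_map (nu := nu) f h.
Let F := fun chi : 'cV[R]_(n + nu) => ext_field f chi (phi chi).
Let Om := sublevel D V c2.
Let Ox := [set usubmx chi | chi in Om].
Let Oz := [set dsubmx chi | chi in Om].
Let A := Ac R n - L *m Cc R n.
Hypothesis n0 : (0 < n)%N.
Hypothesis sf : smooth (fun p : ('cV[R]_n * R)%type => f p.1 p.2).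
Hypothesis sh : smooth (fun p : ('cV[R]_n * R)%type => h p.1 p.2).
Hypothesis sphi : smooth phi.
Hypothesis obsH : observable H X U.
Hypothesis lyap : lyapunov_function F D V a alpha1 alpha2 alpha3.
Hypothesis Om0 : Om 0.
Hypothesis adm : admissible_sets H X U Ox Oz C.
Hypothesis bf : boundary_function Oz C b.
Hypothesis PA : P *m A + A^T *m P = - 1%:M.
Hypothesis ST : S^T = S.
Hypothesis SS : S *m S = P.

Notation St := 'cV[R]_(n + nu + n).
Notation zz s := (dsubmx (usubmx s)).
Notation xx s := (usubmx (usubmx s)).
Notation xh s := (dsubmx s).
Notation er := (err (nu := nu) f h).
Let Br := branch f h X D V c2 C.
Let K := closed_loop_states (nu := nu) f h C.
Let G rho := closed_loop f h phi L S b rho.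
Let W rho := err_energy (nu := nu) f h S rho.
Let Vs (s : St) := V (usubmx s).
Let Good := good f h X D V c2 C.

Let uS : S \in unitmx := lyap_S_unit PA ST SS.
Let cBr : compact Br := branch_compact sf sh obsH lyap Om0 adm bf.

(** Feedback of the exact state is the closed-loop feedback at the state whose estimate is x itself,
    again a point of the branch. The field is Lipschitz between the two states, and
    [branch_inv_lipschitz] bounds their distance. *)
Lemma input_mismatch : exists2 k : R, 0 < k & forall s, Br s ->
  `|ext_field f (usubmx s) (vin phi s) - F (usubmx s)| <= k * `|er s|.
Proof.
have lip i := lipschitz_on_compact (ck_C1 (ck_ext sf sphi 1 i)) cBr.
have [k Hk] := choice (fun i => let: ex_intro2 d h1 h2 := lip i in ex_intro _ d (conj h1 h2)).
have [k2 k20 H2] := branch_inv_lipschitz sf sh obsH lyap Om0 adm bf.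
pose k1 := \sum_i k i + 1.
have k10 : 0 < k1 by rewrite ltr_wpDl //; apply: sumr_ge0 => i _; apply: ltW; case: (Hk i).
exists (k1 * k2); first exact: mulr_gt0.
move=> s Bs; apply: (@le_trans _ _ (k1 * `|xh s - xx s|)); last by rewrite -mulrA ler_pM2l //; exact: H2.
apply/cV_norm_le => [|i]; first by rewrite mulr_ge0 // ltW.
pose s' : St := col_mx (usubmx s) (xx s).
have Bs' : Br s' by apply: (branch_true adm).
have -> : F (usubmx s) = ext_field f (usubmx s') (vin phi s').
  by rewrite /s' /vin !col_mxKu !col_mxKd vsubmxK.
rewrite cV_subE; apply: le_trans ((Hk i).2 _ _ Bs Bs') _.
have -> : s - s' = col_mx 0 (xh s - xx s).
  by rewrite -{1}[s]vsubmxK /s' opp_col_mx add_col_mx subrr.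
apply: ler_pM => //; first by apply: ltW; case: (Hk i).
  rewrite /k1 (bigD1 i) //= -addrA lerDl addr_ge0 // sumr_ge0 // => j _.
  by apply: ltW; case: (Hk j).
by apply: col_mx_le; rewrite ?normr0.
Qed.

Lemma grad_V_bound : exists2 k : R, 0 < k & forall chi, Om chi -> `|grad V chi| <= k.
Proof.
have cg chi : D chi -> {for chi, continuous (grad V)}.
  have [[_ C1V] _ _ _ _] := lyap => Dc; apply: cV_continuous => i.
  rewrite (_ : (fun x => _) = 'D_(delta_mx i 0) V); first exact: (C1V _ Dc).2.
  by apply/funext => x; rewrite mxE.
have cO : compact (grad V @` Om).
  apply: continuous_compact (Om_compact lyap); apply: continuous_in_subspaceT => s.
  by rewrite inE => -[Ds _]; exact: cg.
have [M [Mr HM]] := compact_bounded cO.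
exists (Num.max 1 (M + 1)); first by rewrite lt_max ltr01.
move=> chi Oc; apply: HM; last by exists chi.
by rewrite lt_max ltrDl ltr01 orbT.
Qed.

(** V depends on chi alone, so neither the projection nor rho enters: the state feedback dissipates,
    and the input mismatch is multiplied by the bounded gradient of V. *)
Lemma V_drift : exists2 k : R, 0 < k & forall rho s, Br s ->
  'D_(G rho s) Vs s <= - alpha3 (enorm (usubmx s)) + k * `|er s|.
Proof.
have [k1 k10 H1] := input_mismatch.
have [k2 k20 H2] := grad_V_bound.
exists ((n + nu)%:R * (k2 * k1)).
  by rewrite !mulr_gt0 // ltr0n addn_gt0 n0.
move=> rho s Bs; have [Os _ _] := Bs.
have [[_ C1V] _ _ _ bV] := lyap.
have dV : differentiable V (usubmx s) by exact: (C1V _ Os.1).1.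
have -> : 'D_(G rho s) Vs s = 'D_(ext_field f (usubmx s) (vin phi s)) V (usubmx s).
  by apply: derive_line => t; rewrite /Vs linearD linearZ /= /G /closed_loop col_mxKu.
have -> : 'D_(ext_field f (usubmx s) (vin phi s)) V (usubmx s) =
    ((grad V (usubmx s))^T *m (ext_field f (usubmx s) (vin phi s) - F (usubmx s))) 0 0 + 'D_(F (usubmx s)) V (usubmx s).
  by rewrite -!grad_mulE // mulmxBr [X in _ = X + _]mxE [X in _ = _ + X + _]mxE subrK.
have [_ _ hV] := bV _ Os.1; rewrite addrC; apply: lerD => //.
apply: le_trans (ler_norm _) _; apply: le_trans (dot_le _ _) _.
rewrite -mulrA ler_wpM2l ?ler0n // -mulrA; apply: ler_pM => //; [exact: H2|exact: H1].
Qed.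

Lemma V0 : V 0 = 0.
Proof.
have [_ [[a1 _ _] [a2 _ _] _] _ _ bV] := lyap.
have e0 : enorm (0 : 'cV[R]_(n + nu)) = 0.
  by rewrite /enorm big1 ?sqrtr0 // => i _; rewrite mxE expr0n.
have [h1 h2 _] := bV 0 Om0.1; move: h1 h2; rewrite e0 a1 a2 => h1 h2.
by apply/le_anti; rewrite h1 h2.
Qed.

Lemma alpha3_ge0 chi : D chi -> 0 <= alpha3 (enorm chi).
Proof.
have [_ [_ _ K3] Da _ _] := lyap => Dc.
by apply: class_K_ge0 K3 _ (Da _ Dc); exact: sqrtr_ge0.
Qed.

(** The dissipation is replaced by a continuous function of V, null for V <= eta. If V > eta,
    continuity of V at 0 keeps chi away from the origin, where the increasing function [alpha3] has
    a positive lower bound. *)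
Lemma alpha3_lower (eta : R) : 0 < eta -> exists2 d : R, 0 < d & forall chi, D chi ->
  d * Num.min eta (Num.max 0 (V chi - eta)) <= alpha3 (enorm chi).
Proof.
move=> e0; have [_ [_ _ [a30 a3i _]] Da _ _] := lyap.
have := V_cont lyap Om0.1; move=> /cvgrPdist_lt /(_ eta e0) /nbhs_ballP[r /= r0 Hr].
have r20 : 0 < r / 2 by rewrite divr_gt0.
have big chi : D chi -> eta < V chi -> r / 2 < enorm chi.
  move=> Dc Vc; apply: (@lt_le_trans _ _ r); first by rewrite ltr_pdivrMr // mulr_natr mulr2n ltrDl.
  apply: le_trans (enorm_ge chi); rewrite leNgt; apply/negP => cr.
  have := Hr chi; rewrite -ball_normE /= sub0r normrN => /(_ cr); rewrite V0 sub0r normrN.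
  by rewrite ltr_norml => /andP[_]; lra.
have main (d : R) : 0 < d -> (forall chi, D chi -> eta < V chi -> d * eta <= alpha3 (enorm chi)) ->
  forall chi, D chi -> d * Num.min eta (Num.max 0 (V chi - eta)) <= alpha3 (enorm chi).
  move=> d0 Hd chi Dc; have [Ve|Ve] := leP (V chi) eta.
    by rewrite max_l ?subr_le0 // min_r ?(ltW e0) // mulr0; exact: alpha3_ge0.
  by apply: le_trans (Hd chi Dc Ve); rewrite ler_pM2l // ge_min lexx.
have [ra|ra] := boolP ((r / 2)%:E < a)%E.
  have a3p : 0 < alpha3 (r / 2) by rewrite -a30; exact: a3i.
  exists (alpha3 (r / 2) / eta); first by rewrite divr_gt0.
  apply: main => [|chi Dc Vc]; first by rewrite divr_gt0.
  rewrite divfK ?gt_eqF // ltW // a3i //; [exact: ltW|exact: big|exact: Da].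
(* When [r / 2] is not below a, no chi in D satisfies [eta < V chi]. *)
exists 1 => //; apply: main => // chi Dc Vc; move: ra.
by rewrite (lt_trans _ (Da _ Dc)) // lte_fin; exact: big.
Qed.

(** Compactness alone does not bound a discontinuous field; [local_data] bounds it near each
    point. *)
Lemma G_bounded rho c : 0 < rho -> c < c2 -> exists2 M : R, 0 < M & forall s, Good c s -> `|G rho s| <= M.
Proof.
move=> r0 cc2.
pose Q (r : R) (s : St) := r * `|G rho s| <= 1.
have mono (r r' : R) x : 0 < r' -> r' <= r -> Q r x -> Q r' x.
  by move=> r'0 r'r; apply: le_trans; rewrite ler_wpM2r.
have cG : compact (Good c) := good_compact sf sh obsH lyap Om0 adm bf (c:=c).
have [|r r0' Hr] := compact_unif cG mono; last first.
  by exists r^-1; [rewrite invr_gt0|move=> s gs; rewrite -[leRHS]mulr1 ler_pdivlMl //; exact: Hr].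
move=> s0 [Bs Vs0].
have [r [M [B' [k' [pu' [r0' M0 HB]]]]]] :=
  local_data L n0 sf sh sphi obsH lyap adm bf uS r0 Bs (le_lt_trans Vs0 cc2).
exists (Num.min r M^-1); first by rewrite lt_min r0' invr_gt0.
move=> s [Bs' _]; rewrite lt_min => /andP[sr _].
have [_ [h1 _ _] h2 h3] := HB s (ltW sr).
have [_ Gs] := h2 (h3 Bs').
have GM : `|G rho s| <= M.
  rewrite /G Gs /reflected; case: ifP => _.
    by apply: le_trans h1; apply: le_trans (ler_normB _ _) _; rewrite normrZ.
  by apply: le_trans h1; rewrite lerDl mulr_ge0.
rewrite /Q; apply: (@le_trans _ _ (M^-1 * M)); last by rewrite mulVf // gt_eqF.
by apply: ler_pM => //; [rewrite le_min (ltW r0') /= invr_ge0 ltW|rewrite ge_min lexx orbT].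
Qed.

(** The strict bound on V may presuppose that the solution has stayed in [Good c] so far. Limit
    times are covered by closedness; beyond t the strict bound persists by continuity, and
    [branch_open] draws the rest from the constraint K. *)
Lemma trap rho c (T : R) y : c < c2 -> 0 <= T -> sol_on K (G rho) 0 T y -> Br (y 0) -> Vs (y 0) < c ->
  (forall t, 0 <= t -> t <= T -> (forall r, 0 <= r -> r <= t -> Good c (y r)) -> Vs (y t) < c) ->
  forall t, 0 <= t -> t <= T -> Good c (y t).
Proof.
move=> cc2 T0 sy B0 V0c Hstep; apply: real_induction => // t t0 tT Hr.
  move: t0; rewrite le_eqVlt => /orP[/eqP <-|t0]; first by split => //; exact: ltW.
  have clG : closed (Good c).
    by apply: compact_closed; [exact: norm_hausdorff|exact: (good_compact sf sh obsH lyap Om0 adm bf (c:=c))].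
  apply: clG => N /nbhs_ballP[e /= e0 He].
  have [d d0 Hd] := sol_on_cont (ltW t0) tT sy e0.
  pose r := Num.max 0 (t - d / 2).
  have r0 : 0 <= r by rewrite le_max lexx.
  have d20 : 0 < d / 2 by rewrite divr_gt0.
  have rt : r < t by rewrite gt_max t0 ltrBlDr ltrDl d20.
  exists (y r); split; first exact: Hr.
  apply: He; rewrite -ball_normE /= distrC; apply: Hd => //; first exact: le_trans (ltW rt) tT.
  have h1 : t - d / 2 <= r by rewrite le_max lexx orbT.
  by rewrite distrC gtr0_norm ?subr_gt0 //; lra.
have Bt : Br (y t) by case: (Hr t t0 (lexx t)).
have Vt : Vs (y t) < c by apply: Hstep => //; exact: ltW.
have [d1 d10 H1] := branch_open sf sh obsH adm Bt.
have [[Dt _] _ _] := Bt.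
have nO : \forall p \near y t, Om (usubmx p) by apply: (near_Om lyap) => //; exact: lt_trans cc2.
have nV : \forall p \near y t, Vs p < c.
  have cV : {for y t, continuous Vs}.
    apply: (@continuous_comp _ _ _ (fun s : St => usubmx s) V); first exact: usubmx_continuous.
    exact: V_cont lyap _ Dt.
  have e0 : 0 < c - Vs (y t) by rewrite subr_gt0.
  move: cV => /cvgrPdist_lt /(_ _ e0); apply: filterS => q.
  by rewrite ltr_norml => /andP[]; lra.
have /nbhs_ballP[d2 /= d20 H2] : \forall p \near y t, Om (usubmx p) /\ Vs p < c by exact: filterI.
have e0 : 0 < Num.min d1 d2 by rewrite lt_min d10.
have [d d0 Hd] := sol_on_cont t0 (ltW tT) sy e0.
exists d => // r tr rd rT.
have r0 : 0 <= r by apply: le_trans t0 (ltW tr).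
have := Hd r r0 rT; rewrite gtr0_norm ?subr_gt0 // ltrBlDr [d + t]addrC => /(_ rd).
rewrite lt_min => /andP[h1 h2].
have [|Or Vr] := H2 (y r); first by rewrite -ball_normE /= distrC.
split; last exact: ltW.
by apply: H1 => //; have [Kr _] := sy r r0 rT; exact: Kr.
Qed.

Definition excess (eta v : R) : R := Num.min eta (Num.max 0 (v - eta)).

Lemma Vs_cont s : Br s -> {for s, continuous Vs}.
Proof.
move=> [[Ds _] _ _].
apply: (@continuous_comp _ _ _ (fun s : St => usubmx s) V); first exact: usubmx_continuous.
exact: V_cont lyap _ Ds.
Qed.

Lemma er_cont s : {for s, continuous er}.
Proof.
by apply: cV_continuous => i; apply: differentiable_continuous; apply: (@ck_diff _ _ _ 0); exact: ck_err.
Qed.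

Section one_solution.
Variables (rho cc T : R) (y : R -> St).
Hypothesis rho0 : 0 < rho.
Hypothesis cc2 : cc < c2.
Hypothesis sy : sol_on K (G rho) 0 T y.
Hypothesis gy : forall t, 0 <= t -> t <= T -> Good cc (y t).

(** Gronwall for the energy, then square roots: the rate is halved, and the factors kp of the two
    comparisons combine into one. *)
Lemma err_decay (c kp : R) : 0 < c -> 0 < kp ->
  (forall s, Br s -> [/\ 'D_(G rho s) (W rho) s <= - (c / rho) * W rho s,
     `|er s| ^+ 2 <= kp * W rho s & W rho s <= kp * (rho ^- n * `|er s|) ^+ 2]) ->
  forall t, 0 <= t -> t <= T ->
  `|er (y t)| <= kp * (rho ^- n * `|er (y 0)|) * expR (- (c / (2 * rho) * t)).
Proof.
move=> c0 kp0 Hc t t0 tT; have T0 := le_trans t0 tT.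
have [M M0 HM] := G_bounded rho0 cc2.
have ckW : ck 1 (W rho) by exact: ck_err_energy.
have cW s : {for s, continuous (W rho)} by apply: differentiable_continuous; exact: ck_diff ckW.
have wt : W rho (y t) <= expR (- (c / rho * (t - 0))) * W rho (y 0).
  apply: (@rdle_expR_le _ (W rho \o y)) => //.
  - by rewrite divr_ge0 // ltW.
  - move=> r r0 rt; apply: lcont_comp; last exact: cW.
    by apply: (sol_on_lcont r0 _ sy); exact: le_trans tT.
  - by move=> r _ _; exact: dot_ge0.
  - move=> r r0 rt.
    apply: (@sol_rdle_along _ _ K (Good cc) (G rho) 0 T y r M (W rho) (fun s => - (c / rho) * W rho s)) => //.
    + exact: lt_le_trans tT.
    + by move=> q rq qT; apply: gy => //; exact: le_trans rq.
    + by move=> q _; exact: ck_diff ckW.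
    + by move=> v; apply: differentiable_continuous; apply: (@ck_diff _ _ _ 0); exact: ck_derive ckW.
    + by apply: contM; [exact: continuous_cst_at|exact: cW].
    + by move=> q [Bq _]; have [] := Hc q Bq.
have [_ h1 _] := Hc (y t) (gy t0 tT).1; have [_ _ h2] := Hc (y 0) (gy (lexx 0) T0).1.
have r0 : 0 <= rho ^- n by rewrite invr_ge0 exprn_ge0 // ltW.
rewrite -(ler_pXn2r (n := 2)) ?nnegrE // ?mulr_ge0 ?expR_ge0 ?(ltW kp0) //.
apply: le_trans h1 _; apply: (@le_trans _ _ (kp * (expR (- (c / rho * (t - 0))) * W rho (y 0)))).
  by rewrite ler_pM2l.
have -> : (kp * (rho ^- n * `|er (y 0)|) * expR (- (c / (2 * rho) * t))) ^+ 2 =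
   kp * (expR (- (c / rho * (t - 0))) * (kp * (rho ^- n * `|er (y 0)|) ^+ 2)).
  have -> : - (c / rho * (t - 0)) = - (c / (2 * rho) * t) + - (c / (2 * rho) * t) by field; rewrite gt_eqF.
  by rewrite expRD; ring.
by rewrite ler_pM2l // ler_pM2l // expR_gt0.
Qed.

(** The derivative of the added exponential is [- (k * E * expR (- (w * t)))], which compensates the
    error term; the dissipation remains. *)
Lemma V_along (k d eta E w : R) : 0 <= k -> 0 < w -> 0 <= d ->
  (forall s, Br s -> 'D_(G rho s) Vs s <= - (d * excess eta (Vs s)) + k * `|er s|) ->
  (forall t, 0 <= t -> t <= T -> `|er (y t)| <= E * expR (- (w * t))) ->
  let g := fun t => Vs (y t) + k * E / w * expR (- (w * t)) in
  (forall t, 0 < t -> t <= T -> lcont g t) /\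
  (forall t, 0 <= t -> t < T -> rdle g t (- (d * excess eta (Vs (y t))))).
Proof.
move=> k0 w0 d0 Hd HE g.
have [M M0 HM] := G_bounded rho0 cc2.
have cexp t : {for t, continuous (fun t : R => k * E / w * expR (- (w * t)))}.
  apply: contM; first exact: continuous_cst_at.
  apply: (@continuous_comp _ _ _ (fun t : R => - (w * t)) expR); last exact: continuous_expR.
  by apply: cvgN; apply: contM; [exact: continuous_cst_at|exact: cvg_id].
split=> t t0 tT.
  have lc : lcont y t by exact: (sol_on_lcont t0 tT sy).
  have lV : lcont (Vs \o y) t by apply: (lcont_comp lc); apply: Vs_cont; apply: (gy _ tT).1; exact: ltW.
  exact: (cvgD lV (continuous_lcont (cexp t))).
have tT' := ltW tT.
have Bt : Br (y t) by exact: (gy t0 tT').1.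
have cex : {for y t, continuous (fun s => excess eta (Vs s))}.
  apply: continuous_minr; first exact: continuous_cst_at.
  apply: continuous_maxr; first exact: continuous_cst_at.
  by apply: contB; [exact: Vs_cont|exact: continuous_cst_at].
have h1 : rdle (Vs \o y) t (- (d * excess eta (Vs (y t))) + k * `|er (y t)|).
  apply: (@sol_rdle_along _ _ K (Good cc) (G rho) 0 T y t M Vs
    (fun s => - (d * excess eta (Vs s)) + k * `|er s|)) => //.
  - by move=> q rq qT; apply: gy => //; exact: le_trans rq.
  - move=> q [[[Dq _] _ _] _].
    have [[_ C1V] _ _ _ _] := lyap.
    apply: (@differentiable_comp _ _ _ _ (fun s : St => usubmx s) V); first exact: differentiable_usubmx.
    exact: (C1V _ Dq).1.
  - move=> v; have [[_ C1V] _ _ _ _] := lyap; have [[Dt _] _ _] := Bt.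
    rewrite (_ : 'D_v Vs = fun s : St => 'D_(usubmx v) V (usubmx s)); last first.
      by apply/funext => s; apply: derive_line => r; rewrite /Vs linearD linearZ.
    apply: (@continuous_comp _ _ _ (fun s : St => usubmx s) ('D_(usubmx v) V)); first exact: usubmx_continuous.
    exact: (C1V _ Dt).2.
  - apply: contD.
        have c1 : {for y t, continuous (fun s => d * excess eta (Vs s))}.
        by apply: contM; [exact: continuous_cst_at|exact: cex].
      exact: (cvgN c1).
    apply: contM; first exact: continuous_cst_at.
    apply: (@continuous_comp _ _ _ er (fun x => `|x|)); [exact: er_cont|exact: norm_continuous].
  - by move=> q [Bq _]; exact: Hd.
apply: rdle_weaken (rdleD h1 (@rdle_expR _ (k * E / w) w t)) _.
have -> : k * E / w * w * expR (- (w * t)) = k * (E * expR (- (w * t))) by field; rewrite gt_eqF.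
have := ler_wpM2l k0 (HE t t0 tT'); lra.
Qed.

Lemma V_growth (k d eta E w : R) : 0 <= k -> 0 < w -> 0 <= d -> 0 <= eta -> 0 <= E ->
  (forall s, Br s -> 'D_(G rho s) Vs s <= - (d * excess eta (Vs s)) + k * `|er s|) ->
  (forall t, 0 <= t -> t <= T -> `|er (y t)| <= E * expR (- (w * t))) ->
  forall r t, 0 <= r -> r <= t -> t <= T ->
  Vs (y t) + k * E / w * expR (- (w * t)) <= Vs (y r) + k * E / w * expR (- (w * r)).
Proof.
move=> k0 w0 d0 e0 E0 Hd HE r t r0 rt tT; have [h1 h2] := V_along k0 w0 d0 Hd HE.
rewrite -subr_le0 -(mul0r (t - r)).
apply: (@rdle_le _ (fun t => Vs (y t) + k * E / w * expR (- (w * t)))) => //.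
  by move=> q rq qt; apply: h1; [exact: le_lt_trans rq|exact: le_trans tT].
move=> q rq qt; apply: rdle_weaken (h2 q _ _) _; [exact: le_trans rq|exact: lt_le_trans tT|].
by rewrite oppr_le0 mulr_ge0 // /excess le_min e0 le_max lexx.
Qed.

(** The bound Mv is free of the factor rho^-n of [err_decay], so this crude estimate is the useful
    one at the start. *)
Lemma V_linear_growth (k d eta Mv : R) : 0 <= k -> 0 <= d -> 0 <= eta ->
  (forall s, Br s -> 'D_(G rho s) Vs s <= - (d * excess eta (Vs s)) + k * `|er s|) ->
  (forall s, Br s -> `|er s| <= Mv) ->
  forall t, 0 <= t -> t <= T -> Vs (y t) <= Vs (y 0) + k * Mv * t.
Proof.
move=> k0 d0 e0 Hd HM t t0 tT.
have [M M0 HMM] := G_bounded rho0 cc2.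
rewrite -lerBlDl -[t in leRHS]subr0; apply: (@rdle_le _ (Vs \o y)) => //.
  move=> r r0 rt; have rT := le_trans rt tT.
  have lc : lcont y r by exact: (sol_on_lcont r0 rT sy).
  by apply: (lcont_comp lc); apply: Vs_cont; apply: (gy _ rT).1; exact: ltW.
move=> r r0 rt; have rT := lt_le_trans rt tT.
apply: (@sol_rdle_along _ _ K (Good cc) (G rho) 0 T y r M Vs (fun=> k * Mv)) => //.
- by move=> q rq qT; apply: gy => //; exact: le_trans rq.
- move=> q [[[Dq _] _ _] _].
  have [[_ C1V] _ _ _ _] := lyap.
  apply: (@differentiable_comp _ _ _ _ (fun s : St => usubmx s) V); first exact: differentiable_usubmx.
  exact: (C1V _ Dq).1.
- move=> v; have [[_ C1V] _ _ _ _] := lyap; have [[[Dt _] _ _] _] := gy r0 (ltW rT).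
  rewrite (_ : 'D_v Vs = fun s : St => 'D_(usubmx v) V (usubmx s)); last first.
    by apply/funext => s; apply: derive_line => q; rewrite /Vs linearD linearZ.
  apply: (@continuous_comp _ _ _ (fun s : St => usubmx s) ('D_(usubmx v) V)); first exact: usubmx_continuous.
  exact: (C1V _ Dt).2.
- exact: continuous_cst_at.
- move=> q [Bq _]; apply: le_trans (Hd q Bq) _.
  apply: (@le_trans _ _ (k * `|er q|)); last by apply: ler_wpM2l => //; exact: HM.
  by rewrite gerDr oppr_le0 mulr_ge0 // /excess le_min e0 le_max lexx.
Qed.

End one_solution.

Lemma V_ge0 chi : D chi -> 0 <= V chi.
Proof.
have [_ [K1 _ _] Da _ bV] := lyap => Dc; have [h1 _ _] := bV _ Dc; apply: le_trans h1.
by apply: class_K_ge0 K1 _ (Da _ Dc); exact: sqrtr_ge0.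
Qed.

Lemma small_state (eps : R) : 0 < eps -> exists2 eta : R, 0 < eta & forall s, Br s ->
  Vs s < eta -> `|er s| < eta -> enorm s < eps.
Proof.
move=> e0; have [k k0 Hk] := branch_inv_lipschitz sf sh obsH lyap Om0 adm bf.
have [_ [[a10 a1i _] _ _] Da _ bV] := lyap.
(* chi of norm at most e1 and xhat within e1 of x give s a sup norm of at most 2 e1, hence
   [enorm s <= eps / 2]. *)
pose m := (n + nu + n)%N; pose e1 := eps / m.+1%:R / 4.
have e10 : 0 < e1 by rewrite !divr_gt0.
have [eta1 eta10 H1] : exists2 eta1 : R, 0 < eta1 & forall chi, D chi -> V chi < eta1 -> enorm chi < e1.
  have [ea|ea] := boolP (e1%:E < a)%E; last first.
    (* Here a <= e1, and every chi in D already has norm below a. *)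
    by exists 1 => // chi Dc _; rewrite -lte_fin; apply: lt_le_trans (Da _ Dc) _; rewrite leNgt.
  exists (alpha1 e1); first by rewrite -a10; exact: a1i.
  move=> chi Dc Vc; rewrite ltNge; apply/negP => ge; have [h1 _ _] := bV _ Dc.
  have : alpha1 e1 <= alpha1 (enorm chi).
    move: ge; rewrite le_eqVlt => /orP[/eqP <- //|lt]; apply: ltW; apply: a1i => //; [exact: ltW|exact: Da].
  by move=> /le_trans /(_ h1); rewrite leNgt Vc.
exists (Num.min eta1 (e1 / k)); first by rewrite lt_min eta10 divr_gt0.
move=> s Bs; rewrite !lt_min => /andP[Vs1 _] /andP[_ er1].
have [[Ds _] _ _] := Bs.
have h1 : `|usubmx s| <= e1 by apply: le_trans (enorm_ge _) _; apply: ltW; exact: H1.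
have h2 : `|xh s - xx s| <= e1.
  by apply: le_trans (Hk s Bs) _; rewrite mulrC -ler_pdivlMr //; exact: ltW.
have h3 : `|xh s| <= e1 + e1.
  by rewrite -[xh s](subrK (xx s)); apply: le_trans (ler_normD _ _) _; apply: lerD => //; apply: le_trans (usubmx_le _) h1.
have h4 : `|s| <= 2 * e1.
  by rewrite -[s]vsubmxK; apply: col_mx_le; lra.
apply: le_lt_trans (enorm_le s) _; rewrite mulrC -ltr_pdivlMr //.
apply: le_lt_trans h4 _; have : 0 < eps / m.+1%:R by rewrite divr_gt0.
rewrite /e1; move: (eps / _) => q q0; lra.
Qed.

Lemma Br0 : Br 0.
Proof.
rewrite /Br /branch /= !linear0; split => //.
  by apply: (Ox_X adm); exists 0 => //; rewrite linear0.
by apply: (Ox_C adm); exists 0 => //; rewrite linear0.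
Qed.

Lemma er0 : er 0 = 0.
Proof. by rewrite /err !linear0 subrr. Qed.

(** The constraint K alone allows xhat outside X; near the origin, a point of the branch,
    [branch_open] excludes this. *)
Lemma near_origin (k eta : R) : 0 < c2 -> 0 < eta -> 0 <= k -> exists2 d : R, 0 < d & forall s, K s -> `|s| < d ->
  Br s /\ Vs s + k * `|er s| < eta.
Proof.
move=> c20 e0 k0; have [d1 d10 H1] := branch_open sf sh obsH adm Br0.
pose g (s : St) := Vs s + k * `|er s|.
have cg : {for 0, continuous g}.
  apply: contD; first exact: (Vs_cont Br0).
  apply: contM; first exact: continuous_cst_at.
  by apply: (@continuous_comp _ _ _ er (fun x => `|x|)); [exact: er_cont|exact: norm_continuous].
have g0 : g 0 = 0 by rewrite /g er0 normr0 mulr0 addr0 /Vs linear0 (V0).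
have nO : \forall p \near (0 : St), Om (usubmx p).
  by apply: (near_Om lyap); rewrite linear0 ?(V0) //; exact: Om0.1.
move: cg => /cvgrPdist_lt /(_ _ e0) ng.
have /nbhs_ballP[d2 /= d20 H2] : \forall p \near (0 : St), Om (usubmx p) /\ `|g 0 - g p| < eta by exact: filterI.
exists (Num.min d1 d2); first by rewrite lt_min d10.
move=> s Ks; rewrite lt_min => /andP[s1 s2].
have [|Os gs] := H2 s; first by rewrite -ball_normE /= sub0r normrN.
split; first by apply: H1 => //; rewrite subr0.
by move: gs; rewrite g0 sub0r normrN ltr_norml => /andP[].
Qed.

(** * Confinement, attraction and stability for a fixed gain *)

Section fixed_gain.
Variables (rho cc c kp k Mv : R).
Hypothesis rho0 : 0 < rho.
Hypothesis cc0 : 0 < cc.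
Hypothesis cc2 : cc < c2.
Hypothesis c0 : 0 < c.
Hypothesis kp0 : 0 < kp.
Hypothesis k0 : 0 < k.
Hypothesis Mv0 : 0 < Mv.
Hypothesis contr : forall s, Br s -> [/\ 'D_(G rho s) (W rho) s <= - (c / rho) * W rho s,
     `|er s| ^+ 2 <= kp * W rho s & W rho s <= kp * (rho ^- n * `|er s|) ^+ 2].
Hypothesis drift : forall eta : R, 0 < eta -> exists2 d : R, 0 < d &
  forall s, Br s -> 'D_(G rho s) Vs s <= - (d * excess eta (Vs s)) + k * `|er s|.
Hypothesis erM : forall s, Br s -> `|er s| <= Mv.

Let w := c / (2 * rho).
Let E (p : St) := kp * (rho ^- n * `|er p|).

Lemma w_gt0 : 0 < w.
Proof. by rewrite divr_gt0 // mulr_gt0. Qed.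

Lemma E_ge0 p : 0 <= E p.
Proof. by rewrite !mulr_ge0 ?(ltW kp0) // invr_ge0 exprn_ge0 // ltW. Qed.

Lemma A_ge0 p : 0 <= k * E p / w.
Proof. by apply: divr_ge0; [apply: mulr_ge0; [exact: ltW|exact: E_ge0]|exact: ltW w_gt0]. Qed.

(* On [0, tau] the crude rate k Mv is used, after tau the decay of the error. *)
Definition budget (tau : R) (p : St) :=
  [/\ Br p, 0 <= tau & Vs p + k * Mv * tau + k * E p / w * expR (- (w * tau)) < cc].

Lemma sol_on_restrict (T t : R) y : t <= T -> sol_on K (G rho) 0 T y -> sol_on K (G rho) 0 t y.
Proof. by move=> tT sy r r0 rt; apply: sy => //; exact: le_trans tT. Qed.

Lemma confined (tau T : R) y p : budget tau p -> 0 <= T -> sol_on K (G rho) 0 T y -> y 0 = p ->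
  forall t, 0 <= t -> t <= T -> Good cc (y t).
Proof.
move=> [Bp tau0 bud] T0 sy yp; have w0 := w_gt0; have k0' := ltW k0.
have A0 := A_ge0 p.
(* The value eta = 1 is arbitrary: confinement uses only the sign of the dissipation. *)
have [d d0 Hd] := drift ltr01.
have d0' := ltW d0.
apply: (trap cc2 T0 sy); rewrite ?yp //.
  apply: le_lt_trans bud; rewrite -addrA lerDl; apply: addr_ge0; first by rewrite !mulr_ge0 // ltW.
  by apply: mulr_ge0 => //; exact: expR_ge0.
move=> t t0 tT gt_; have sy' := sol_on_restrict tT sy.
have HE := err_decay rho0 cc2 sy' gt_ c0 kp0 contr.
rewrite yp -/(E p) -/w in HE.
have [tt|tt] := leP t tau.
  have h1 := V_linear_growth rho0 cc2 sy' gt_ k0' d0' ler01 Hd erM t0 (lexx t).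
  apply: le_lt_trans h1 _; apply: le_lt_trans bud; rewrite yp -addrA lerD2l.
  apply: (@le_trans _ _ (k * Mv * tau)); first by rewrite ler_wpM2l // mulr_ge0 // ltW.
  by rewrite lerDl mulr_ge0 ?expR_ge0.
have gtau r : 0 <= r -> r <= tau -> Good cc (y r).
  by move=> r0 rt; apply: gt_ => //; apply: le_trans rt (ltW tt).
have sytau := sol_on_restrict (ltW tt) sy'.
have h1 := V_linear_growth rho0 cc2 sytau gtau k0' d0' ler01 Hd erM tau0 (lexx tau).
have h2 := V_growth rho0 cc2 sy' gt_ k0' w0 d0' ler01 (E_ge0 p) Hd HE tau0 (ltW tt) (lexx t).
apply: le_lt_trans bud; rewrite -yp in h2 *.
have h3 : 0 <= k * E (y 0) / w * expR (- (w * t)) by apply: mulr_ge0; [exact: A_ge0|exact: expR_ge0].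
apply: (@le_trans _ _ (Vs (y t) + k * E (y 0) / w * expR (- (w * t)))); first by rewrite lerDl.
by apply: le_trans h2 _; rewrite lerD2r.
Qed.

(** V plus the exponential tail is nonincreasing. Once the tail is at most eta and V is below 2 eta,
    V remains below 3 eta < e. If V never fell below 2 eta, the sum would decrease at rate d eta for
    ever, although it is nonnegative. *)
Lemma complete_V_vanish tau y p (e : R) : budget tau p -> solution K (G rho) +oo%E y -> y 0 = p -> 0 < e ->
  exists T0 : R, forall t, T0 <= t -> 0 <= t /\ Vs (y t) < e.
Proof.
move=> bp sy yp e0; have w0 := w_gt0; have k0' := ltW k0.
have sT (T : R) : sol_on K (G rho) 0 T y by exact: ((solutionP K (G rho) +oo%E y).1 sy T (ltry T)).
have gT t : 0 <= t -> Good cc (y t) by move=> t0; apply: (confined bp t0 (sT t) yp).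
have A0 := A_ge0 p.
pose eta := e / 4; have eta0 : 0 < eta by rewrite divr_gt0.
have [d d0 Hd] := drift eta0; have d0' := ltW d0.
have HE (T : R) := err_decay rho0 cc2 (sT T) (fun t t0 _ => gT t t0) c0 kp0 contr.
rewrite yp -/(E p) -/w in HE.
have [T0 T00 HT0] := expR_vanish A0 w0 eta0.
pose g t := Vs (y t) + k * E p / w * expR (- (w * t)).
have gmono r t : 0 <= r -> r <= t -> g t <= g r.
  move=> r0 rt.
  exact: (V_growth rho0 cc2 (sT t) (fun t t0 _ => gT t t0) k0' w0 d0' (ltW eta0) (E_ge0 p) Hd (HE t) r0 rt (lexx t)).
have g0 t : 0 <= t -> 0 <= g t.
  move=> t0; apply: addr_ge0; last by apply: mulr_ge0; [exact: A0|exact: expR_ge0].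
  by apply: V_ge0; have [[[]]] := gT t t0.
have [[t1 T01 Ht1]|no] := pselect (exists2 t1, T0 <= t1 & Vs (y t1) < 2 * eta).
  have t10 := le_trans T00 T01; exists t1 => t tt; have t0 := le_trans t10 tt; split=> //.
  have h1 := gmono t1 t t10 tt; have h2 := HT0 t1 T01.
  have h3 : 0 <= k * E p / w * expR (- (w * t)) by apply: mulr_ge0; [exact: A0|exact: expR_ge0].
  apply: (@le_lt_trans _ _ (g t)); first by rewrite lerDl.
  apply: le_lt_trans h1 _; apply: (@le_lt_trans _ _ (Vs (y t1) + eta)); first by rewrite lerD2l.
  by move: Ht1; rewrite /eta; lra.
(* By this time g would have lost [g T0 + 1], more than it has. *)
pose T1 := T0 + (g T0 + 1) / (d * eta).
have de : 0 < d * eta by rewrite mulr_gt0.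
have T01 : T0 <= T1 by rewrite lerDl divr_ge0 ?(ltW de) // addr_ge0 ?g0.
have [h1 h2] := V_along rho0 cc2 (sT T1) (fun t t0 _ => gT t t0) k0' w0 d0' Hd (HE T1).
have : g T1 - g T0 <= - (d * eta) * (T1 - T0).
  apply: rdle_le => // [t Tt tT|t Tt tT]; first by apply: h1 => //; exact: le_lt_trans Tt.
  have t0 := le_trans T00 Tt; apply: rdle_weaken (h2 t t0 tT) _; rewrite lerN2 ler_pM2l //.
  have Vt : 2 * eta <= Vs (y t) by rewrite leNgt; apply/negP => lt; apply: no; exists t.
  by rewrite /excess le_min lexx le_max; apply/orP; right; rewrite lerBrDr -mulr2n -mulr_natl.
have -> : - (d * eta) * (T1 - T0) = - (g T0 + 1) by rewrite /T1; field; rewrite !gt_eqF.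
have := g0 T1 (le_trans T00 T01); lra.
Qed.

Lemma complete_cvg0 tau y p : budget tau p -> solution K (G rho) +oo%E y -> y 0 = p ->
  y t @[t --> +oo%R] --> (0 : St).
Proof.
move=> bp sy yp; have w0 := w_gt0.
have sT (T : R) : sol_on K (G rho) 0 T y by exact: ((solutionP K (G rho) +oo%E y).1 sy T (ltry T)).
have gT t : 0 <= t -> Good cc (y t) by move=> t0; apply: (confined bp t0 (sT t) yp).
apply/cvgrPdist_lt => e e0; have [eta eta0 Heta] := small_state e0.
have [T1 HT1] := complete_V_vanish bp sy yp eta0.
have eta20 : 0 < eta / 2 by rewrite divr_gt0.
have [T2 T20 HT2] := expR_vanish (E_ge0 p) w0 eta20.
exists (Num.max T1 T2); split; first exact: num_real.
move=> t; rewrite gt_max => /andP[/ltW t1 /ltW t2]; have [t0 Vt] := HT1 t t1.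
rewrite sub0r normrN; apply: le_lt_trans (enorm_ge _) _; apply: Heta => //; first by case: (gT t t0).
have := err_decay rho0 cc2 (sT t) (fun t t0 _ => gT t t0) c0 kp0 contr t0 (lexx t).
rewrite yp -/(E p) -/w => /le_lt_trans; apply; apply: le_lt_trans (HT2 t t2) _.
by rewrite ltr_pdivrMr // mulr_natr mulr2n ltrDl.
Qed.

Lemma budget_attracted tau p : budget tau p -> region_of_attraction K (G rho) p.
Proof.
move=> bp.
have [tl tl0 Htl] := local_existence L n0 sf sh sphi obsH lyap Om0 adm bf uS rho0 cc2.
have [M M0 HM] := G_bounded rho0 cc2.
apply: (@region_intro _ _ K (Good cc) (G rho) tl M p) => //.
- by apply: compact_closed; [exact: norm_hausdorff|exact: (good_compact sf sh obsH lyap Om0 adm bf (c:=cc))].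
- by move=> s [[_ _ Cs] _].
- have [Bp tau0 bud] := bp; split => //; apply: ltW; apply: le_lt_trans bud.
  rewrite -addrA lerDl; apply: addr_ge0; first by rewrite !mulr_ge0 // ltW.
  by apply: mulr_ge0; [exact: A_ge0|exact: expR_ge0].
- by move=> T y T0 sy yp; apply: (confined bp T0 sy yp).
- by move=> y sy yp; apply: complete_cvg0 bp sy yp.
Qed.

(** For fixed rho the bound E is linear in the error, so near the origin the budget is met with a
    window of length 0; kk dominates both coefficients of the error. *)
Lemma origin_budget (eta : R) : 0 < eta -> exists2 d : R, 0 < d & forall p, K p -> enorm p < d ->
  [/\ budget 0 p, Vs p + k * E p / w < eta & E p < eta].
Proof.
move=> eta0; have w0 := w_gt0.
pose q := kp * rho ^- n; have q0 : 0 <= q by rewrite mulr_ge0 ?(ltW kp0) // invr_ge0 exprn_ge0 // ltW.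
pose kk := k * q / w + q.
have kk1 : 0 <= k * q / w by apply: divr_ge0; [apply: mulr_ge0 => //; exact: ltW|exact: ltW].
have kk0 : 0 <= kk by rewrite addr_ge0.
have m0 : 0 < Num.min cc eta by rewrite lt_min cc0.
have [d d0 Hd] := near_origin (lt_trans cc0 cc2) m0 kk0; exists d => // p Kp pd.
have [Bp] := Hd p Kp (le_lt_trans (enorm_ge p) pd).
have V0' : 0 <= Vs p by apply: V_ge0; have [[]] := Bp.
have e1 : k * E p / w = k * q / w * `|er p| by rewrite /E /q; ring.
have e2 : E p = q * `|er p| by rewrite /E /q; ring.
have n1 : 0 <= q * `|er p| by rewrite mulr_ge0.
have n2 : 0 <= k * q / w * `|er p| by rewrite mulr_ge0.
rewrite lt_min /kk mulrDl => /andP[h1 h2].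
split; [|by rewrite e1; lra|by rewrite e2; lra].
by split => //; rewrite !mulr0 addr0 oppr0 expR0 mulr1 e1; lra.
Qed.

Lemma origin_stable : lyapunov_stable K (G rho).
Proof.
move=> eps e0; have [eta eta0 Heta] := small_state e0.
have [d d0 Hd] := origin_budget eta0; exists d => // T y sy yd t t0 tT.
have w0 := w_gt0.
have sT : sol_on K (G rho) 0 t y by exact: ((solutionP K (G rho) T y).1 sy t tT).
have K0 : K (y 0) by have [] := sT 0 (lexx 0) t0.
have [bp h1 h2] := Hd _ K0 yd.
have gt_ := confined bp t0 sT erefl.
have HE := err_decay rho0 cc2 sT gt_ c0 kp0 contr.
have [dd dd0 Hdd] := drift ltr01.
have h3 := V_growth rho0 cc2 sT gt_ (ltW k0) w0 (ltW dd0) ler01 (E_ge0 (y 0)) Hdd HE (lexx 0) t0 (lexx t).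
have A0 := A_ge0 (y 0).
apply: Heta; first by case: (gt_ t t0 (lexx t)).
  apply: le_lt_trans h1; rewrite mulr0 oppr0 expR0 mulr1 in h3; apply: le_trans h3.
  by rewrite lerDl; apply: mulr_ge0; [exact: A0|exact: expR_ge0].
apply: le_lt_trans (HE t t0 (lexx t)) _; apply: le_lt_trans h2; rewrite -[leRHS]mulr1 -/(E (y 0)).
apply: ler_wpM2l; first exact: E_ge0.
by rewrite -[leRHS]expR0 ler_expR oppr_le0; apply: mulr_ge0 => //; exact: ltW w0.
Qed.

End fixed_gain.

End trajectories.

(** * Equilibrium at the origin and choice of the gain *)

Lemma closed_loop0 (R : realType) (n nu : nat) (f : 'cV[R]_n -> R -> 'cV[R]_n) (h : 'cV[R]_n -> R -> R)
    (phi : 'cV[R]_(n + nu) -> R) (L : 'cV[R]_n) (S : 'M[R]_n) (b : 'cV[R]_n -> 'cV[R]_nu -> R) (rho : R) :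
  smooth (fun p : ('cV[R]_n * R)%type => f p.1 p.2) ->
  smooth (fun p : ('cV[R]_n * R)%type => h p.1 p.2) ->
  C1_on setT (fun p : ('cV[R]_n * 'cV[R]_nu)%type => b p.1 p.2) ->
  Hx (nu := nu) f h 0 \in unitmx -> ext_field f (0 : 'cV[R]_(n + nu)) (phi 0) = 0 ->
  closed_loop f h phi L S b rho 0 = 0.
Proof.
move=> sf sh bC1 uH F0.
have v0 : vin phi (0 : 'cV[R]_(n + nu + n)) = phi 0 by rewrite /vin !linear0 col_mx0.
have ff0 : free_field f h phi L rho 0 = 0.
  rewrite /free_field v0 linear0 F0 -[RHS]col_mx0; congr col_mx.
  rewrite /ofield /observer_field v0 /ext_output !linear0 subrr scale0r addr0.
  by have := congr1 usubmx F0; rewrite /ext_field col_mxKu !linear0.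
rewrite closed_loop_reflected // /reflected ff0.
(* The rate is the derivative of the level along the free field, which vanishes at 0. *)
have -> : rate f h phi L rho b 0 = 0.
  by rewrite -derive_level_free // ff0 deriveE ?linear0 //; exact: diff_level.
by rewrite scale0r subrr if_same.
Qed.

Theorem theorem2 (R : realType) (n nu : nat)
    (f : 'cV[R]_n -> R -> 'cV[R]_n) (h : 'cV[R]_n -> R -> R)
    (X : set 'cV[R]_n) (U : set 'cV[R]_nu)
    (phi : 'cV[R]_(n + nu) -> R)
    (D : set 'cV[R]_(n + nu)) (V : 'cV[R]_(n + nu) -> R)
    (a : \bar R) (alpha1 alpha2 alpha3 : R -> R)
    (c1 c2 : R)
    (C : 'cV[R]_nu -> set 'cV[R]_n) (b : 'cV[R]_n -> 'cV[R]_nu -> R)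
    (L : 'cV[R]_n) (P S : 'M[R]_n)
    (D' : set 'cV[R]_(n + nu)) :
  let H := obs_map (nu := nu) f h in
  let F := fun chi : 'cV[R]_(n + nu) => ext_field f chi (phi chi) in
  let Omega := sublevel D V in
  let Omega2x := [set usubmx chi | chi in Omega c2] in
  let Omega2z := [set dsubmx chi | chi in Omega c2] in
  let A := Ac R n - L *m Cc R n in
  (0 < n)%N ->
  smooth (fun p : ('cV[R]_n * R)%type => f p.1 p.2) ->
  smooth (fun p : ('cV[R]_n * R)%type => h p.1 p.2) ->
  f 0 0 = 0 ->
  (nu <= n)%N -> depends_on_first f h nu ->
  observable H X U ->
  stabilizable f ->
  smooth phi ->
  asymptotically_stable setT F ->
  D = region_of_attraction setT F ->
  lyapunov_function F D V a alpha1 alpha2 alpha3 ->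
  0 < c1 -> c1 < c2 ->
  admissible_sets H X U Omega2x Omega2z C ->
  boundary_function Omega2z C b ->
  hurwitz A ->
  P *m A + A^T *m P = - 1%:M ->
  S^T = S -> S *m S = P ->
  compact D' -> D' `<=` Omega c1 ->
  exists rho_star : R, [/\ 0 < rho_star, rho_star <= 1 &
    forall rho : R, 0 < rho -> rho <= rho_star ->
      let K := closed_loop_states f h C in
      let G := closed_loop f h phi L S b rho in
      asymptotically_stable K G /\
      [set s | D' (usubmx s) /\ Omega2x (dsubmx s)]
        `<=` region_of_attraction K G].
Proof.
move=> H F Omega Omega2x Omega2z A n0 sf sh _ _ dep obsH _ sphi asF DE lyap c10 c12 adm bf _ PA ST SS _ D'O.
have e0 m : enorm (0 : 'cV[R]_m) = 0 by rewrite /enorm big1 ?sqrtr0 // => i _; rewrite mxE expr0n.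
have D0 : D 0 by have [_ _ [r r0 Hr]] := asF; rewrite DE; apply: Hr => //; rewrite e0.
have Om0 : sublevel D V c2 0.
  split => //; have [_ [_ [a20 _ _] _] _ _ bV] := lyap; have [_ h1 _] := bV _ D0.
  by apply: le_trans h1 _; rewrite e0 a20 ltW // (lt_trans c10).
have cBr := branch_compact sf sh obsH lyap Om0 adm bf.
have [c [kp [rho1 [cgt kpgt rho1gt contr]]]] := err_contraction n0 sf sh sphi dep obsH lyap Om0 adm bf PA ST SS.
have [k kgt Vdrift] := V_drift L S n0 sf sh sphi obsH lyap Om0 adm bf.
have [Mv Mvgt erM] : exists2 Mv : R, 0 < Mv & forall s, branch f h X D V c2 C s -> `|err f h s| <= Mv.
  have cE : compact (err (nu := nu) f h @` branch f h X D V c2 C).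
    apply: continuous_compact cBr; apply: continuous_subspaceT => s.
    by apply: cV_continuous => i; apply: differentiable_continuous; exact: diff_err.
  have [M [Mr HM]] := compact_bounded cE.
  exists (Num.max 1 (M + 1)); first by rewrite lt_max ltr01.
  move=> s Bs; apply: HM; last by exists s.
  by rewrite lt_max ltrDl ltr01 orbT.
have drift rho (eta : R) : 0 < eta -> exists2 d : R, 0 < d & forall s, branch f h X D V c2 C s ->
    'D_(closed_loop f h phi L S b rho s) (fun s => V (usubmx s)) s
      <= - (d * excess eta (V (usubmx s))) + k * `|err f h s|.
  move=> eta0; have [d d0 Hd] := alpha3_lower lyap Om0 eta0; exists d => // s Bs.
  apply: le_trans (Vdrift rho s Bs) _; rewrite lerD2r lerN2; apply: Hd.
  by have [[]] := Bs.
(* One gap is spent on the growth during the window and one on the tail; the third keeps the budget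
   strict. *)
pose cc := (c1 + c2) / 2; pose gap := (cc - c1) / 3.
have cc0 : 0 < cc by rewrite /cc; lra.
have cc2 : cc < c2 by rewrite /cc; lra.
have gap0 : 0 < gap by rewrite /gap /cc; lra.
(* At the rate [k * Mv] the window costs exactly one gap, whatever rho. *)
pose tau := gap / (k * Mv).
have kM0 : 0 < k * Mv by rewrite mulr_gt0.
have tau0 : 0 < tau by rewrite divr_gt0.
(* Bound of [k * E / w] up to its factor rho^-n, where w = c / (2 rho) and rho <= 1. *)
pose B := 2 * (k * kp * Mv) / c.
have B0 : 0 <= B by rewrite /B divr_ge0 ?mulr_ge0 // ltW.
have bt0 : 0 < c * tau / 2 by rewrite divr_gt0 // mulr_gt0.
have [rho2 rho20 Hrho2] := gain_vanish n B0 bt0 gap0.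
exists (Num.min 1 (Num.min rho1 rho2)); split.
- by rewrite !lt_min ltr01 rho1gt rho20.
- by rewrite ge_min lexx.
move=> rho rho0; rewrite !le_min => /and3P[rle1 rle_1 rle_2] K G.
have ctr s := contr rho s rho0 rle1 rle_1.
have att t p : budget f h X D V c2 C rho cc c kp k Mv t p -> region_of_attraction K G p.
  exact: (budget_attracted n0 sf sh sphi obsH lyap Om0 adm bf PA ST SS rho0 cc2 cgt kpgt kgt Mvgt ctr (drift rho) erM).
split.
  split.
  - split.
      by have [] := Br0 Om0 adm.
    apply: closed_loop0 => //; first exact: bf.1.
      by apply: (branch_unit obsH adm); exact: (Br0 Om0 adm).
    by have [[_ F00] _ _] := asF.
  - exact: (origin_stable n0 sf sh sphi obsH lyap Om0 adm bf PA ST SS rho0 cc0 cc2 cgt kpgt kgt Mvgt ctr (drift rho) erM).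
  - have [d d0 Hd] := origin_budget sf sh obsH lyap Om0 adm Mv rho0 cc0 cc2 cgt kpgt kgt ltr01.
    by exists d => // p Kp pd; have [bp _ _] := Hd p Kp pd; exact: att bp.
move=> s [/D'O[Ds Vs] Oxs]; apply: (att tau).
have Os : sublevel D V c2 (usubmx s) by split => //; apply: le_trans Vs (ltW c12).
(* An initial estimate in the projection of Omega c2 lies in X and satisfies the constraint, by the
   inclusions required of the admissible sets. *)
have Bs : branch f h X D V c2 C s.
  by split => //; [exact: (Ox_X adm)|apply: (Ox_C adm) => //; exact: Om_zz].
split => //; first exact: ltW.
have h1 : k * Mv * tau = gap by rewrite /tau mulrC divfK // gt_eqF.
have rn0 : 0 < rho ^- n by rewrite invr_gt0 exprn_gt0.
have h2 : k * (kp * (rho ^- n * `|err f h s|)) / (c / (2 * rho)) * expR (- (c / (2 * rho) * tau)) <= gap.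
  have -> : c / (2 * rho) * tau = c * tau / 2 / rho by field; rewrite gt_eqF.
  apply: le_trans (Hrho2 rho rho0 rle_2); apply: ler_wpM2r; first exact: expR_ge0.
  apply: (@le_trans _ _ (k * (kp * (rho ^- n * Mv)) / (c / (2 * 1)))).
    apply: ler_pM.
    - by rewrite !mulr_ge0 // ltW.
    - by rewrite invr_ge0 divr_ge0 ?mulr_ge0 // ltW.
    - by rewrite ler_pM2l // ler_pM2l // ler_pM2l //; exact: erM.
    - rewrite lef_pV2 ?posrE ?divr_gt0 ?mulr_gt0 //.
      by rewrite ler_pM2l // lef_pV2 ?posrE ?mulr_gt0 // ler_pM2l.
  rewrite le_eqVlt; apply/orP; left; apply/eqP; rewrite /B.
  by field; rewrite !gt_eqF // exprn_gt0.
rewrite h1; apply: (@le_lt_trans _ _ (c1 + gap + gap)); first by rewrite lerD // lerD2r.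
by rewrite /gap /cc; lra.
Qed.
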